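(* Let $L/K$ be a Galois extension of fields of characteristic $0$ and let $\Gamma_K=(\Gamma,\rho)$ be a $K$-rational quiver with respect to $L/K$ whose underlying quiver $\Gamma$ is connected and of type $A$, $D$ or $E$. Let $\Delta$ be the root system associated with the Dynkin diagram underlying $\Gamma$ and $\Delta_+\subseteq\Delta$ its set of positive roots. Then $\Gamma_K$ is representation finite, and the set of isomorphism classes of indecomposable representations of $\Gamma_K$ over $K$ (that is, of indecomposable $K$-rational representations of $\Gamma_K$) is in canonical bijection with the set of $\mathrm{Gal}(L/K)$-orbits on $\Delta_+$, where $\mathrm{Gal}(L/K)$ acts on $\Delta$ by the canonical extension of its given action on the Dynkin diagram underlying $\Gamma$.
   Context: A quiver $\Gamma=(V,E,s,t)$ consists of finite sets $V$ of vertices and $E$ of edges and source and target maps $s,t\colon E\to V$. It is of type $A$, $D$ or $E$ if its underlying undirected graph is a Dynkin diagram of that type (any orientation allowed). For a Galois extension $L/K$, a $K$-rational structure on $\Gamma$ is a group homomorphism $\rho\colon \mathrm{Gal}(L/K)\to\mathrm{Aut}(\Gamma)$ such that the induced actions on $V$ and $E$ are continuous (for the discrete topology on $V$ and $E$); thus $s(\sigma e)=\sigma s(e)$ and $t(\sigma e)=\sigma t(e)$ for all $\sigma\in \mathrm{Gal}(L/K)$, $e\in E$. The pair $\Gamma_K=(\Gamma,\rho)$ is called a $K$-rational quiver. A $K$-rational representation $M$ of $\Gamma_K$ (with respect to $L/K$) consists of: (1) a family of $L$-vector spaces $M(v)$, $v\in V$; (2) for each $\sigma\in\mathrm{Gal}(L/K)$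 a family of $\sigma$-linear isomorphisms $\varphi_{v,\sigma}\colon M(v)\to M(\sigma v)$ satisfying the cocycle condition $\varphi_{\tau v,\sigma}\circ\varphi_{v,\tau}=\varphi_{v,\sigma\tau}$; (3) for each $e\in E$ an $L$-linear map $\phi_e\colon M(s(e))\to M(t(e))$, these maps commuting with the Galois action, i.e. $\phi_{\sigma e}\circ\varphi_{s(e),\sigma}=\varphi_{t(e),\sigma}\circ\phi_e$ for all $\sigma$ and $e$. Morphisms are families of $L$-linear maps $M(v)\to N(v)$ commuting with all $\phi_e$ and all $\varphi_{v,\sigma}$. A representation is indecomposable if it is nonzero and not a direct sum of two nonzero subrepresentations. ''Representation finite'' means that there are only finitely many isomorphism classes of indecomposable representations. The simple roots $\alpha_v$ of $\Delta$ are indexed by the vertices $v$ of $\Gamma$; $\sigma\in\mathrm{Gal}(L/K)$ acts by $\sigma\alpha_v=\alpha_{\sigma v}$, extended linearly to $\Delta$. The bijection is given as follows: for an orbit $\mathcal O\subseteq\Delta_+$ choose $\alpha\in\mathcal O$ with stabilizer $G_\alpha\subseteq\mathrm{Gal}(L/K)$; the indecomposable representation of $\Gamma$ over $L$ whose dimension vector is given by the coefficients of $\alpha$ is defined over the fixed field $L^{G_\alpha}$, and its restriction of scalars from $L^{G_\alpha}$ to $K$ is the indecomposable representation of $\Gamma_K$ attached to $\mathcal O$ (independent of the choice of $\alpha$).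
   Formalization: K-rational representations (and forms over fixed fields) are required to have continuous semilinear Galois action on the spaces M(v); this is automatic for finite L/K, and without it the claim fails for infinite L/K, e.g. A_1 twisted by a discontinuous character. *)

(* Defs.v *)
From HB Require Import structures.
From mathcomp Require Import all_boot all_order all_algebra all_field.
From mathcomp Require Import boolp.

Set Implicit Arguments.
Unset Strict Implicit.
Unset Printing Implicit Defensive.

Import GRing.Theory.
Local Open Scope ring_scope.

Section Galois.
Variables (K L : fieldType) (iota : {rmorphism K -> L}).

Definition algebraic_extension : Prop := forall x : L, algebraicOver iota x.

Definition normal_extension : Prop :=
  forall p : {poly K}, irreducible_poly p ->
    (exists x : L, root (map_poly iota p) x) ->
    exists rs : seq L, map_poly iota p %= \prod_(r <- rs) ('X - r%:P).

Definition separable_extension : Prop :=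
  forall x : L, exists2 p : {poly K}, separable_poly p & root (map_poly iota p) x.

Definition galois_extension : Prop :=
  [/\ algebraic_extension, normal_extension & separable_extension].

Definition is_automorphism (f : L -> L) : Prop :=
  [/\ zmod_morphism f, GRing.monoid_morphism f, bijective f
    & forall x : K, f (iota x) = iota x].

(* Gal(L/K), with (s * t) x = s (t x). *)
Record Gal : Type := MkGal { gal_fun :> L -> L; galP : is_automorphism gal_fun }.

Lemma gal_ext (s t : Gal) : s =1 t -> s = t.
Proof.
case: s t => [f fP] [g gP] /= fg; have {}fg : f = g by apply: funext.
by case: _ / fg gP => gP; rewrite (Prop_irrelevance fP gP).
Qed.

HB.instance Definition _ := gen_eqMixin Gal.
HB.instance Definition _ := gen_choiceMixin Gal.

HB.instance Definition _ (s : Gal) :=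
  GRing.isZmodMorphism.Build L L s (let: And4 h _ _ _ := galP s in h).
HB.instance Definition _ (s : Gal) :=
  GRing.isMonoidMorphism.Build L L s (let: And4 _ h _ _ := galP s in h).

Lemma gal_bij (s : Gal) : bijective s. Proof. by case: (galP s). Qed.

Lemma gal_fix (s : Gal) (x : K) : s (iota x) = iota x.
Proof. by case: (galP s). Qed.

Lemma gal1_subproof : is_automorphism id.
Proof. by split=> //; exists id. Qed.
Definition gal_one := MkGal gal1_subproof.

Lemma galM_subproof (s t : Gal) : is_automorphism (s \o t).
Proof.
split=> [x y||| x] /=.
- by rewrite !rmorphB.
- by split=> [|x y] /=; rewrite ?rmorph1 ?rmorphM.
- exact: bij_comp (gal_bij s) (gal_bij t).
- by rewrite !gal_fix.
Qed.
Definition gal_mul (s t : Gal) := MkGal (galM_subproof s t).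

Lemma gal_inv_ex (s : Gal) : exists g : L -> L, cancel s g /\ cancel g s.
Proof. by case: (gal_bij s) => g; exists g. Qed.
Definition gal_inv_fun (s : Gal) : L -> L := projT1 (cid (gal_inv_ex s)).
Lemma gal_invK (s : Gal) : cancel s (gal_inv_fun s).
Proof. by rewrite /gal_inv_fun; case: cid => g []. Qed.
Lemma gal_funK (s : Gal) : cancel (gal_inv_fun s) s.
Proof. by rewrite /gal_inv_fun; case: cid => g []. Qed.

Lemma galV_subproof (s : Gal) : is_automorphism (gal_inv_fun s).
Proof.
have sI := bij_inj (gal_bij s); split=> [x y||| x].
- by apply: sI; rewrite rmorphB /= !gal_funK.
- by split=> [|x y]; apply: sI; rewrite ?rmorphM /= !gal_funK ?rmorph1.
- by exists s => y; rewrite ?gal_funK ?gal_invK.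
- by apply: sI; rewrite gal_funK gal_fix.
Qed.
Definition gal_inv (s : Gal) := MkGal (galV_subproof s).

Arguments gal_inv : simpl never.

Lemma gal_mulA : associative gal_mul.
Proof. by move=> s t u; apply: gal_ext. Qed.
Lemma gal_mul1g : left_id gal_one gal_mul.
Proof. by move=> s; apply: gal_ext. Qed.
Lemma gal_mulg1 : right_id gal_one gal_mul.
Proof. by move=> s; apply: gal_ext. Qed.
Lemma gal_mulVg : left_inverse gal_one gal_inv gal_mul.
Proof. by move=> s; apply: gal_ext => x; apply: gal_invK. Qed.
Lemma gal_mulgV : right_inverse gal_one gal_inv gal_mul.
Proof. by move=> s; apply: gal_ext => x; apply: gal_funK. Qed.

HB.instance Definition _ := isGroup.Build Gal
  gal_mulA gal_mul1g gal_mulg1 gal_mulVg gal_mulgV.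

Lemma gal_mulKV (s t : Gal) (x : L) : t ((s * t)^-1%g x) = s^-1%g x.
Proof.
suff /(congr1 (fun u : Gal => u x)) : (t * (s * t)^-1 = s^-1)%g by [].
by rewrite invgM mulgA mulgV mul1g.
Qed.

(* Intermediate fields are given by their sets of elements; [gal_over F] is
   Gal(L/F), as a subgroup of Gal(L/K). *)
Definition base_field : L -> Prop := fun x => exists a : K, x = iota a.
Definition whole_field : L -> Prop := fun=> True.
Definition fixed_field (H : Gal -> Prop) : L -> Prop :=
  fun x => forall s : Gal, H s -> s x = x.
Definition gal_over (F : L -> Prop) (s : Gal) : Prop :=
  forall x : L, F x -> s x = x.

(* In the Krull topology of Gal(L/F), the pointwise stabilizers of finite
   subsets of L form a basis of neighbourhoods of 1. *)
Definition krull_nbhs1 (F : L -> Prop) (A : Gal -> Prop) : Prop :=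
  exists xs : seq L, forall s : Gal,
    gal_over F s -> (forall x, x \in xs -> s x = x) -> A s.

Lemma gal_overS (F F' : L -> Prop) (s : Gal) :
  (forall x, F x -> F' x) -> gal_over F' s -> gal_over F s.
Proof. by move=> sFF' F's x /sFF'; apply: F's. Qed.

End Galois.

Record quiver : Type := Quiver {
  vert : finType;
  edge : finType;
  src : edge -> vert;
  tgt : edge -> vert }.

Section Dynkin.
Variable Gamma : quiver.
Implicit Types u v : vert Gamma.

(* Number of edges of the underlying undirected graph joining u and v
   (for u = v: number of loops at u). *)
Definition nedges u v : nat :=
  #|[set e : edge Gamma | ((src e == u) && (tgt e == v))
                       || ((src e == v) && (tgt e == u))]|.

Definition connected_quiver : Prop :=
  (exists v : vert Gamma, True) /\
  forall u v, connect [rel x y | (0 < nedges x y)%N] u v.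

End Dynkin.

(* The underlying undirected graph of Gamma is isomorphic to the simple graph on
   {0, ..., n-1} with adjacency relation adj. *)
Definition underlying_graph_iso (Gamma : quiver) (n : nat) (adj : rel nat) : Prop :=
  exists2 f : vert Gamma -> 'I_n, bijective f &
    forall u v : vert Gamma, nedges u v = adj (f u) (f v) :> nat.

(* The path 0 - 1 - ... - (n-1). *)
Definition adjA (i j : nat) : bool := (j == i.+1) || (i == j.+1).

(* The path 0 - 1 - ... - (n-2), with one more vertex n-1 attached to k. *)
Definition adj_branch (n k i j : nat) : bool :=
  [|| adjA i j && (i < n.-1)%N && (j < n.-1)%N,
      (i == n.-1) && (j == k) | (j == n.-1) && (i == k)].

Definition type_A (Gamma : quiver) : Prop :=
  exists2 n : nat, (0 < n)%N & underlying_graph_iso Gamma n adjA.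
Definition type_D (Gamma : quiver) : Prop :=
  exists2 n : nat, (3 < n)%N & underlying_graph_iso Gamma n (adj_branch n (n - 3)).
Definition type_E (Gamma : quiver) : Prop :=
  exists2 n : nat, n \in [:: 6; 7; 8] & underlying_graph_iso Gamma n (adj_branch n 2).
Definition type_ADE (Gamma : quiver) : Prop :=
  [\/ type_A Gamma, type_D Gamma | type_E Gamma].

Section Roots.
Variable Gamma : quiver.
Implicit Types (a b : {ffun vert Gamma -> int}) (u v : vert Gamma).

Definition cartan u v : int := if u == v then 2 else - (nedges u v)%:Z.

Definition simple_root v : {ffun vert Gamma -> int} := [ffun u => (u == v)%:Z].

Definition simple_reflection v a : {ffun vert Gamma -> int} :=
  a - simple_root v *~ (\sum_u a u * cartan u v).

(* The orbit of the simple roots under the Weyl group. *)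
Inductive is_root : {ffun vert Gamma -> int} -> Prop :=
| is_root_simple v : is_root (simple_root v)
| is_root_reflection v a : is_root a -> is_root (simple_reflection v a).

Definition is_positive_root a : Prop := is_root a /\ forall v, 0 <= a v.

End Roots.

Section RationalQuiver.
Variables (K L : fieldType) (iota : {rmorphism K -> L}) (Gamma : quiver).
Local Notation G := (Gal iota).

(* A homomorphism Gal(L/K) -> Aut(Gamma), given by the two actions. *)
Record rational_structure : Type := RationalStructure {
  actv : G -> vert Gamma -> vert Gamma;
  acte : G -> edge Gamma -> edge Gamma;
  actv1 : forall v, actv 1%g v = v;
  acte1 : forall e, acte 1%g e = e;
  actvM : forall s t v, actv (s * t)%g v = actv s (actv t v);
  acteM : forall s t e, acte (s * t)%g e = acte s (acte t e);
  src_act : forall s e, src (acte s e) = actv s (src e);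
  tgt_act : forall s e, tgt (acte s e) = actv s (tgt e);
  actv_continuous :
    forall v, krull_nbhs1 (base_field iota) (fun s => actv s v = v);
  acte_continuous :
    forall e, krull_nbhs1 (base_field iota) (fun s => acte s e = e) }.

End RationalQuiver.

Section Representations.
Variables (K L : fieldType) (iota : {rmorphism K -> L}) (Gamma : quiver).
Variable rho : rational_structure iota Gamma.
Local Notation G := (Gal iota).

(* F-rational representations, with respect to L/F, of the F-rational quiver
   obtained from rho by restriction to Gal(L/F).  To avoid transports along
   equalities of vertices, phi_{v,s} is indexed by v, by w and by a proof that
   w = s v. *)
Record rat_rep (F : L -> Prop) : Type := RatRep {
  space :> vert Gamma -> lmodType L;
  semi : forall s : G, gal_over F s ->
    forall v w : vert Gamma, actv rho s v = w ->
    {linear space v -> space w | (s : L -> L) \; *:%R};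
  emap : forall e : edge Gamma, {linear space (src e) -> space (tgt e)};
  semi_bij : forall s (Fs : gal_over F s) v w (vw : actv rho s v = w),
    bijective (semi Fs vw);
  semiM : forall s t (Fs : gal_over F s) (Ft : gal_over F t)
      (Fst : gal_over F (s * t)%g) u v w
      (uv : actv rho t u = v) (vw : actv rho s v = w)
      (uw : actv rho (s * t)%g u = w) (x : space u),
    semi Fs vw (semi Ft uv x) = semi Fst uw x;
  emap_semi : forall s (Fs : gal_over F s) e
      (hs : actv rho s (src e) = src (acte rho s e))
      (ht : actv rho s (tgt e) = tgt (acte rho s e)) (x : space (src e)),
    emap (acte rho s e) (semi Fs hs x) = semi Fs ht (emap e x) }.

(* The action on the disjoint union of the discrete spaces M v is continuous.
   This is automatic when L/F is finite (see rep_continuous_discrete); for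
   infinite L/F it is needed for Galois descent: twisting the action by a
   discontinuous character of Gal(L/F) gives representations without F-form. *)
Definition rep_continuous F (M : rat_rep F) : Prop :=
  forall v (x : M v), krull_nbhs1 F (fun s : G =>
    exists (Fs : gal_over F s) (vv : actv rho s v = v), semi M Fs vv x = x).

Lemma semi_id F (M : rat_rep F) (s : G) (Fs : gal_over F s) v
  (vv : actv rho s v = v) (x : M v) : s = 1%g -> semi M Fs vv x = x.
Proof.
have semi_eq t t' (Ft : gal_over F t) (Ft' : gal_over F t') (e : actv rho t v = v)
    (e' : actv rho t' v = v) (y : M v) : t = t' -> semi M Ft e y = semi M Ft' e' y.
  move=> tt'; subst t'.
  by rewrite (Prop_irrelevance Ft Ft') (Prop_irrelevance e e').
move=> s1; have ss : (s * s)%g = s by rewrite s1 mulg1.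
apply: (bij_inj (semi_bij M Fs vv)).
have Fss : gal_over F (s * s)%g by rewrite ss.
have vvss : actv rho (s * s)%g v = v by rewrite ss.
by rewrite (semiM (r := M) Fs Fs Fss vv vv vvss); apply: semi_eq.
Qed.

(* The hypothesis says that Gal(L/F) is discrete, i.e. finite. *)
Lemma rep_continuous_discrete F (M : rat_rep F) :
  krull_nbhs1 F (fun s : G => s = 1%g) -> rep_continuous M.
Proof.
move=> [xs xsP] v x; exists xs => s Fs sxs; have s1 := xsP s Fs sxs.
have vv : actv rho s v = v by rewrite s1 actv1.
by exists Fs, vv; apply: semi_id.
Qed.

Definition rep_iso F (M N : rat_rep F) : Prop :=
  exists f : forall v, {linear M v -> N v},
  [/\ forall v, bijective (f v),
      forall e (x : M (src e)), f (tgt e) (emap M e x) = emap N e (f (src e) x)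
    & forall s (Fs : gal_over F s) v w (vw : actv rho s v = w) (x : M v),
        f w (semi M Fs vw x) = semi N Fs vw (f v x)].

Record subrep F (M : rat_rep F) : Type := SubRep {
  sub_mem :> forall v, M v -> Prop;
  sub_mem0 : forall v, sub_mem (0 : M v);
  sub_memD : forall v (x y : M v), sub_mem x -> sub_mem y -> sub_mem (x + y);
  sub_memZ : forall v (c : L) (x : M v), sub_mem x -> sub_mem (c *: x);
  sub_mem_emap : forall e (x : M (src e)), sub_mem x -> sub_mem (emap M e x);
  sub_mem_semi : forall s (Fs : gal_over F s) v w (vw : actv rho s v = w) (x : M v),
    sub_mem x -> sub_mem (semi M Fs vw x) }.

Definition sub_zero F (M : rat_rep F) (U : subrep M) : Prop :=
  forall v (x : M v), U v x -> x = 0.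

Definition rep_direct_sum F (M : rat_rep F) (U W : subrep M) : Prop :=
  forall v,
    (forall x : M v, exists y z : M v, [/\ U v y, W v z & x = y + z]) /\
    (forall x : M v, U v x -> W v x -> x = 0).

Definition rep_nonzero F (M : rat_rep F) : Prop := exists v (x : M v), x <> 0.

Definition indecomposable F (M : rat_rep F) : Prop :=
  rep_nonzero M /\
  forall U W : subrep M, rep_direct_sum U W -> sub_zero U \/ sub_zero W.

Definition has_dimension_vector F (M : rat_rep F) (a : {ffun vert Gamma -> int}) : Prop :=
  forall v, exists n : nat, a v = n%:Z /\
    exists f : {linear 'rV[L]_n -> M v}, bijective f.

Definition base_change F F' (sFF' : forall x : L, F x -> F' x) (M : rat_rep F) :
  rat_rep F'.
Proof.
exists M (fun s F's v w vw => semi M (gal_overS sFF' F's) vw) (emap M).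
- by move=> *; apply: semi_bij.
- by move=> *; apply: semiM.
- by move=> *; apply: emap_semi.
Defined.

Definition base_change_top F (M : rat_rep F) : rat_rep (@whole_field L) :=
  base_change (fun _ _ => I) M.

(* After Galois descent, restriction of scalars sends N to the product of its
   conjugates under Gal(L/K) / Gal(L/F).  Its space at v is realized, without
   choice of coset representatives, as the space of the families f with
   f(g) in N(g^-1 v) (with L acting through g^-1) such that
   phi_h (f (g h)) = f g for all h in Gal(L/F). *)
Section RestrictionOfScalars.
Variables (F : L -> Prop) (N : rat_rep F).

Definition res_compatible v (f : forall (g : G) w, actv rho g w = v -> N w) : Prop :=
  forall (g h : G) (Fh : gal_over F h) w w' (e : actv rho (g * h)%g w = v)
    (e' : actv rho h w = w') (e'' : actv rho g w' = v),
    semi N Fh e' (f (g * h)%g w e) = f g w' e''.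

Record res_space v : Type := ResSpace {
  res_fun :> forall (g : G) w, actv rho g w = v -> N w;
  resP : res_compatible res_fun }.

Lemma res_ext v (f f' : res_space v) :
  (forall g w (e : actv rho g w = v), f g w e = f' g w e) -> f = f'.
Proof.
case: f f' => [f fP] [f' f'P] /= ff'.
have {}ff' : f = f'.
  apply: functional_extensionality_dep => g; apply: functional_extensionality_dep => w.
  by apply: functional_extensionality_dep => e.
by case: _ / ff' f'P => f'P; rewrite (Prop_irrelevance fP f'P).
Qed.

HB.instance Definition _ v := gen_eqMixin (res_space v).
HB.instance Definition _ v := gen_choiceMixin (res_space v).

Lemma res0_subproof v : res_compatible (fun g w (_ : actv rho g w = v) => 0 : N w).
Proof. by move=> *; rewrite linear0. Qed.
Definition res_zero v := ResSpace (@res0_subproof v).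

Lemma resN_subproof v (f : res_space v) :
  res_compatible (fun g w (e : actv rho g w = v) => - f g w e).
Proof. by move=> g h Fh w w' e e' e''; rewrite linearN (resP f Fh e e' e''). Qed.
Definition res_opp v (f : res_space v) := ResSpace (resN_subproof f).

Lemma resD_subproof v (f f' : res_space v) :
  res_compatible (fun g w (e : actv rho g w = v) => f g w e + f' g w e).
Proof.
by move=> g h Fh w w' e e' e''; rewrite linearD (resP f Fh e e' e'') (resP f' Fh e e' e'').
Qed.
Definition res_add v (f f' : res_space v) := ResSpace (resD_subproof f f').

Lemma res_addA v : associative (@res_add v).
Proof. by move=> f f' f''; apply: res_ext => * /=; rewrite addrA. Qed.
Lemma res_addC v : commutative (@res_add v).
Proof. by move=> f f'; apply: res_ext => * /=; rewrite addrC. Qed.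
Lemma res_add0 v : left_id (res_zero v) (@res_add v).
Proof. by move=> f; apply: res_ext => * /=; rewrite add0r. Qed.
Lemma res_addN v : left_inverse (res_zero v) (@res_opp v) (@res_add v).
Proof. by move=> f; apply: res_ext => * /=; rewrite addNr. Qed.

HB.instance Definition _ v := GRing.isZmodule.Build (res_space v)
  (@res_addA v) (@res_addC v) (@res_add0 v) (@res_addN v).

Lemma resZ_subproof v (c : L) (f : res_space v) :
  res_compatible (fun g w (e : actv rho g w = v) => (g^-1)%g c *: f g w e).
Proof.
move=> g h Fh w w' e e' e''; rewrite linearZ /= (resP f Fh e e' e''); congr (_ *: _).
exact: gal_mulKV.
Qed.
Definition res_scale v (c : L) (f : res_space v) := ResSpace (resZ_subproof c f).

Lemma res_scaleA v (c d : L) (f : res_space v) :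
  res_scale c (res_scale d f) = res_scale (c * d) f.
Proof. by apply: res_ext => g w e /=; rewrite scalerA -(rmorphM g^-1%g). Qed.
Lemma res_scale1 v : left_id 1 (@res_scale v).
Proof.
move=> f; apply: res_ext => g w e.
transitivity (g^-1%g 1 *: f g w e) => //.
by rewrite rmorph1 scale1r.
Qed.
Lemma res_scaleDr v : right_distributive (@res_scale v) +%R.
Proof. by move=> c f f'; apply: res_ext => * /=; rewrite scalerDr. Qed.
Lemma res_scaleDl v (f : res_space v) :
  {morph (@res_scale v)^~ f : c d / c + d}.
Proof. by move=> c d; apply: res_ext => g w e /=; rewrite -scalerDl -(rmorphD g^-1%g). Qed.

HB.instance Definition _ v := GRing.Zmodule_isLmodule.Build L (res_space v)
  (@res_scaleA v) (@res_scale1 v) (@res_scaleDr v) (@res_scaleDl v).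

(* (phi_s f) g = f (s^-1 g) *)
Lemma res_act_subproof s v v' (vv' : actv rho s v = v') g w
  (e : actv rho g w = v') : actv rho (s^-1 * g)%g w = v.
Proof. by rewrite actvM e -vv' -actvM mulVg actv1. Qed.

Lemma res_semi_subproof s v v' (vv' : actv rho s v = v') (f : res_space v) :
  res_compatible (fun g w e => f (s^-1 * g)%g w (res_act_subproof vv' e)).
Proof.
move=> g h Fh w w' e e' e''.
move: (res_act_subproof vv' e); rewrite mulgA => e1.
exact: resP.
Qed.

Definition res_semi_fun s v v' (vv' : actv rho s v = v') (f : res_space v) :
  res_space v' := ResSpace (res_semi_subproof vv' f).

Lemma res_semi_linear s v v' (vv' : actv rho s v = v') :
  linear_for ((s : L -> L) \; *:%R) (res_semi_fun vv').
Proof.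
move=> c f f'; apply: res_ext => g w e /=; congr (_ *: _ + _).
suff /(congr1 (fun u : G => u c)) : ((s^-1 * g)^-1 = g^-1 * s)%g by [].
by rewrite invgM invgK.
Qed.

HB.instance Definition _ s v v' (vv' : actv rho s v = v') :=
  GRing.isLinear.Build L (res_space v) (res_space v') ((s : L -> L) \; *:%R)
    (res_semi_fun vv') (res_semi_linear vv').

Lemma res_fun_eq v (f : res_space v) g g' w (e : actv rho g w = v)
  (e' : actv rho g' w = v) : g = g' -> f g w e = f g' w e'.
Proof. by move=> gg'; case: _ / gg' e' => e'; congr (f g w _); apply: Prop_irrelevance. Qed.

Lemma res_semi_bij s v v' (vv' : actv rho s v = v') : bijective (res_semi_fun vv').
Proof.
have v'v : actv rho s^-1%g v' = v by rewrite -vv' -actvM mulVg actv1.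
exists (res_semi_fun v'v) => f; apply: res_ext => g w e /=; apply: res_fun_eq.
- by rewrite invgK mulgA mulVg mul1g.
- by rewrite invgK mulgA mulgV mul1g.
Qed.

(* The map phi_e of N, as a map from N v to N w when src e = v and tgt e = w. *)
Definition emap_at e v w (sv : src e = v) (tw : tgt e = w) (x : N v) : N w :=
  ecast w' (N w') tw (emap N e (ecast v' (N v') (esym sv) x)).

Lemma emap_at_linear e v w (sv : src e = v) (tw : tgt e = w) :
  linear (emap_at sv tw).
Proof. by case: _ / sv; case: _ / tw => c x y; rewrite /emap_at /= linearP. Qed.

Lemma emap_at_semi h (Fh : gal_over F h) e e' v w v' w'
    (sv : src e = v) (tw : tgt e = w) (sv' : src e' = v') (tw' : tgt e' = w')
    (vv' : actv rho h v = v') (ww' : actv rho h w = w') (x : N v) :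
  e' = acte rho h e ->
  semi N Fh ww' (emap_at sv tw x) = emap_at sv' tw' (semi N Fh vv' x).
Proof.
move=> ee'; subst e'; case: _ / sv vv' x; case: _ / tw ww'.
case: _ / sv'; case: _ / tw' => ht hs x; rewrite /emap_at /=.
by rewrite emap_semi.
Qed.

Lemma res_src_subproof e g w (ew : actv rho g w = tgt e) :
  actv rho g (src (acte rho g^-1%g e)) = src e.
Proof. by rewrite src_act -actvM mulgV actv1. Qed.

Lemma res_tgt_subproof e g w (ew : actv rho g w = tgt e) :
  tgt (acte rho g^-1%g e) = w.
Proof. by rewrite tgt_act -ew -actvM mulVg actv1. Qed.

Lemma res_fun_semi v (f : res_space v) g h (Fh : gal_over F h) w w' g'
    (e : actv rho g' w = v) (e' : actv rho h w = w') (e'' : actv rho g w' = v) :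
  g' = (g * h)%g -> semi N Fh e' (f g' w e) = f g w' e''.
Proof. by move=> gg'; subst g'; apply: resP. Qed.

Lemma res_emap_subproof e (f : res_space (src e)) :
  res_compatible (fun g w (ew : actv rho g w = tgt e) =>
    emap_at (erefl (src (acte rho g^-1%g e))) (res_tgt_subproof ew)
      (f g _ (res_src_subproof ew))).
Proof.
move=> g h Fh w w' ew e' ew'.
have ee' : acte rho g^-1%g e = acte rho h (acte rho (g * h)^-1%g e).
  by rewrite -acteM invgM mulgA mulgV mul1g.
have vv' : actv rho h (src (acte rho (g * h)^-1%g e)) = src (acte rho g^-1%g e).
  by rewrite ee' [RHS]src_act.
rewrite (emap_at_semi Fh _ _ (erefl (src (acte rho g^-1%g e))) (res_tgt_subproof ew') vv') //.
by congr (emap_at _ _ _); apply: resP.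
Qed.

(* (phi_e f) g = phi_(g^-1 e) (f g) *)
Definition res_emap_fun e (f : res_space (src e)) : res_space (tgt e) :=
  ResSpace (res_emap_subproof f).

Lemma res_emap_linear e : linear (@res_emap_fun e).
Proof. by move=> c f f'; apply: res_ext => g w ew /=; rewrite emap_at_linear. Qed.

HB.instance Definition _ e := GRing.isLinear.Build L (res_space (src e))
  (res_space (tgt e)) *:%R (@res_emap_fun e) (@res_emap_linear e).

Definition restriction_of_scalars : rat_rep (base_field iota).
Proof.
exists res_space (fun s _ v w vw => @res_semi_fun s v w vw : {linear _ -> _ | _})
  (fun e => @res_emap_fun e : {linear _ -> _}).
- by move=> s _ v w vw; apply: res_semi_bij.
- move=> s t Fs Ft Fst u v w uv vw uw f; apply: res_ext => g x e /=.
  by apply: res_fun_eq; rewrite invgM mulgA.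
- move=> s Fs e hs ht f; apply: res_ext => g w ew /=.
  move: (res_src_subproof _) (res_tgt_subproof _) (res_tgt_subproof _)
    (res_act_subproof _ _).
  have -> : acte rho g^-1%g (acte rho s e) = acte rho (s^-1 * g)^-1%g e.
    by rewrite invgM invgK acteM.
  move=> h1 h2 h2' h1'; rewrite (Prop_irrelevance h1 h1').
  by rewrite (Prop_irrelevance h2 h2').
Defined.

End RestrictionOfScalars.

Definition indecomposable_class : Type :=
  {C : rat_rep (base_field iota) -> Prop |
    exists M, [/\ rep_continuous M, indecomposable M & C = rep_iso M]}.

Definition representation_finite : Prop :=
  exists (n : nat) (f : 'I_n -> indecomposable_class), forall C, exists i, f i = C.

(* The additive extension of alpha_v |-> alpha_(s v). *)
Definition act_root (s : G) (a : {ffun vert Gamma -> int}) : {ffun vert Gamma -> int} :=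
  \sum_v simple_root (actv rho s v) *~ a v.

Definition root_orbit (a : {ffun vert Gamma -> int}) : {ffun vert Gamma -> int} -> Prop :=
  fun b => exists s : G, b = act_root s a.

Definition positive_root_orbit : Type :=
  {O : {ffun vert Gamma -> int} -> Prop |
    exists2 a, is_positive_root a & O = root_orbit a}.

Definition root_stabilizer (a : {ffun vert Gamma -> int}) : G -> Prop :=
  fun s => act_root s a = a.

Definition definition_field (a : {ffun vert Gamma -> int}) : L -> Prop :=
  fixed_field (root_stabilizer a).

Definition is_form F (X : rat_rep (@whole_field L)) (N : rat_rep F) : Prop :=
  rep_continuous N /\ rep_iso (base_change_top N) X.

(* The representation X exists, is unique up to isomorphism, is defined over
   definition_field a, and its forms N there have restriction of scalars in C. *)
Definition attached (a : {ffun vert Gamma -> int})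
    (C : rat_rep (base_field iota) -> Prop) : Prop :=
  exists X : rat_rep (@whole_field L),
  [/\ indecomposable X, has_dimension_vector X a,
      forall Y : rat_rep (@whole_field L),
        indecomposable Y -> has_dimension_vector Y a -> rep_iso X Y,
      exists N : rat_rep (definition_field a), is_form X N
    & forall N : rat_rep (definition_field a),
        is_form X N -> C (restriction_of_scalars N)].

End Representations.

(* Main.v *)
(* Bernstein-Gelfand-Ponomarev reflections, made Galois equivariant. The sinks are
   fired in the order of their rank, the number of vertices that they reach, which
   is invariant under the Galois group. A vector h > 0 on which the Cartan matrix
   is positive makes the Tits form positive definite, hence bounds the roots, and
   forces every positive root, followed back in time, to become the simple root of
   a vertex about to be fired, within a bounded time.
   Let H be a subgroup of Gal(L/K), and M an indecomposable representation with a
   continuous semilinear action of H. At a set of fired sinks, either M is supported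
   there or its incoming maps are onto, by Galois descent (complements exist since
   invariants span), and then M can be reflected. Homs transfer back along
   reflections, so M vanishes if it can be reflected for too long; hence M is
   reached by reflections at a representation supported on one H-orbit of vertices,
   which is determined by its dimension vector. So M is determined by its dimension
   vector, and for H = 1 these are the positive roots.
   Restriction of scalars from the stabilizer of a root is induction, which commutes
   with reflections. Reflecting until the root a is simple at a vertex u, whose
   stabilizer is that of a, turns the induced representation into the simple one on
   the orbit of u: it is indecomposable, it determines the orbit of a, and every
   indecomposable over K arises this way. *)
From HB Require Import structures.
From mathcomp Require Import all_boot all_order all_algebra.
From mathcomp Require Import boolp.
From mathcomp Require classical_sets.
Require Import Defs.
From mathcomp Require Import ring lra zify.
Set Implicit Arguments.
Unset Strict Implicit.
Unset Printing Implicit Defensive.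

Import Order.TTheory GRing.Theory Num.Theory.
Local Open Scope ring_scope.

(** * Linear algebra *)

(** Homs replace it: a vector at a relative sink of the support of a reflected M is the image of a
    hom from a representation attached to a simple root. Going back in time, that representation
    becomes simple at a freshly fired vertex, and such a simple has no nonzero hom to a reflection.
    Only roots, which are bounded, are followed numerically, and the Euler form against h bounds
    their lifetime. Reflecting at one vertex would break the Galois symmetry, so all sinks of one
    rank are fired together; they are pairwise non-adjacent, hence their reflections commute. When
    L/K is infinite one cannot sum over the group. Interpolation at conjugates gives the indicator
    of an open subgroup as a combination of evaluations, and traces become finite sums over
    cosets. *)

Section LinearTools.
Variable L : fieldType.

Definition mklin (U W : lmodType L) (f : U -> W) (lin_f : linear f) : {linear U -> W} :=
  HB.pack f (GRing.isLinear.Build L U W *:%R f lin_f).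

(** Linear maps are built from their graphs: when a source vector has many presentations,
    well-definedness reduces to the presentations of 0. *)
Lemma linear_of_rel (U W : lmodType L) (rel : U -> W -> Prop) :
  (forall c x y x' y', rel x x' -> rel y y' -> rel (c *: x + y) (c *: x' + y')) ->
  (forall x, exists y, rel x y) -> (forall y, rel 0 y -> y = 0) ->
  exists f : {linear U -> W}, forall x y, rel x y <-> y = f x.
Proof.
move=> relL relT rel0; pose f x := projT1 (cid (relT x)).
have fP x : rel x (f x) by rewrite /f; case: cid.
have rel_inj x y y' : rel x y -> rel x y' -> y = y'.
  move=> xy xy'; have := relL (-1) _ _ _ _ xy xy'.
  by rewrite !scaleN1r addNr => /rel0 /eqP; rewrite addrC subr_eq0 => /eqP.
have lin_f : linear f by move=> c x y; apply: rel_inj (fP _) _; apply: relL.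
exists (mklin lin_f) => x y; split=> [xy|->]; last exact: fP.
exact: rel_inj xy (fP x).
Qed.

Record submod_pred (U : lmodType L) (P : U -> Prop) : Prop := SubmodPred {
  submod0 : P 0;
  submodD : forall x y, P x -> P y -> P (x + y);
  submodZ : forall c x, P x -> P (c *: x) }.

Section Subspace.
Variables (U : lmodType L) (P : U -> Prop) (submodP : submod_pred P).

Lemma submod_sum I (r : seq I) (Q : pred I) (F : I -> U) :
  (forall i, Q i -> P (F i)) -> P (\sum_(i <- r | Q i) F i).
Proof. by move=> PF; elim/big_ind: _ => //; [apply: submod0 | apply: submodD]. Qed.

Lemma submodN x : P x -> P (- x).
Proof. by move=> Px; rewrite -scaleN1r; apply: submodZ. Qed.

(** Subspaces are cut out by predicates in [Prop], without decidability, so equality and choice on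
    them are classical. *)
Record subspace (submodP : submod_pred P) : Type :=
  Subspace { subval :> U; subvalP : P subval }.
Local Notation sub := (subspace submodP).

Lemma subval_inj : injective (@subval submodP).
Proof.
move=> [x Px] [y Py] /= xy; subst y; congr Subspace; exact: Prop_irrelevance.
Qed.

HB.instance Definition _ := gen_eqMixin sub.
HB.instance Definition _ := gen_choiceMixin sub.

Definition sub_zero : sub := Subspace submodP (submod0 submodP).
Definition sub_opp (x : sub) : sub := Subspace submodP (submodN (subvalP x)).
Definition sub_add (x y : sub) : sub :=
  Subspace submodP (submodD submodP (subvalP x) (subvalP y)).
Definition sub_scale c (x : sub) : sub := Subspace submodP (submodZ submodP c (subvalP x)).

Lemma sub_addA : associative sub_add.
Proof. by move=> x y z; apply: subval_inj; rewrite /= addrA. Qed.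
Lemma sub_addC : commutative sub_add.
Proof. by move=> x y; apply: subval_inj; rewrite /= addrC. Qed.
Lemma sub_add0 : left_id sub_zero sub_add.
Proof. by move=> x; apply: subval_inj; rewrite /= add0r. Qed.
Lemma sub_addN : left_inverse sub_zero sub_opp sub_add.
Proof. by move=> x; apply: subval_inj; rewrite /= addNr. Qed.
HB.instance Definition _ := GRing.isZmodule.Build sub sub_addA sub_addC sub_add0 sub_addN.

Lemma sub_scaleA c d x : sub_scale c (sub_scale d x) = sub_scale (c * d) x.
Proof. by apply: subval_inj; rewrite /= scalerA. Qed.
Lemma sub_scale1 : left_id 1 sub_scale.
Proof. by move=> x; apply: subval_inj; rewrite /= scale1r. Qed.
Lemma sub_scaleDr : right_distributive sub_scale +%R.
Proof. by move=> c x y; apply: subval_inj; rewrite /= scalerDr. Qed.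
Lemma sub_scaleDl x : {morph sub_scale^~ x : c d / c + d}.
Proof. by move=> c d; apply: subval_inj; rewrite /= scalerDl. Qed.
HB.instance Definition _ := GRing.Zmodule_isLmodule.Build L sub
  sub_scaleA sub_scale1 sub_scaleDr sub_scaleDl.

Lemma subval_linear : linear (@subval submodP). Proof. by []. Qed.
HB.instance Definition _ := GRing.isLinear.Build L sub U *:%R (@subval submodP) subval_linear.

End Subspace.

Section SubspaceMap.
Variables (U W : lmodType L) (P : U -> Prop) (Q : W -> Prop).
Variables (sP : submod_pred P) (sQ : submod_pred Q) (f : {linear U -> W}).
Hypothesis PQ : forall x, P x -> Q (f x).

Definition sub_map_fun (x : subspace sP) : subspace sQ := Subspace sQ (PQ (subvalP x)).
Lemma sub_map_linear : linear sub_map_fun.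
Proof. by move=> c x y; apply: subval_inj; rewrite /= linearP. Qed.
Definition sub_map : {linear subspace sP -> subspace sQ} := mklin sub_map_linear.
End SubspaceMap.

(** Dimension is relative to a predicate because a vertex space is a subspace of a total space,
    which may have infinite dimension. *)
Definition has_dim (U : lmodType L) (P : U -> Prop) (n : nat) : Prop :=
  exists2 f : {linear 'rV[L]_n -> U}, injective f & forall x, P x <-> exists y, x = f y.

End LinearTools.

(** * Galois descent for a possibly infinite extension *)

Section Descent.
Variables (K L : fieldType) (iota : {rmorphism K -> L}).
Hypothesis algL : algebraic_extension iota.
Local Notation G := (Gal iota).
Implicit Types (s t : G) (xs : seq L).

Lemma roots_finite (q : {poly L}) : q != 0 -> exists rs : seq L, forall y, root q y -> y \in rs.
Proof.
have [n] := ubnP (size q); elim: n q => // n IHn q szq q0.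
have [[z qz]|nz] := pselect (exists z, root q z); last first.
  by exists [::] => y qy; case: nz; exists y.
have [q' def_q] := factor_theorem q z qz.
have q'0 : q' != 0 by apply: contraNneq q0 => q'0; rewrite def_q q'0 mul0r.
have [|rs rsP] := IHn q' _ q'0.
  by move: szq; rewrite def_q size_Mmonic ?monicXsubC // size_XsubC addn2 ltnS.
exists (z :: rs) => y; rewrite def_q rootM root_XsubC in_cons.
by case/orP => [/rsP ->|->]; rewrite ?orbT.
Qed.

Lemma conjugates_finite x : exists rs : seq L, forall s, s x \in rs.
Proof.
have [p p0 px] := algL x.
have [|rs rsP] := @roots_finite (map_poly iota p); first by rewrite map_poly_eq0.
exists rs => s; apply: rsP; rewrite -(fmorph_root s) -map_poly_comp in px.
by rewrite (eq_map_poly (g := iota)) in px => // y; apply: gal_fix.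
Qed.

Definition fixes s xs : Prop := forall x, x \in xs -> s x = x.

(* The L-algebra of functions on Gal(L/K) generated by the evaluations at
   elements of the fixed field of the stabilizer of xs. *)
Definition interp xs (f : G -> L) : Prop :=
  exists ces : seq (L * L),
    (forall ce, ce \in ces -> forall s, fixes s xs -> s ce.2 = ce.2) /\
    forall s, f s = \sum_(ce <- ces) ce.1 * s ce.2.

Lemma interpM xs f g : interp xs f -> interp xs g -> interp xs (fun s => f s * g s).
Proof.
move=> [ces [cesP fE]] [des [desP gE]].
exists [seq (ce.1 * de.1, ce.2 * de.2) | ce <- ces, de <- des]; split.
  move=> _ /allpairsP[[ce de] /= [/cesP ceP /desP deP ->]] s sxs /=.
  by rewrite rmorphM /= ceP ?deP.
move=> s; rewrite fE gE big_allpairs_dep big_distrl /=; apply: eq_bigr => ce _.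
by rewrite big_distrr; apply: eq_bigr => de _ /=; rewrite rmorphM mulrACA.
Qed.

Lemma interpD xs f g : interp xs f -> interp xs g -> interp xs (fun s => f s + g s).
Proof.
move=> [ces [cesP fE]] [des [desP gE]]; exists (ces ++ des); split.
  by move=> ce; rewrite mem_cat => /orP[/cesP|/desP].
by move=> s; rewrite big_cat fE gE.
Qed.

Lemma interpC xs c : interp xs (fun=> c).
Proof.
exists [:: (c, 1)]; split=> [ce|s]; last by rewrite big_seq1 rmorph1 mulr1.
by rewrite inE => /eqP-> s _; rewrite rmorph1.
Qed.

Lemma interp_eval xs x : x \in xs -> interp xs (fun s => s x).
Proof.
move=> xxs; exists [:: (1, x)]; split=> [ce|s]; last by rewrite big_seq1 mul1r.
by rewrite inE => /eqP-> s /(_ _ xxs).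
Qed.

Lemma interp_prod xs I (r : seq I) (F : I -> G -> L) :
  (forall i, interp xs (F i)) -> interp xs (fun s => \prod_(i <- r) F i s).
Proof.
move=> FP; elim: r => [|i r IHr].
  rewrite (_ : (fun s => _) = fun=> 1); first exact: interpC.
  by apply/funext => s; rewrite big_nil.
rewrite (_ : (fun s => _) = fun s => F i s * \prod_(i <- r) F i s).
  exact: interpM.
by apply/funext => s; rewrite big_cons.
Qed.

(** Lagrange interpolation: the conjugates of x lie in a finite list, and the product of (s x - r) /
    (x - r) over its entries r other than x is 1 if s fixes x and has a vanishing factor
    otherwise. *)
Lemma interp_delta xs : exists2 f, interp xs f &
  forall s, (fixes s xs -> f s = 1) /\ (~ fixes s xs -> f s = 0).
Proof.
(* The induction shrinks [ys] while the algebra of [xs] stays fixed. *)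
suff delta ys : {subset ys <= xs} -> exists2 f, interp xs f &
    forall s, (fixes s ys -> f s = 1) /\ (~ fixes s ys -> f s = 0).
  exact: delta.
elim: ys => [_|x ys IHys sys].
  by exists (fun=> 1); [exact: interpC|split=> // []; case].
have [|f fI fP] := IHys; first by move=> y yys; apply: sys; rewrite in_cons yys orbT.
have [rs rsP] := conjugates_finite x.
pose g s := \prod_(r <- rs) (if r == x then 1 else (s x + - r) * (x - r)^-1).
have gI : interp xs g.
  apply: (@interp_prod _ _ rs (fun r s => if r == x then 1 else (s x + - r) * (x - r)^-1)) => r.
  case: eqVneq => _; first exact: interpC.
  by apply/interpM/interpC/interpD/interpC/interp_eval/sys; rewrite mem_head.
exists (fun s => g s * f s); first exact: interpM.
move=> s; split=> sP.
  rewrite (fP s).1 ?mulr1 => [|y yys]; last by apply: sP; rewrite in_cons yys orbT.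
  rewrite /g big1 // => r _; case: eqVneq => // rx.
  by rewrite sP ?mem_head // divff // subr_eq0 eq_sym.
have [sx|/eqP sx] := pselect (s x = x).
  rewrite (fP s).2 ?mulr0 // => sys'; apply: sP => y; rewrite in_cons.
  by case/orP => [/eqP->|/sys'].
suff -> : g s = 0 by rewrite mul0r.
by apply/eqP; rewrite prodf_seq_eq0; apply/hasP; exists (s x); rewrite ?rsP //= (negPf sx) subrr mul0r.
Qed.

Record subgroup (H : G -> Prop) : Prop := Subgroup {
  sub1 : H 1%g;
  subM : forall s t, H s -> H t -> H (s * t)%g;
  subV : forall s, H s -> H s^-1%g }.

Lemma fixes_sub xs : subgroup (fixes^~ xs).
Proof.
split=> [x|s t sxs txs x xxs|s sxs x xxs]; first by [].
  by rewrite /= txs // sxs.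
by rewrite -{1}(sxs _ xxs) /=; apply: gal_invK.
Qed.

Lemma fixes_cat s xs ys : fixes s (xs ++ ys) -> fixes s xs /\ fixes s ys.
Proof. by move=> sP; split=> x xP; apply: sP; rewrite mem_cat xP ?orbT. Qed.

Lemma fixesMl s t xs : fixes (s^-1 * t)%g xs <-> forall x, x \in xs -> s x = t x.
Proof.
split=> st x xxs; first by rewrite -{1}(st x xxs); apply: gal_funK.
by rewrite /= -st //; apply: gal_invK.
Qed.

(* [ss] represents the left cosets in H of the stabilizer of xs. *)
Record transversal (H : G -> Prop) xs (ss : seq G) : Prop := Transversal {
  trans_sub : forall s, s \in ss -> H s;
  trans_ex : forall s, H s -> exists2 t, t \in ss & fixes (s^-1 * t)%g xs;
  trans_uniq : uniq ss;
  trans_inj : forall s t, s \in ss -> t \in ss -> fixes (s^-1 * t)%g xs -> s = t }.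

Lemma values_finite xs : exists vs : seq (seq L), forall s, [seq s x | x <- xs] \in vs.
Proof.
elim: xs => [|x xs [vs vsP]]; first by exists [:: [::]].
have [rs rsP] := conjugates_finite x.
exists [seq r :: v | r <- rs, v <- vs] => s.
by apply: allpairs_f; rewrite ?rsP ?vsP.
Qed.

(** H may be infinite, but a coset is determined by the values of its elements on [xs], and these
    are conjugates: there are finitely many tuples. *)
Lemma transversal_exists (H : G -> Prop) xs : exists ss, transversal H xs ss.
Proof.
have [vs vsP] := values_finite xs.
have valE s t : [seq s x | x <- xs] = [seq t x | x <- xs] <-> fixes (s^-1 * t)%g xs.
  rewrite fixesMl; split=> [st x xxs|st]; last exact/eq_in_map.
  by move/eq_in_map: st; apply.
suff [ss [ss1 ss2 ss3 ss4]] : exists ss, [/\ forall s, s \in ss -> H s,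
    forall s, H s -> [seq s x | x <- xs] \in vs ->
      exists2 t, t \in ss & [seq s x | x <- xs] = [seq t x | x <- xs], uniq ss &
    forall s t, s \in ss -> t \in ss -> [seq s x | x <- xs] = [seq t x | x <- xs] -> s = t].
  exists ss; split=> // [s Hs|s t sss tss /valE]; last exact: ss4.
  by have [t tss /valE] := ss2 s Hs (vsP s); exists t.
elim: vs {vsP} => [|v vs [ss [ss1 ss2 ss3 ss4]]]; first by exists [::]; split.
have [[s Hs sv]|nv] := pselect (exists2 s, H s & [seq s x | x <- xs] = v /\
    forall t, t \in ss -> [seq t x | x <- xs] <> v); last first.
  exists ss; split=> // s Hs; rewrite in_cons => /orP[/eqP sv|]; last exact: ss2.
  apply: contrapT => nt; apply: nv; exists s => //; split=> // t tss tv.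
  by apply: nt; exists t; rewrite // sv.
case: sv => sv nsv; exists (s :: ss); split.
- by move=> t; rewrite in_cons => /orP[/eqP->|/ss1].
- move=> t Ht; rewrite in_cons => /orP[/eqP tv|tvs].
    by exists s; rewrite ?mem_head // sv.
  by have [t' t'ss] := ss2 t Ht tvs; exists t'; rewrite // in_cons t'ss orbT.
- by rewrite /= ss3 andbT; apply/negP => /nsv; rewrite sv.
- move=> t t'; rewrite !in_cons => /orP[/eqP->|tss] /orP[/eqP->|t'ss] //.
  + by rewrite sv => /esym /(nsv _ t'ss).
  + by rewrite sv => /(nsv _ tss).
  + exact: ss4.
Qed.

Section Trace.
Variables (H : G -> Prop) (xs : seq L) (ss : seq G).
Hypotheses (subH : subgroup H) (ssP : transversal H xs ss).

Definition coset_invariant (Z : Type) (F : G -> Z) : Prop :=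
  forall s t, H s -> H t -> fixes (s^-1 * t)%g xs -> F s = F t.

(** Left translation by k permutes the cosets, and F depends on the coset only. *)
Lemma trace_shift (Z : nmodType) (F : G -> Z) k : coset_invariant F -> H k ->
  \sum_(s <- ss) F (k * s)%g = \sum_(s <- ss) F s.
Proof.
move=> FP Hk; have ssH := trans_sub ssP.
have Hks s : s \in ss -> H (k * s)%g by move=> /ssH; apply: subM.
pose rep s := if pselect (H s) is left Hs then s2val (cid2 (trans_ex ssP Hs)) else 1%g.
have repP s : H s -> rep s \in ss /\ fixes (s^-1 * rep s)%g xs.
  by rewrite /rep; case: pselect => // Hs _; case: cid2.
rewrite (eq_big_seq (fun s => F (rep (k * s)%g))); last first.
  move=> s sss; have [rss rxs] := repP _ (Hks _ sss).
  by apply: FP => //; [apply: Hks | apply: ssH].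
rewrite -(big_map (fun s => rep (k * s)%g) xpredT F); apply: perm_big.
have uniq_r : uniq [seq rep (k * s)%g | s <- ss].
  rewrite map_inj_in_uniq ?(trans_uniq ssP) // => s t sss tss st.
  have [_ /fixesMl rs] := repP _ (Hks _ sss); have [_ /fixesMl rt] := repP _ (Hks _ tss).
  apply: (trans_inj ssP) => //; apply/fixesMl => x xxs.
  by apply: (bij_inj (gal_bij k)); have := rs x xxs; rewrite st -(rt x xxs).
have sub_r : {subset [seq rep (k * s)%g | s <- ss] <= ss}.
  by move=> _ /mapP[s sss ->]; case: (repP _ (Hks _ sss)).
apply: uniq_perm (trans_uniq ssP) _ => // s.
by have [_ ->] := uniq_min_size uniq_r sub_r (eq_leq (esym (size_map _ _))).
Qed.
End Trace.

(* The Galois correspondence for an open subgroup D: apply the trace of D to a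
   function that is 1 on the stabilizer of xs and 0 off it. *)
Lemma open_subgroup_closed (D : G -> Prop) xs s :
  subgroup D -> (forall t, fixes t xs -> D t) -> gal_over (fixed_field D) s -> D s.
Proof.
move=> subD xsD sD; apply: contrapT => nDs.
have [f [ces [cesP fE]] fP] := interp_delta xs.
have [ss ssP] := transversal_exists D xs.
have inv ce : ce \in ces -> coset_invariant D xs (fun t => t ce.2).
  move=> ceces t t' Dt Dt' /(cesP _ ceces) h.
  by rewrite -{1}h; apply: gal_funK.
(* f is a combination of evaluations at elements [ce.2], whose traces are fixed by D and hence by s,
   so shifting by s keeps the sum. Yet the right side is 1, from the representative fixing [xs], and
   the left side is 0 when s is not in D. *)
have : \sum_(t <- ss) f (s * t)%g = \sum_(t <- ss) f t.
  under eq_bigr do rewrite fE; under [RHS]eq_bigr do rewrite fE.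
  rewrite exchange_big [RHS]exchange_big; apply: eq_big_seq => ce ceces.
  rewrite -!big_distrr /=; congr (_ * _); rewrite -(rmorph_sum s); apply: sD => k Dk.
  by rewrite rmorph_sum; apply: (trace_shift subD ssP (inv ce ceces) Dk).
have [t tss txs] := trans_ex ssP (sub1 subD).
have {}txs : fixes t xs by rewrite -[t]mul1g -invg1.
rewrite (big_rem t tss) /= [RHS](big_rem t tss) /= (fP t).1 //.
have f0 k : D k -> f (s * k)%g = 0.
  move=> Dk; apply: (fP _).2 => /xsD Dsk; apply: nDs.
  by rewrite -[s](mulgK k); apply: subM => //; apply: subV.
have Dss := trans_sub ssP.
rewrite f0; last exact: Dss.
rewrite big_seq big1 => [|k /mem_rem /Dss]; last exact: f0.
rewrite big_seq big1 => [|k /[dup] /mem_rem kss krem].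
  by rewrite !addr0 => /eqP; rewrite eq_sym oner_eq0.
apply: (fP k).2 => kxs; have kt : t = k.
  apply: (trans_inj ssP) => //; apply: (subM (fixes_sub xs)) => //.
  exact: (subV (fixes_sub xs)).
by move: krem; rewrite -kt mem_rem_uniq ?(trans_uniq ssP) // inE eqxx.
Qed.

Section Semilinear.
Variables (H : G -> Prop) (V : lmodType L) (act : G -> V -> V).
Hypothesis subH : subgroup H.
Hypothesis act_lin : forall s, H s -> forall c x y,
  act s (c *: x + y) = s c *: act s x + act s y.
Hypothesis actM : forall s t, H s -> H t -> forall x, act (s * t)%g x = act s (act t x).

Definition discrete_at (x : V) : Prop :=
  exists xs, forall s, H s -> fixes s xs -> act s x = x.

(* Speiser's lemma. *)
Lemma span_invariants (P : V -> Prop) x : submod_pred P -> discrete_at x ->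
  (forall y, (forall s, H s -> act s y = y) -> P y) -> P x.
Proof.
move=> subP [xs xsP] Pinv.
have [f [ces [cesP fE]] fP] := interp_delta xs.
have [ss ssP] := transversal_exists H xs.
have ssH := trans_sub ssP.
have actD s y z : H s -> act s (y + z) = act s y + act s z.
  by move=> Hs; rewrite -[y]scale1r act_lin // rmorph1 !scale1r.
have act0 s : H s -> act s 0 = 0.
  by move=> Hs; apply: (addIr (act s 0)); rewrite -actD // addr0 add0r.
have actZ s c y : H s -> act s (c *: y) = s c *: act s y.
  by move=> Hs; rewrite -[c *: y]addr0 act_lin // act0 // addr0.
(* The sum of [f s *: act s x] over the cosets is x, as only the coset fixing [xs] contributes;
   expanding f turns it into a combination of traces, which are invariant. *)
suff -> : x = \sum_(ce <- ces) ce.1 *: \sum_(s <- ss) act s (ce.2 *: x).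
  rewrite big_seq; apply: submod_sum => // ce ceces; apply: submodZ => //.
  apply: Pinv => k Hk.
  rewrite -[RHS](trace_shift subH ssP (F := fun s => act s (ce.2 *: x)) _ Hk).
    rewrite (big_morph (act k) (fun y z => actD k y z Hk) (act0 k Hk)).
    by apply: eq_big_seq => s /ssH Hs; rewrite actM.
  move=> s t Hs Ht st; have Hst : H (s^-1 * t)%g.
    by apply: (subM subH) => //; apply: (subV subH).
  rewrite -[t](mulVKg s) actM //.
  by congr (act s _); rewrite actZ // (cesP ce) // xsP.
transitivity (\sum_(s <- ss) f s *: act s x).
  have [t tss txs] := trans_ex ssP (sub1 subH).
  have {}txs : fixes t xs by rewrite -[t]mul1g -invg1.
  rewrite (big_rem t tss) /= (fP t).1 // scale1r (xsP t (ssH t tss) txs).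
  rewrite big_seq big1 ?addr0 // => k /[dup] /mem_rem kss krem; rewrite (fP k).2 ?scale0r // => kxs.
  have kt : t = k.
    apply: (trans_inj ssP) => //; apply: (subM (fixes_sub xs)) => //.
    exact: (subV (fixes_sub xs)).
  by move: krem; rewrite -kt mem_rem_uniq ?(trans_uniq ssP) // inE eqxx.
under [RHS]eq_bigr do rewrite scaler_sumr.
rewrite exchange_big; apply: eq_big_seq => s /ssH Hs; rewrite fE scaler_suml.
by apply: eq_bigr => ce _; rewrite actZ // scalerA.
Qed.
End Semilinear.

End Descent.

(** * Roots under simultaneous reflections at independent vertices *)

Section RootCombinatorics.
Variable Gamma : quiver.
Local Notation V := (vert Gamma).
Local Notation vec := {ffun V -> int}.
Implicit Types (a b : vec) (u v w : V) (S : {set V}).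
Local Notation nb u v := ((nedges u v)%:Z).

Lemma nedges_sym u v : nedges u v = nedges v u.
Proof. by apply: eq_card => e; rewrite !inE orbC. Qed.

(** The Cartan matrix of a loop-free quiver applied to a, at v. Thus [bform] is twice the Tits form,
    and roots have value 2. *)
Definition kk a v : int := 2 * a v - \sum_u nb v u * a u.
Definition bform a b : int := \sum_v kk a v * b v.
(** For [indep S] this is the product, in any order, of the simple reflections at the vertices of
    S. *)
Definition srefl S a : vec := [ffun v => if v \in S then a v - kk a v else a v].
Definition indep S : Prop := forall u v, u \in S -> v \in S -> nedges u v = 0%N.
Definition nonneg a : Prop := forall v, 0 <= a v.

Lemma kkD a b v : kk (a + b) v = kk a v + kk b v.
Proof.
rewrite /kk ffunE mulrDr (eq_bigr (fun u => nb v u * a u + nb v u * b u)) => [|u _].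
  by rewrite big_split /= opprD addrACA.
by rewrite ffunE mulrDr.
Qed.

Lemma kkN a v : kk (- a) v = - kk a v.
Proof.
rewrite /kk ffunE mulrN opprB [RHS]addrC; congr (_ + _).
by rewrite -sumrN; apply: eq_bigr => u _; rewrite ffunE mulrN opprK.
Qed.

Lemma bformDl a b c : bform (a + b) c = bform a c + bform b c.
Proof. by rewrite -big_split; apply: eq_bigr => v _; rewrite kkD mulrDl. Qed.

Lemma bformC a b : bform a b = bform b a.
Proof.
rewrite /bform /kk; under eq_bigr do rewrite mulrBl mulr_suml.
under [RHS]eq_bigr do rewrite mulrBl mulr_suml.
rewrite !sumrB [X in _ - X]exchange_big; congr (_ - _).
  by apply: eq_bigr => v _; rewrite -!mulrA [a v * _]mulrC.
by apply: eq_bigr => u _; apply: eq_bigr => v _; rewrite nedges_sym mulrAC.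
Qed.

Lemma bformDr a b c : bform a (b + c) = bform a b + bform a c.
Proof. by rewrite bformC bformDl ![bform _ a]bformC. Qed.

Lemma bformNl a b : bform (- a) b = - bform a b.
Proof. by rewrite -sumrN; apply: eq_bigr => v _; rewrite kkN mulNr. Qed.

Lemma bform_simple a v : bform a (simple_root v) = kk a v.
Proof.
rewrite /bform (bigD1 v) //= ffunE eqxx mulr1 big1 ?addr0 // => u uv.
by rewrite ffunE (negPf uv) mulr0.
Qed.

Lemma indep_delta S a : indep S -> (forall v, v \notin S -> a v = 0) ->
  bform a a = \sum_v 2 * a v * a v.
Proof.
move=> Si a0; apply: eq_bigr => v _.
have [vS|vS] := boolP (v \in S); last by rewrite a0 // !mulr0.
congr (_ * _); rewrite /kk big1 ?subr0 // => u _.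
by have [uS|/a0->] := boolP (u \in S); [rewrite Si // mul0r | rewrite mulr0].
Qed.

(** The change d is supported on S, where the form is diagonal; there 2 B(a, d) and B(d, d)
    cancel. *)
Lemma bform_srefl S a : indep S -> bform (srefl S a) (srefl S a) = bform a a.
Proof.
move=> Si; pose d := srefl S a - a.
have dE v : d v = if v \in S then - kk a v else 0.
  by rewrite !ffunE; case: ifP => _; rewrite ?subrr // addrAC subrr sub0r.
have -> : srefl S a = a + d by rewrite addrC subrK.
clearbody d.
have E : bform a d + bform a d + bform d d = 0.
  rewrite (@indep_delta S d) // => [|v vS]; last by rewrite dE (negPf vS).
  rewrite /bform -!big_split big1 // => v _ /=; rewrite dE; case: ifP => _; lia.
by rewrite bformDl !bformDr (bformC d a); lia.
Qed.

Lemma kk_indep S a v : indep S -> v \in S -> kk (srefl S a) v = - kk a v.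
Proof.
move=> Si vS; rewrite /kk ffunE vS.
rewrite (eq_bigr (fun u => nb v u * a u)) => [|u _]; first by rewrite /kk; move: (\sum_u _) => x; lia.
by rewrite ffunE; case: ifP => // uS; rewrite Si // !mul0r.
Qed.

Lemma sreflK S : indep S -> involutive (srefl S).
Proof.
move=> Si a; apply/ffunP => v; rewrite [LHS]ffunE; case: ifP => vS.
  by rewrite kk_indep // ffunE vS opprK subrK.
by rewrite ffunE vS.
Qed.

Lemma ffun_mulz a (n : int) w : (a *~ n) w = a w * n.
Proof.
case: n => n; first by rewrite -pmulrn ffunMnE -mulr_natr natz.
by rewrite NegzE -nmulrn ffunE ffunMnE mulrN -mulr_natr natz.
Qed.

Lemma simple_reflectionE v a : nedges v v = 0%N -> simple_reflection v a = srefl [set v] a.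
Proof.
move=> nv; apply/ffunP => u; rewrite !ffunE inE.
have -> : \sum_w a w * cartan w v = kk a v.
  rewrite /kk (bigD1 v) //= [X in _ - X](bigD1 v) //= nv mul0r add0r.
  rewrite /cartan eqxx mulrC -sumrN; congr (_ + _); apply: eq_bigr => w wv.
  by rewrite (negPf wv) mulrN mulrC nedges_sym.
rewrite ffun_mulz ffunE; case: eqP => [->|_]; first by rewrite mul1r.
by rewrite mul0r subr0.
Qed.

Lemma bform_simple_simple v : nedges v v = 0%N -> bform (simple_root v) (simple_root v) = 2.
Proof.
move=> nv; rewrite bform_simple /kk ffunE eqxx big1 ?subr0 // => u _.
by rewrite ffunE; case: eqP => [->|]; rewrite ?nv ?mul0r ?mulr0.
Qed.

Section Positive.
Variable h : V -> int.
Hypothesis nloop : forall v, nedges v v = 0%N.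
Hypothesis h_gt0 : forall v, 0 < h v.
Hypothesis kk_h : forall v, 1 <= 2 * h v - \sum_u nb v u * h u.

Lemma indep1 v : indep [set v].
Proof. by move=> u w; rewrite !inE => /eqP-> /eqP->. Qed.

Lemma bform_root a : is_root a -> bform a a = 2.
Proof.
elim=> [v|v b _ IHb]; first exact: bform_simple_simple.
by rewrite simple_reflectionE // bform_srefl //; apply: indep1.
Qed.

(** The vertices of S do not interact, so they can be reflected one at a time. *)
Lemma is_root_srefl S a : indep S -> is_root a -> is_root (srefl S a).
Proof.
have [n] := ubnP #|S|; elim: n S => // n IHn S leSn Si ra; have [->|[v vS]] := set_0Vmem S.
  suff -> : srefl set0 a = a by [].
  by apply/ffunP => v; rewrite ffunE inE.
have S'i : indep (S :\ v).
  by move=> u w; rewrite !inE => /andP[_ uS] /andP[_ wS]; apply: Si.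
have ra' : is_root (srefl (S :\ v) a).
  by apply: IHn => //; move: leSn; rewrite (cardsD1 v) vS ltnS.
suff -> : srefl S a = simple_reflection v (srefl (S :\ v) a) by apply: is_root_reflection.
rewrite simple_reflectionE //; apply/ffunP => u; rewrite !ffunE !inE.
case: eqVneq => [->|uv] //=; rewrite vS.
congr (_ - _); rewrite /kk !ffunE !inE eqxx /=; congr (_ - _).
apply: eq_bigr => w _; rewrite ffunE !inE; case: ifP => // /andP[_ wS].
by rewrite Si // !mul0r.
Qed.

(* AM-GM: [2 a_u a_v <= a_u^2 h_v / h_u + a_v^2 h_u / h_v], summed over the edges. *)
Lemma bform_ge a v : a v ^+ 2 <= h v * bform a a.
Proof.
pose A u : rat := (a u)%:~R; pose H u : rat := (h u)%:~R.
have H0 u : 0 < H u by rewrite ltr0z.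
pose N u w : rat := (nb u w)%:~R.
have N0 u w : 0 <= N u w by rewrite ler0z.
have NC u w : N u w = N w u by rewrite /N nedges_sym.
have kkH u : \sum_w N u w * H w <= 2 * H u - 1.
  have := kk_h u; rewrite -(ler_int rat) rmorphB rmorphM rmorph_sum /=.
  by under eq_bigr do rewrite rmorphM; rewrite -/(H u) /N /H; lra.
have def_B : (bform a a)%:~R = \sum_u 2 * A u ^+ 2 - \sum_u \sum_w N u w * A u * A w.
  rewrite rmorph_sum -sumrB; apply: eq_bigr => u _ /=.
  rewrite rmorphM rmorphB rmorphM rmorph_sum /= mulrBl mulr_suml; congr (_ - _).
    by rewrite -/(A u) rmorph_nat; ring.
  by apply: eq_bigr => w _; rewrite rmorphM mulrAC.
have le_E : \sum_u \sum_w N u w * A u * A w <= \sum_u \sum_w N u w * A u ^+ 2 * (H w / H u).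
  suff: 2 * \sum_u \sum_w N u w * A u * A w <=
        2 * \sum_u \sum_w N u w * A u ^+ 2 * (H w / H u) by rewrite ler_pM2l.
  rewrite !mulr_natl !mulr2n.
  rewrite [X in _ <= X + _]exchange_big -!big_split; apply: ler_sum => u _ /=.
  rewrite -!big_split; apply: ler_sum => w _ /=.
  rewrite [N w u]NC -subr_ge0.
  have -> : N u w * A w ^+ 2 * (H u / H w) + N u w * A u ^+ 2 * (H w / H u) -
     (N u w * A u * A w + N u w * A u * A w) =
     N u w * (A w * H u - A u * H w) ^+ 2 / (H u * H w).
    by field; rewrite !gt_eqF ?H0.
  by apply: divr_ge0; apply: mulr_ge0; rewrite ?sqr_ge0 ?N0 // ltW.
(* The hypothesis [kk_h] leaves a surplus of [A u ^+ 2 / H u] at every vertex. *)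
have le_F : \sum_u \sum_w N u w * A u ^+ 2 * (H w / H u) <= \sum_u (2 * A u ^+ 2 - A u ^+ 2 / H u).
  apply: ler_sum => u _.
  have -> : \sum_w N u w * A u ^+ 2 * (H w / H u) = A u ^+ 2 / H u * \sum_w N u w * H w.
    by rewrite mulr_sumr; apply: eq_bigr => w _; field; rewrite gt_eqF ?H0.
  have -> : 2 * A u ^+ 2 - A u ^+ 2 / H u = A u ^+ 2 / H u * (2 * H u - 1).
    by field; rewrite gt_eqF ?H0.
  by apply: ler_wpM2l; rewrite // divr_ge0 ?sqr_ge0 // ltW.
have {le_E le_F} leB : \sum_u A u ^+ 2 / H u <= (bform a a)%:~R.
  rewrite def_B lerBrDl; apply: le_trans (lerD le_E (lexx _)) _.
  apply: le_trans (lerD le_F (lexx _)) _.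
  by rewrite -big_split /=; apply: ler_sum => u _; rewrite subrK.
have : A v ^+ 2 / H v <= (bform a a)%:~R.
  apply: le_trans leB; rewrite (bigD1 v) //= lerDl sumr_ge0 // => u _.
  by rewrite divr_ge0 ?sqr_ge0 // ltW.
by rewrite ler_pdivrMr // mulrC -rmorphXn -rmorphM ler_int.
Qed.

Lemma bform_ge0 a : 0 <= bform a a.
Proof.
have [v|V0] := pickP (fun _ : V => true); last by rewrite /bform big1 // => v; have := V0 v.
move=> _; have := le_trans (sqr_ge0 (a v)) (bform_ge a v).
by rewrite pmulr_rge0.
Qed.

Lemma bform_eq0 a : bform a a <= 0 -> a = 0.
Proof.
move=> a0; apply/ffunP => v; rewrite ffunE; apply/eqP; rewrite -sqrf_eq0 eq_le sqr_ge0 andbT.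
by apply: le_trans (bform_ge a v) _; rewrite pmulr_rle0.
Qed.

(** From a_v^2 <= 2 h_v <= (2 h_v)^2. *)
Lemma root_bound a v : bform a a = 2 -> `|a v| <= 2 * h v.
Proof. by move=> a2; have := bform_ge a v; rewrite a2; nia. Qed.

(** A negative entry at v means kk a v > a v >= 0. Positivity of the form on a - simple_root v gives
    kk a v <= 2. The value 2 makes this difference isotropic, hence zero; the value 1 forces a v =
    0, and then kk a v <= 0. *)
Lemma positive_root_srefl S a : nonneg a -> bform a a = 2 -> indep S ->
  nonneg (srefl S a) \/ exists2 v, v \in S & a = simple_root v.
Proof.
move=> a0 a2 Si; have [[v vneg]|nv] := pselect (exists v, srefl S a v < 0); last first.
  by left=> v; rewrite leNgt; apply/negP => ?; apply: nv; exists v.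
right; move: vneg; rewrite ffunE; case: ifP => [vS|_]; last by rewrite ltNge a0.
move=> lt_k; exists v => //.
pose s := simple_root v; have kE : bform a s = kk a v by apply: bform_simple.
have s2 : bform s s = 2 by apply: bform_simple_simple.
have bE : bform (a - s) (a - s) = 4 - 2 * kk a v.
  by rewrite bformDl !bformDr !bformNl ![bform _ (- s)]bformC !bformNl [bform s a]bformC a2 s2 kE; lia.
have k_le2 : kk a v <= 2 by have := bform_ge0 (a - s); rewrite bE; lia.
have [k2|k1] : kk a v = 2 \/ kk a v = 1 by have := a0 v; lia.
  by apply/eqP; rewrite -subr_eq0 -/s; apply/eqP/bform_eq0; rewrite bE k2.
have av0 : a v = 0 by have := a0 v; lia.
have : kk a v <= 0 by rewrite /kk av0 mulr0 sub0r oppr_le0 sumr_ge0 // => u _; rewrite mulr_ge0.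
by rewrite k1.
Qed.

(** On vectors supported on S the reflection is -1, so only a = 0 could stay nonnegative. *)
Lemma indep_root S a : nonneg a -> bform a a = 2 -> indep S ->
  (forall v, v \notin S -> a v = 0) -> exists2 v, v \in S & a = simple_root v.
Proof.
move=> a0 a2 Si aS; have [na|//] := positive_root_srefl a0 a2 Si.
have {aS}ra : srefl S a = - a.
  apply/ffunP => v; rewrite !ffunE; case: ifP => vS; last by rewrite aS ?vS ?oppr0.
  rewrite /kk big1 => [|u _]; first by rewrite subr0 mulr_natl mulr2n opprD addrA subrr sub0r.
  by have [uS|/aS->] := boolP (u \in S); [rewrite Si // mul0r | rewrite mulr0].
suff a_0 : a = 0 by move: a2; rewrite a_0 /bform big1 // => v _; rewrite ffunE mulr0.
apply/ffunP => v; rewrite ffunE; apply/eqP; rewrite eq_le (a0 v) andbT -oppr_ge0.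
by have := na v; rewrite ra ffunE.
Qed.

End Positive.

(** * Firing sinks by rank, and tracing roots back in time *)

Section Orientation.
Variable h : V -> int.
Hypothesis nloop : forall v, nedges v v = 0%N.
Hypothesis h_gt0 : forall v, 0 < h v.
Hypothesis kk_h : forall v, 1 <= 2 * h v - \sum_u nb v u * h u.

Definition orientation (arr : rel V) : Prop := forall u v, nedges u v = (arr u v + arr v u)%N.

(* Every nonempty set of vertices contains a sink of the induced subquiver,
   since otherwise its indicator vector has nonpositive Tits form. *)
Lemma relative_sink arr (T : {set V}) : orientation arr -> T != set0 ->
  exists2 v, v \in T & forall w, w \in T -> ~~ arr v w.
Proof.
move=> arrP T0; apply: contrapT => nv.
have out v : v \in T -> exists2 w, w \in T & arr v w.
  move=> vT; apply: contrapT => nw; apply: nv; exists v => // w wT.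
  by apply/negP => vw; apply: nw; exists w.
pose a : vec := [ffun v => (v \in T)%:Z].
have aT v : v \in T -> a v = 1 by move=> vT; rewrite ffunE vT.
have aN v : v \notin T -> a v = 0 by move=> /negPf vT; rewrite ffunE vT.
suff /(bform_eq0 h_gt0 kk_h) a_0 : bform a a <= 0.
  by have [v /aT] := set0Pn _ T0; rewrite a_0 ffunE.
have -> : bform a a = \sum_(v in T) (2 - \sum_(u in T) nb v u).
  rewrite [RHS]big_mkcond; apply: eq_bigr => v _; case: ifPn => vT; last by rewrite aN ?mulr0.
  rewrite aT // mulr1 /kk aT // mulr1; congr (_ - _).
  rewrite [RHS]big_mkcond; apply: eq_bigr => u _.
  by case: ifPn => uT; rewrite ?(aT _ uT) ?(aN _ uT) ?mulr1 ?mulr0.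
rewrite sumrB subr_le0.
(* Counting degrees inside T by arrows: the form is 2 (#T - #arrows), and each vertex of T emits an
   arrow. *)
have -> : \sum_(v in T) \sum_(u in T) nb v u = \sum_(v in T) 2 * \sum_(u in T) (arr v u)%:Z.
  under eq_bigr => v _ do under eq_bigr => u _ do rewrite arrP PoszD.
  under eq_bigr do rewrite big_split /=.
  rewrite big_split /= [X in _ + X]exchange_big -big_split /=.
  by apply: eq_bigr => v _; rewrite mulr_natl.
apply: ler_sum => v /out[w wT vw]; rewrite (bigD1 w) //= vw.
by rewrite mulrDr lerDl mulr_ge0 // sumr_ge0.
Qed.

Variable arr : rel V.
Hypothesis arrP : orientation arr.

Definition rank v : nat := #|[set w | connect arr v w]|.

(** If u were on a cycle, its strong component T would have no sink: each member takes a next step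
    inside T. *)
Lemma arr_acyclic u v : arr u v -> ~~ connect arr v u.
Proof.
move=> uv; apply/negP => vu; pose T := [set w | connect arr u w && connect arr w u].
have [|w] := @relative_sink arr T arrP; first by apply/set0Pn; exists u; rewrite inE connect0.
rewrite inE => /andP[uw wu] wT.
have [/eqP|] := altP (w =P u).
  move=> /eqP wu'; subst w; have := wT v; rewrite inE uv (connect1 uv) vu.
  by move=> /(_ isT).
case/connectP: wu => [[|x p] /=]; first by move=> _ ->; rewrite eqxx.
case/andP => wx xp /esym lastu _; have := wT x; rewrite inE wx.
rewrite (connect_trans uw (connect1 wx)) /=.
by rewrite (_ : connect arr x u) // => [/(_ isT)//|]; apply/connectP; exists p.
Qed.

Lemma rank_arr u v : arr u v -> (rank v < rank u)%N.
Proof.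
move=> uv; apply: proper_card; apply/properP; split.
  by apply/subsetP => w; rewrite !inE; apply: connect_trans (connect1 uv).
by exists u; rewrite !inE ?connect0 // arr_acyclic.
Qed.

(* Time is read modulo [period]. At time t the sinks of rank t are fired, which
   reverses the arrows at them; a full period restores the orientation. *)
Definition period : nat := #|V|.+1.
Definition fired t v : bool := (rank v < t %% period)%N.
Definition fire t : {set V} := [set v | rank v == (t %% period)%N].
Definition arrow t : rel V :=
  [rel u v | if fired t u == fired t v then arr u v else arr v u].
Definition flip (S : {set V}) (e : rel V) : rel V :=
  [rel u v | if (u \in S) == (v \in S) then e u v else e v u].

Lemma rank_lt v : (rank v < period)%N.
Proof. by rewrite ltnS /rank max_card. Qed.

Lemma arrow_orientation t : orientation (arrow t).
Proof. by move=> u v; rewrite arrP /arrow /= [fired t v == _]eq_sym; case: ifP => // _; rewrite addnC. Qed.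

Lemma arrowK n : arrow (n * period) =2 arr.
Proof. by move=> u v; rewrite /arrow /fired /= modnMl !ltn0. Qed.

(** Arrows lower the rank, so at time t all original targets of u have been fired, and the arrows
    between them and u now point to u. *)
Lemma fire_sink t u v : u \in fire t -> ~~ arrow t u v.
Proof.
rewrite /arrow /fired /= inE => /eqP <-; rewrite ltnn.
case: ltnP => [lt_vu|le_uv] /=; first by apply: contraL lt_vu => /rank_arr; rewrite -leqNgt => /ltnW.
by apply/negP => /rank_arr; rewrite ltnNge le_uv.
Qed.

Lemma arrow_flip t : arrow t.+1 =2 flip (fire t) (arrow t).
Proof.
move=> u v; rewrite /arrow /flip /fired /= !inE.
have [lt_t|] := ltnP (t %% period)%N.+1 period.
  have -> : (t.+1 %% period = (t %% period).+1)%N.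
    by rewrite -addn1 -modnDml addn1 modn_small.
  rewrite !ltnS; move: (t %% _)%N => k.
  by case: (ltngtP (rank u) k) => _; case: (ltngtP (rank v) k) => _.
(* End of a period: every vertex has been fired, each arrow has been reversed twice, and the count
   restarts at 0. *)
move=> le_t; have lt_t : (t %% period < period)%N by rewrite ltn_mod.
have mt : period = (t %% period)%N.+1 by apply/eqP; rewrite eqn_leq le_t.
have -> : (t.+1 %% period = 0)%N.
  by rewrite -addn1 -modnDml addn1 -mt modnn.
have rk w : (rank w <= t %% period)%N by rewrite -ltnS -mt rank_lt.
rewrite !ltn0 /=; have := rk u; have := rk v; move: (t %% _)%N => k.
by case: (ltngtP (rank u) k) => _; case: (ltngtP (rank v) k) => _.
Qed.

Lemma fire_indep t : indep (fire t).
Proof.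
by move=> u v ut vt; rewrite (arrow_orientation t) (negPf (fire_sink v ut)) (negPf (fire_sink u vt)).
Qed.

Arguments fire_indep : clear implicits.

Lemma fire_ex v t : exists2 i, (i < period)%N & v \in fire (t + i).
Proof.
have lt_r := rank_lt v; have lt_t : (t %% period < period)%N by rewrite ltn_mod.
have [le_tr|lt_rt] := leqP (t %% period)%N (rank v).
  exists (rank v - t %% period)%N; first by apply: leq_ltn_trans lt_r; apply: leq_subr.
  by rewrite inE -modnDml subnKC // modn_small.
exists (rank v + period - t %% period)%N; first by rewrite ltn_subLR; lia.
rewrite inE -modnDml subnKC; last by lia.
by rewrite modnDr modn_small.
Qed.

(* The Euler form <h, a> of the quiver oriented by [arrow t]. *)
Definition potential t a : int :=
  \sum_v h v * a v - \sum_u \sum_v (arrow t u v)%:Z * (h u * a v).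

(** The Euler form is preserved when the orientation and both arguments are reflected. Here h is not
    reflected; the correction pairs the simple roots of the fired vertices, now sources, with the
    reflected vector, and each pairing is - a v. *)
Lemma potential_srefl t a :
  potential t.+1 (srefl (fire t) a) =
  potential t a - \sum_(v in fire t) (2 * h v - \sum_u nb v u * h u) * a v.
Proof.
set S := fire t; have Si : indep S := fire_indep t.
rewrite /potential; set a' := srefl S a.
have E1 : \sum_v h v * a' v = \sum_v h v * a v - \sum_(v in S) h v * kk a v.
  rewrite [\sum_(v in S) _]big_mkcond -sumrB; apply: eq_bigr => v _.
  by rewrite ffunE; case: ifP => _; rewrite ?subr0 ?mulrBr.
have E2 : \sum_u \sum_v (arrow t.+1 u v)%:Z * (h u * a' v) =
    \sum_u \sum_v (arrow t u v)%:Z * (h u * a v)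
    - \sum_(v in S) \sum_u nb v u * h u * a v + \sum_(u in S) \sum_v nb u v * (h u * a v).
  have -> : \sum_(v in S) \sum_u nb v u * h u * a v =
     \sum_u \sum_(v in S) nb v u * h u * a v by rewrite exchange_big.
  rewrite [\sum_(u in S) _]big_mkcond -sumrB -big_split; apply: eq_bigr => u _ /=.
  rewrite [\sum_(v in S) _]big_mkcond -sumrB.
  have [uS|uS] := boolP (u \in S); last first.
    rewrite addr0; apply: eq_bigr => v _; rewrite arrow_flip /flip /= (negPf uS) ffunE.
    rewrite -/S; have [vS|vS] := boolP (v \in S); last by rewrite subr0.
    rewrite (negPf (fire_sink _ vS)) mul0r (arrow_orientation t) (negPf (fire_sink _ vS)) add0n.
    by rewrite mulrA subrr.
  rewrite -big_split; apply: eq_bigr => v _ /=; rewrite arrow_flip /flip /= -/S uS ffunE.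
  rewrite (negPf (fire_sink _ uS)) mul0r sub0r.
  have [vS|vS] := boolP (v \in S).
    by rewrite eqxx !Si // !mul0r oppr0.
  by rewrite (arrow_orientation t) (negPf (fire_sink _ uS)) add0n oppr0 add0r.
rewrite E1 E2.
have -> : \sum_(v in S) (2 * h v - \sum_u nb v u * h u) * a v =
  \sum_(v in S) h v * kk a v + \sum_(u in S) \sum_v nb u v * (h u * a v) -
  \sum_(v in S) \sum_u nb v u * h u * a v.
  rewrite -big_split -sumrB; apply: eq_bigr => v _ /=.
  rewrite mulrBl mulr_suml; congr (_ - _); rewrite /kk mulrBr mulr_sumr.
  rewrite [X in _ - X + _](eq_bigr (fun u => nb v u * (h v * a u))) => [|u _].
    by rewrite subrK mulrA [h v * 2]mulrC.
  by rewrite mulrCA.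
lia.
Qed.

Definition pot_bound : int := \sum_v h v * (2 * h v) + \sum_u \sum_v h u * (2 * h v).

Lemma potential_bound t a : bform a a = 2 -> `|potential t a| <= pot_bound.
Proof.
move=> a2; apply: le_trans (ler_normB _ _) _; apply: lerD.
  apply: le_trans (ler_norm_sum _ _ _) _; apply: ler_sum => v _.
  by rewrite normrM (gtr0_norm (h_gt0 v)) ler_wpM2l ?(ltW (h_gt0 v)) // (root_bound h_gt0 kk_h).
apply: le_trans (ler_norm_sum _ _ _) _; apply: ler_sum => u _.
apply: le_trans (ler_norm_sum _ _ _) _; apply: ler_sum => v _.
have uv : `|h u * a v| <= h u * (2 * h v).
  by rewrite normrM (gtr0_norm (h_gt0 u)) ler_wpM2l ?(ltW (h_gt0 u)) // (root_bound h_gt0 kk_h).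
by case: (arrow t u v); rewrite ?mul1r // mul0r normr0 (le_trans _ uv).
Qed.

(* [hits t T b u]: going back in time from T to t+1, the positive roots b stay
   positive and reach the simple root of u, which is fired at time t. *)
Definition hits (t T : nat) (b : nat -> vec) (u : V) : Prop :=
  [/\ (t < T)%N, u \in fire t, b t.+1 = simple_root u,
    forall i, (t < i < T)%N -> b i.+1 = srefl (fire i) (b i) &
    forall i, (t < i <= T)%N -> nonneg (b i) /\ bform (b i) (b i) = 2].

(** The potential of a root lies between [- pot_bound] and [pot_bound], so it cannot grow by 1 over
    each of [2 * pot_bound + 1] periods. *)
Definition window : nat := (period * (2 * `|pot_bound| + 1)).+1.

(** Each step back adds to the potential the fired coefficients, weighted by the Cartan matrix on h.
    Over a period every vertex is fired, so while the vector stays nonnegative the potential grows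
    by at least 1, the zero vector being excluded by its form value. Boundedness forces a step that
    leaves the nonnegative vectors, and this happens only at the simple root of a fired vertex. *)
Lemma hit T a : (window <= T)%N -> nonneg a -> bform a a = 2 ->
  exists (t : nat) (b : nat -> vec) (u : V), [/\ hits t T b u, b T = a & (T <= t + window)%N].
Proof.
move=> leWT a0 a2.
pose back := fix back n := if n is n'.+1 then srefl (fire (T - n'.+1)) (back n') else a.
have back2 n : bform (back n) (back n) = 2.
  by elim: n => //= n IHn; rewrite bform_srefl //; apply: fire_indep.
have [n lt_n nneg] : exists2 n, (n <= window)%N & ~ nonneg (back n).
  apply: contrapT => neg.
  have pos n : (n <= window)%N -> nonneg (back n).
    by move=> le_n; apply: contrapT => nn; apply: neg; exists n.
  pose P n := potential (T - n) (back n).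
  have Pstep n : (n < window)%N -> P n.+1 = P n + \sum_(v in fire (T - n.+1))
      (2 * h v - \sum_u nb v u * h u) * back n.+1 v.
    move=> lt_n; rewrite /P; have -> : (T - n)%N = (T - n.+1).+1 by lia.
    have -> : back n = srefl (fire (T - n.+1)) (back n.+1) by rewrite /= sreflK //; apply: fire_indep.
    by rewrite potential_srefl subrK.
  have term0 n v : (n <= window)%N -> 0 <= (2 * h v - \sum_u nb v u * h u) * back n v.
    by move=> /pos /(_ v); have := kk_h v; nia.
  (* Second clause: if the potential has not grown over i steps, every vertex fired in them has
     coefficient 0 at the end. *)
  have Pmono n i : (n + i <= window)%N -> P n <= P (n + i)%N /\
      (P (n + i)%N <= P n -> forall v, (exists2 j, (j < i)%N & v \in fire (T - (n + j).+1)) ->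
        back (n + i)%N v = 0).
    elim: i => [|i IHi] le_ni; first by rewrite addn0; split=> // _ v [].
    have [|P1 P2] := IHi; first by lia.
    rewrite addnS Pstep; last by lia.
    set D := \sum_(v in _) _; have D0 : 0 <= D by apply: sumr_ge0 => v _; apply: term0; lia.
    split=> [|leP v [j]]; first by lia.
    have fire0 : v \in fire (T - (n + i).+1) -> back (n + i).+1 v = 0.
      move=> vf; have : D <= 0 by lia.
      rewrite /D (bigD1 v) //; set E := (X in _ + X <= 0).
      have E0 : 0 <= E by apply: sumr_ge0 => w _; apply: term0; lia.
      have := kk_h v; have : 0 <= back (n + i).+1 v by apply: pos; lia.
      nia.
    rewrite ltnS leq_eqVlt => /orP[/eqP->|lt_j] vj; first exact: fire0.
    have [|vf] := boolP (v \in fire (T - (n + i).+1)); first exact: fire0.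
    by rewrite /= ffunE (negPf vf) P2 //; [lia | exists j].
  have Pperiod n : (n + period <= window)%N -> P n + 1 <= P (n + period)%N.
    move=> le_n; have [P1 P2] := Pmono n period le_n.
    have [lt_P|le_P] := ltP (P n) (P (n + period)%N); first by lia.
    suff b0 : back (n + period)%N = 0.
      by have := back2 (n + period)%N; rewrite b0 /bform big1 // => v _; rewrite ffunE mulr0.
    apply/ffunP => v; rewrite ffunE; apply: P2 => //.
    have [i lt_i vi] := fire_ex v (T - (n + period)).
    exists (period - i.+1)%N; first by lia.
    by rewrite (_ : (T - (n + (period - i.+1)).+1)%N = (T - (n + period) + i)%N) //; lia.
  have Pk k : (k * period <= window)%N -> P 0%N + k%:Z <= P (k * period)%N.
    elim: k => [|k IHk] le_k; first by rewrite addr0.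
    rewrite mulSn addnC; have := Pperiod (k * period)%N; have := IHk.
    by move: le_k; rewrite mulSn => le_k; move=> /(_ ltac:(lia)) ? /(_ ltac:(lia)); lia.
  pose k := (2 * `|pot_bound| + 1)%N.
  have : P 0%N + k%:Z <= P (k * period)%N by apply: Pk; rewrite mulnC leqnSn.
  have : `|P 0%N| <= pot_bound by apply: potential_bound.
  have : `|P (k * period)%N| <= pot_bound by apply: potential_bound.
  by rewrite {}/k; move: (P _) (P _) => x y; lia.
(* m is the first step back at which nonnegativity fails; one step before, the root is simple at a
   fired vertex. *)
have [m nm min_m] := ex_minnP (P := fun n => `[< ~ nonneg (back n) >])
  (ex_intro _ n (introT (asboolP _) nneg)).
have le_mn : (m <= n)%N by apply: min_m; apply/asboolP.
have pos i : (i < m)%N -> nonneg (back i).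
  move=> lt_i; apply: contrapT => nn; have := min_m i; move/(_ (introT (asboolP _) nn)).
  by rewrite leqNgt lt_i.
move/asboolP: nm; case: m min_m le_mn pos => [|m] min_m le_mn pos nm; first by case: nm.
have [//|[u uf bu]] := positive_root_srefl nloop h_gt0 kk_h (pos m (leqnn _)) (back2 m)
  (fire_indep (T - m.+1)).
exists (T - m.+1)%N, (fun i => back (T - i)%N), u; split; [split=> // | by rewrite subnn | by lia].
- by lia.
- by rewrite (_ : (T - (T - m.+1).+1)%N = m) //; lia.
- move=> i lt_i; rewrite (_ : (T - i)%N = (T - i.+1).+1) /=; last by lia.
  rewrite (_ : (T - (T - i.+1).+1)%N = i); last by lia.
  by rewrite sreflK //; apply: fire_indep.
- by move=> i lt_i; split=> //; apply: pos; lia.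
Qed.

End Orientation.
End RootCombinatorics.

(** * Representations and reflections *)

Section Model.
Variables (K L : fieldType) (iota : {rmorphism K -> L}) (Gamma : quiver).
Variable rho : rational_structure iota Gamma.
Local Notation V := (vert Gamma).
Local Notation G := (Gal iota).
Local Notation av := (actv rho).
Implicit Types (u v w : V) (s t : G) (H : G -> Prop) (e : rel V) (S : {set V}).

(* A representation on the direct sum of all its vertex spaces: [tp v] is the
   projection onto the space at v, [tf u v] the sum of the maps along the arrows
   u -> v, and [ta s] the semilinear action of s. *)
Record trep : Type := TRep {
  tsp :> lmodType L;
  tp : V -> {linear tsp -> tsp};
  tf : V -> V -> {linear tsp -> tsp};
  ta : G -> tsp -> tsp;
  tpp : forall u v x, tp u (tp v x) = if u == v then tp v x else 0;
  tp_sum : forall x, \sum_v tp v x = x;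
  tpf : forall u v w x, tp w (tf u v x) = if w == v then tf u v x else 0;
  tfp : forall u v w x, tf u v (tp w x) = if w == u then tf u v x else 0 }.
Arguments tp {t} v. Arguments tf {t} u v. Arguments ta {t} s x.
Implicit Types M N : trep.

Lemma tp_idem M v (x : M) : tp v (tp v x) = tp v x.
Proof. by rewrite tpp eqxx. Qed.

Lemma tf_tp M u v (x : M) : tf u v (tp u x) = tf u v x.
Proof. by rewrite tfp eqxx. Qed.

Lemma tp_tf M u v (x : M) : tp v (tf u v x) = tf u v x.
Proof. by rewrite tpf eqxx. Qed.

Lemma tp_ext M (x y : M) : (forall v, tp v x = tp v y) -> x = y.
Proof. by move=> xy; rewrite -[x]tp_sum -[y]tp_sum; apply: eq_bigr. Qed.

Lemma tp_partial M (P : pred V) v (x : M) :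
  tp v (\sum_(w | P w) tp w x) = if P v then tp v x else 0.
Proof.
rewrite linear_sum; case: ifPn => Pv.
  rewrite (bigD1 v) //= tp_idem big1 ?addr0 // => w /andP[_ wv].
  by rewrite tpp eq_sym (negPf wv).
rewrite big1 // => w Pw; rewrite tpp; case: eqP => // vw.
by rewrite vw Pw in Pv.
Qed.

Definition oriented e M : Prop := forall u v (x : M), ~~ e u v -> tf u v x = 0.

(** The action laws are asked on H only, so one [trep] can be viewed over any subgroup; [ta s] is
    arbitrary for s outside H. *)
Record galois H M : Prop := Galois {
  gal_lin : forall s, H s -> forall c (x y : M), ta s (c *: x + y) = s c *: ta s x + ta s y;
  gal_mulE : forall s t, H s -> H t -> forall x : M, ta (s * t)%g x = ta s (ta t x);
  gal_oneE : forall x : M, ta 1%g x = x;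
  gal_tp : forall s, H s -> forall v (x : M), ta s (tp v x) = tp (av s v) (ta s x);
  gal_tf : forall s, H s -> forall u v (x : M),
    ta s (tf u v x) = tf (av s u) (av s v) (ta s x) }.

Definition good H e M : Prop := galois H M /\ oriented e M.

Definition tcont H M : Prop := forall x : M, discrete_at H (@ta M) x.

Record hom H M N (phi : {linear M -> N}) : Prop := Hom {
  hom_p : forall v x, phi (tp v x) = tp v (phi x);
  hom_f : forall u v x, phi (tf u v x) = tf u v (phi x);
  hom_a : forall s, H s -> forall x, phi (ta s x) = ta s (phi x) }.

Definition tiso H M N : Prop := exists (phi : {linear M -> N}) (psi : {linear N -> M}),
  [/\ hom H phi, hom H psi, cancel phi psi & cancel psi phi].

(** Phrased by idempotents rather than by summands, since it is homs that transfer along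
    reflections. *)
Definition tindec H M : Prop := (exists x : M, x <> 0) /\
  forall f : {linear M -> M}, hom H f -> (forall x, f (f x) = f x) ->
    (forall x, f x = 0) \/ (forall x, f x = x).

Section GaloisAction.
Variables (H : G -> Prop) (M : trep).
Hypothesis galM : galois H M.

Lemma ta0 s : H s -> ta s (0 : M) = 0.
Proof.
move=> Hs; have := gal_lin galM Hs (-1) 0 0.
by rewrite rmorphN rmorph1 !scaleN1r !addNr.
Qed.

Lemma taD s (x y : M) : H s -> ta s (x + y) = ta s x + ta s y.
Proof. by move=> Hs; rewrite -[x]scale1r (gal_lin galM) // rmorph1 !scale1r. Qed.

Lemma taZ s c (x : M) : H s -> ta s (c *: x) = s c *: ta s x.
Proof. by move=> Hs; rewrite -[c *: x]addr0 (gal_lin galM) // ta0 // addr0. Qed.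

Lemma taB s (x y : M) : H s -> ta s (x - y) = ta s x - ta s y.
Proof. by move=> Hs; rewrite taD // -scaleN1r taZ // rmorphN rmorph1 scaleN1r. Qed.

Lemma ta_sum s I (r : seq I) (P : pred I) (F : I -> M) : H s ->
  ta s (\sum_(i <- r | P i) F i) = \sum_(i <- r | P i) ta s (F i).
Proof. by move=> Hs; apply: (big_morph (ta s) (fun x y => taD x y Hs) (ta0 Hs)). Qed.

Hypothesis subH : subgroup H.

Lemma taK s (x : M) : H s -> ta s^-1%g (ta s x) = x.
Proof. by move=> Hs; rewrite -(gal_mulE galM) ?mulVg ?(gal_oneE galM) //; apply: (subV subH). Qed.

Lemma taVK s (x : M) : H s -> ta s (ta s^-1%g x) = x.
Proof. by move=> Hs; rewrite -(gal_mulE galM) ?mulgV ?(gal_oneE galM) //; apply: (subV subH). Qed.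

Lemma ta_inj s (x y : M) : H s -> ta s x = ta s y -> x = y.
Proof. by move=> Hs xy; rewrite -[x](taK _ Hs) xy taK. Qed.
End GaloisAction.

Lemma avK s v : av s^-1%g (av s v) = v.
Proof. by rewrite -actvM mulVg actv1. Qed.

Lemma avVK s v : av s (av s^-1%g v) = v.
Proof. by rewrite -actvM mulgV actv1. Qed.

Lemma av_inj s : injective (av s).
Proof. exact: can_inj (avK s). Qed.

Lemma av_bij s : bijective (av s).
Proof. by exists (av s^-1%g); [apply: avK | apply: avVK]. Qed.

Lemma galois_sub H H' M : (forall s, H s -> H' s) -> galois H' M -> galois H M.
Proof. by move=> HH' [m1 m2 m3 m4 m5]; split=> // *; rewrite ?m1 ?m2 ?m4 ?m5 //; apply: HH'. Qed.

Lemma good_sub H H' e M : (forall s, H s -> H' s) -> good H' e M -> good H e M.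
Proof. by move=> HH' [gM oM]; split=> //; apply: galois_sub gM. Qed.

Lemma hom_sub H H' M N (phi : {linear M -> N}) : (forall s, H s -> H' s) -> hom H' phi -> hom H phi.
Proof. by move=> HH' [h1 h2 h3]; split=> // s /HH'; apply: h3. Qed.

Lemma tindec_sub H H' M : (forall s, H s -> H' s) -> tindec H M -> tindec H' M.
Proof. by move=> HH' [nz ind]; split=> // f hf; apply: ind; apply: hom_sub hf. Qed.

Lemma hom_id H M : hom H (idfun : {linear M -> M}).
Proof. by split. Qed.

Lemma hom_comp H M N (P : trep) (f : {linear M -> N}) (g : {linear N -> P}) :
  hom H f -> hom H g -> hom H (g \o f : {linear M -> P}).
Proof. by move=> [f1 f2 f3] [g1 g2 g3]; split=> * /=; rewrite ?f1 ?f2 ?f3 ?g1 ?g2 ?g3. Qed.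

Lemma hom0 H M N : galois H N -> hom H (\0 : {linear M -> N}).
Proof. by move=> gN; split=> * /=; rewrite ?linear0 // (ta0 gN). Qed.

Lemma homB H M N (f g : {linear M -> N}) : galois H N -> hom H f -> hom H g ->
  hom H (f \- g : {linear M -> N}).
Proof.
move=> gN [f1 f2 f3] [g1 g2 g3].
by split=> * /=; rewrite ?linearB ?(taB gN) // ?f1 ?f2 ?f3 ?g1 ?g2 ?g3.
Qed.

Lemma tiso_intro H M N (f : {linear M -> N}) (g : {linear N -> M}) :
  hom H f -> cancel f g -> cancel g f -> tiso H M N.
Proof.
move=> [fp ff fa] fK gK; exists f, g; split=> //.
by split=> * ; apply: (can_inj fK); rewrite gK ?fp ?ff ?fa // gK.
Qed.

Lemma tiso_refl H M : tiso H M M.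
Proof. by exists (idfun : {linear M -> M}), (idfun : {linear M -> M}); split=> //; apply: hom_id. Qed.

Lemma tiso_sym H M N : tiso H M N -> tiso H N M.
Proof. by move=> [f [g [hf hg fg gf]]]; exists g, f. Qed.

Lemma tiso_trans H M N (P : trep) : tiso H M N -> tiso H N P -> tiso H M P.
Proof.
move=> [f [f' [hf hf' ff' f'f]]] [g [g' [hg hg' gg' g'g]]].
exists (g \o f : {linear M -> P}), (f' \o g' : {linear P -> M}).
split; try exact: hom_comp; by move=> x /=; rewrite ?gg' ?ff' ?f'f ?g'g.
Qed.

Lemma tiso_sub H H' M N : (forall s, H s -> H' s) -> tiso H' M N -> tiso H M N.
Proof.
by move=> HH' [f [g [hf hg fg gf]]]; exists f, g; split=> //; apply: hom_sub HH' _.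
Qed.

Lemma tiso_tcont H M N : tiso H M N -> tcont H M -> tcont H N.
Proof.
move=> [f [g [hf hg fg gf]]] cM x; have [xs xsP] := cM (g x); exists xs => s Hs sxs.
by rewrite -[x]gf -(hom_a hf) // xsP.
Qed.

Lemma tiso_tindec H M N : tiso H M N -> tindec H M -> tindec H N.
Proof.
move=> [f [g [hf hg fg gf]]] [[x x0] ind]; split.
  by exists (f x) => fx0; apply: x0; rewrite -[x]fg fx0 linear0.
move=> p hp pp; pose q : {linear M -> M} := (g \o p) \o f.
have hq : hom H q by apply: hom_comp hf _; apply: hom_comp hp hg.
have qq y : q (q y) = q y by rewrite /q /= gf pp.
have [q0|q1] := ind q hq qq; [left|right] => y.
  by rewrite -[p y]gf -[y]gf [g _]q0 linear0.
by rewrite -[p y]gf -[y]gf [g _]q1.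
Qed.

(* [theta : M' -> M] exhibits M' as the reflection of M at the set S of sinks:
   it is an isomorphism away from S, and at each v in S the sequence
   0 -> M'_v -> (+)_(u -> v) M_u -> M_v -> 0 is exact. *)
Record is_refl H e S M M' (theta : {linear M' -> M}) : Prop := IsRefl {
  refl_p : forall v x, theta (tp v x) = if v \in S then 0 else tp v (theta x);
  refl_f : forall u v x, u \notin S -> v \notin S -> theta (tf u v x) = tf u v (theta x);
  refl_a : forall s, H s -> forall x, theta (ta s x) = ta s (theta x);
  refl_inj : forall v (x : M'), v \notin S -> theta (tp v x) = 0 -> tp v x = 0;
  refl_surj : forall y : M, exists x : M', theta x = \sum_(v | v \notin S) tp v y;
  refl_complex : forall v (x : M'), v \in S -> \sum_u tf u v (theta (tf v u x)) = 0;
  refl_mono : forall v (x : M'), v \in S -> (forall u, u \notin S -> tf v u x = 0) -> tp v x = 0;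
  refl_epi : forall v (y : M), v \in S -> exists z : M, tp v y = \sum_u tf u v z;
  refl_exact : forall v (z : M), v \in S -> \sum_u tf u v z = 0 ->
    exists x : M', forall u, e u v -> theta (tf v u x) = tp u z }.

(** * The source reflection functor on morphisms *)

Section Mix.
Variables (H : G -> Prop) (e : rel V) (S : {set V}).
Hypothesis sinkS : forall u v, u \in S -> ~~ e u v.
Hypothesis stabS : forall s v, H s -> (av s v \in S) = (v \in S).

(** Vectors of M in terms of M': the components off S come from [x0], and the component at a sink v
    is the image under the incoming maps of [theta (x v)]. The presentation is not unique; maps out
    of M are defined on it by [linear_of_rel]. *)
Definition mix M M' (theta : {linear M' -> M}) (x0 : M') (x : V -> M') : M :=
  theta x0 + \sum_(v in S) \sum_u tf u v (theta (x v)).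

Section One.
Variables (M M' : trep) (theta : {linear M' -> M}).
Hypotheses (gM : good H e M) (rM : is_refl H e S theta).
Local Notation mix := (mix theta).

Lemma sink_not u v : e u v -> u \notin S.
Proof. by move=> uv; apply: contraL uv => /sinkS. Qed.

Lemma mix_lin c x0 x y0 y :
  mix (c *: x0 + y0) (fun v => c *: x v + y v) = c *: mix x0 x + mix y0 y.
Proof.
rewrite /mix linearP scalerDr addrACA scaler_sumr -big_split; congr (_ + _).
apply: eq_bigr => v _; rewrite scaler_sumr -big_split; apply: eq_bigr => u _ /=.
by rewrite !linearP.
Qed.

(** Components off S lift along [theta] by [refl_surj]; those at S are in the image of the incoming
    maps by [refl_epi], whose sources are off S because S consists of sinks. *)
Lemma mix_total y : exists x0 x, y = mix x0 x.
Proof.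
have [x0 x0E] := refl_surj rM y.
have ex v : exists x, v \in S -> tp v y = \sum_u tf u v (theta x).
  have [vS|vS] := boolP (v \in S); last by exists 0.
  have [z zE] := refl_epi rM y vS; have [x xE] := refl_surj rM z.
  exists x => _; rewrite zE; apply: eq_bigr => u _.
  have [uv|nuv] := boolP (e u v); last by rewrite !(gM.2 _ _ _ nuv).
  by rewrite -[tf u v z]tf_tp -[tf u v (theta x)]tf_tp xE tp_partial (sink_not uv).
exists x0, (fun v => projT1 (cid (ex v))); rewrite /mix x0E -[y in LHS]tp_sum.
rewrite (bigID (mem S)) /= addrC; congr (_ + _); apply: eq_bigr => v vS.
by case: cid => x /= ->.
Qed.

Lemma mix_p w x0 x : tp w (mix x0 x) =
  mix (if w \in S then 0 else tp w x0) (fun v => if v == w then x v else 0).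
Proof.
rewrite /mix linearD; congr (_ + _).
  have := refl_p rM w x0; case: ifP => wS; last by move->.
  rewrite linear0 => _; have [z zE] : exists z, theta x0 = \sum_(v | v \notin S) tp v z.
    exists (theta x0); rewrite -{1}[x0]tp_sum linear_sum [RHS]big_mkcond.
    by apply: eq_bigr => v _; rewrite (refl_p rM) if_neg.
  by rewrite zE tp_partial wS.
rewrite linear_sum; apply: eq_bigr => v _; rewrite linear_sum; apply: eq_bigr => u _ /=.
by rewrite tpf eq_sym; case: eqP => _; rewrite ?linear0.
Qed.

Lemma refl_tp v x : v \notin S -> theta (tp v x) = tp v (theta x).
Proof. by move=> /negPf vS; rewrite (refl_p rM) vS. Qed.

Lemma mix0r x0 : mix x0 (fun=> 0) = theta x0.
Proof. by rewrite /mix big1 ?addr0 // => v _; rewrite big1 // => u _; rewrite !linear0. Qed.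

Lemma mix_off w x0 x : w \notin S -> mix x0 (fun v => if v == w then x v else 0) = theta x0.
Proof.
move=> wS; rewrite -[RHS]mix0r /mix; congr (_ + _); apply: eq_bigr => v vS.
by apply: eq_bigr => u _; case: eqP => // vw; rewrite -vw vS in wS.
Qed.

Lemma mix_on w x : w \in S ->
  mix 0 (fun v => if v == w then x v else 0) = \sum_u tf u w (theta (x w)).
Proof.
move=> wS; rewrite /mix linear0 add0r (bigD1 w) //= eqxx [X in _ + X]big1 ?addr0 //.
by move=> v /andP[_ /negPf vw]; rewrite vw big1 // => u _; rewrite !linear0.
Qed.

Lemma refl_inj_sub u x y : u \notin S -> theta (tp u x) = theta (tp u y) -> tp u x = tp u y.
Proof.
move=> uS xy; apply/eqP; rewrite -subr_eq0 -linearB; apply/eqP/(refl_inj rM) => //.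
by rewrite !linearB xy subrr.
Qed.

(** An arrow into a sink w2 turns the component of [x0] at w1 into a datum at w2; arrows out of
    sinks are zero. *)
Lemma mix_f w1 w2 x0 x : tf w1 w2 (mix x0 x) =
  mix (if (w1 \in S) || (w2 \in S) then 0 else tf w1 w2 x0)
      (fun v => if (v == w2) && (w1 \notin S) then tp w1 x0 else 0).
Proof.
have [w1S|w1S] := boolP (w1 \in S).
  rewrite gM.2 ?sinkS //= -[LHS](linear0 theta) -[LHS]mix0r.
  by congr (mix _ _); apply/funext => v; rewrite andbF.
have [w2S|w2S] /= := boolP (w2 \in S); last first.
  rewrite [LHS](_ : _ = theta (tf w1 w2 x0)).
    rewrite -mix0r /mix; congr (_ + _); apply: eq_bigr => v vS; apply: eq_bigr => u _.
    by case: eqP => // vw2; rewrite -vw2 vS in w2S.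
  rewrite linearD (refl_f rM) // linear_sum big1 ?addr0 // => v vS.
  rewrite linear_sum big1 // => u _.
  by rewrite -[tf u v _]tp_tf tfp; case: eqP => // vw1; rewrite -vw1 vS in w1S.
rewrite linearD linear_sum [X in _ + X]big1 ?addr0 => [|v vS]; last first.
  rewrite linear_sum big1 // => u _.
  by rewrite -[tf u v _]tp_tf tfp; case: eqP => // vw1; rewrite -vw1 vS in w1S.
rewrite /mix linear0 add0r (bigD1 w2) //= [X in _ + X]big1 ?addr0 => [|v /andP[_ vw2]]; last first.
  by rewrite (negPf vw2) big1 // => u _; rewrite !linear0.
rewrite eqxx /= (bigD1 w1) //= [X in _ + X]big1 ?addr0 => [|u uw1]; last first.
  by rewrite refl_tp // tfp eq_sym (negPf uw1).
by rewrite refl_tp // tfp eqxx.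
Qed.

Lemma mix_a s x0 x : H s ->
  ta s (mix x0 x) = mix (ta s x0) (fun v => ta s (x (av s^-1%g v))).
Proof.
move=> Hs; rewrite /mix (taD gM.1) // (refl_a rM) //; congr (_ + _).
rewrite (ta_sum gM.1) // [RHS](reindex _ (onW_bij _ (av_bij s))) /=.
apply: eq_big => [v|v _]; first by rewrite stabS.
rewrite (ta_sum gM.1) // [RHS](reindex _ (onW_bij _ (av_bij s))) /=; apply: eq_bigr => u _.
by rewrite (gal_tf gM.1) // avK (refl_a rM).
Qed.

End One.

Section Two.
Variables (M M' N N' : trep) (theta : {linear M' -> M}) (eta : {linear N' -> N}).
Hypotheses (gM : good H e M) (rM : is_refl H e S theta).
Hypotheses (gN : good H e N) (rN : is_refl H e S eta).

(** Well-definedness of the transfer. Off S it is injectivity of [theta]. At a sink, exactness lifts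
    a relation among the incoming maps to a vector of M', whose image under phi' gives the relation
    in N by [refl_complex]. *)
Lemma mix_zero (phi' : {linear M' -> N'}) x0 x : hom H phi' ->
  mix theta x0 x = 0 -> mix eta (phi' x0) (fun v => phi' (x v)) = 0.
Proof.
move=> hphi mix0; apply: tp_ext => w; rewrite linear0 (mix_p rN).
have := congr1 (tp w) mix0; rewrite linear0 (mix_p rM).
case: ifPn => wS.
  rewrite mix_on // (mix_on eta (fun v => phi' (x v))) // => E.
  have [z zE] := refl_exact rM wS E.
  rewrite -[RHS](refl_complex rN (phi' z) wS); apply: eq_bigr => u _.
  have [uw|nuw] := boolP (e u w); last by rewrite !(gN.2 _ _ _ nuw).
  have uS := sink_not uw.
  have E' : tf w u z = tp u (x w).
    rewrite -tp_tf; apply: (refl_inj_sub rM) => //; rewrite (refl_tp rM) // [in RHS](refl_tp rM) //.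
    by rewrite zE // tp_idem.
  by rewrite -[tf u w _]tf_tp -(refl_tp rN) // -(hom_p hphi) -E' (hom_f hphi).
by rewrite !mix_off // -(hom_p hphi) => /(refl_inj rM wS) ->; rewrite !linear0.
Qed.

(* The source reflection functor on morphisms. *)
Lemma hom_back (phi' : {linear M' -> N'}) : hom H phi' ->
  exists2 phi : {linear M -> N}, hom H phi & forall x, phi (theta x) = eta (phi' x).
Proof.
move=> hphi; pose rel y z := exists x0 x,
  y = mix theta x0 x /\ z = mix eta (phi' x0) (fun v => phi' (x v)).
have [|y|z [x0 [x [/esym/mix_zero E ->]]]|phi phiP] := @linear_of_rel _ M N rel.
- move=> c y y' z z' [x0 [x [-> ->]]] [x0' [x' [-> ->]]].
  exists (c *: x0 + x0'), (fun v => c *: x v + x' v); rewrite mix_lin; split=> //.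
  by rewrite -mix_lin linearP; congr (mix _ _ _); apply/funext => v; rewrite linearP.
- have [x0 [x ->]] := mix_total gM rM y.
  by exists (mix eta (phi' x0) (fun v => phi' (x v))), x0, x.
- exact: E.
have phi_mix x0 x : phi (mix theta x0 x) = mix eta (phi' x0) (fun v => phi' (x v)).
  by symmetry; apply/phiP; exists x0, x.
exists phi; last first.
  move=> x; rewrite -(mix0r theta) phi_mix -(mix0r eta); congr (mix _ _ _).
  by apply/funext => v; rewrite linear0.
split=> [v y|u v y|s Hs y]; have [x0 [x ->]] := mix_total gM rM y; rewrite phi_mix.
- rewrite (mix_p rM) (mix_p rN) phi_mix; congr (mix _ _ _).
    by case: ifP; rewrite ?linear0 ?(hom_p hphi).
  by apply/funext => w; case: ifP; rewrite ?linear0.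
- rewrite (mix_f gM rM) (mix_f gN rN) phi_mix; congr (mix _ _ _).
    by case: ifP; rewrite ?linear0 ?(hom_f hphi).
  by apply/funext => w; case: ifP; rewrite ?linear0 ?(hom_p hphi).
- rewrite (mix_a gM rM) // (mix_a gN rN) // phi_mix (hom_a hphi) //; congr (mix _ _ _).
  by apply/funext => w; rewrite (hom_a hphi).
Qed.

Lemma hom_back_uniq (phi1 phi2 : {linear M -> N}) : hom H phi1 -> hom H phi2 ->
  (forall x, phi1 (theta x) = phi2 (theta x)) -> phi1 =1 phi2.
Proof.
move=> h1 h2 E y; have [x0 [x ->]] := mix_total gM rM y.
rewrite /mix !linearD E !linear_sum; congr (_ + _); apply: eq_bigr => v _.
by rewrite !linear_sum; apply: eq_bigr => u _; rewrite (hom_f h1) (hom_f h2) E.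
Qed.

(** Off S the two maps agree since [eta] is injective there; at a vertex of S a vector is determined
    by its images under the outgoing maps, which land off S. *)
Lemma hom_back_faithful (phi : {linear M -> N}) (phi1 phi2 : {linear M' -> N'}) :
  hom H phi -> hom H phi1 -> hom H phi2 ->
  (forall x, phi (theta x) = eta (phi1 x)) ->
  (forall x, phi (theta x) = eta (phi2 x)) -> phi1 =1 phi2.
Proof.
move=> h h1 h2 E1 E2.
have eq_off v x : v \notin S -> tp v (phi1 x) = tp v (phi2 x).
  by move=> vS; apply: (refl_inj_sub rN) => //; rewrite !(refl_tp rN) // -E1 -E2.
move=> x; apply: tp_ext => v; have [vS|/eq_off//] := boolP (v \in S).
apply/eqP; rewrite -subr_eq0 -linearB; apply/eqP/(refl_mono rN) => // u uS.
rewrite linearB -(hom_f h1) -(hom_f h2).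
by rewrite -[tf v u x]tp_tf (hom_p h1) (hom_p h2) eq_off // subrr.
Qed.
End Two.
End Mix.
End Model.
Arguments tp {K L iota Gamma t} v.
Arguments tf {K L iota Gamma t} u v.
Arguments ta {K L iota Gamma t} s x.

(** * Construction of the reflection at a stable set of sinks *)

Section ReflectionFunctor.
Variables (K L : fieldType) (iota : {rmorphism K -> L}) (Gamma : quiver).
Variable rho : rational_structure iota Gamma.
Local Notation V := (vert Gamma).
Local Notation G := (Gal iota).
Local Notation av := (actv rho).
Local Notation trep := (trep iota Gamma).

Lemma finite_nbhs (H : G -> Prop) (A : V -> G -> Prop) :
  (forall v, exists xs, forall s, H s -> fixes s xs -> A v s) ->
  exists xs, forall s, H s -> fixes s xs -> forall v, A v s.
Proof.
move=> exA; pose xs v := projT1 (cid (exA v)).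
exists (flatten [seq xs v | v <- enum V]) => s Hs sxs v.
apply: (projT2 (cid (exA v))) => // x xxs; apply: sxs.
by apply/flatten_mapP; exists v; rewrite ?mem_enum.
Qed.

Lemma actv_nbhs : exists xs, forall s, fixes s xs -> forall v, av s v = v.
Proof.
have [|xs xsP] := @finite_nbhs (fun=> True) (fun v s => av s v = v).
  move=> v; have [xs xsP] := actv_continuous rho v; exists xs => s _; apply: xsP.
  by move=> _ [a ->]; apply: gal_fix.
by exists xs => s; apply: xsP.
Qed.

Section Construction.
Variables (H : G -> Prop) (e : rel V) (S : {set V}) (M : trep).
Hypothesis subH : subgroup H.
Hypothesis sinkS : forall u v, u \in S -> ~~ e u v.
Hypothesis stabS : forall s v, (av s v \in S) = (v \in S).
Hypothesis stabe : forall s u v, e (av s u) (av s v) = e u v.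
Hypothesis gM : good rho H e M.
Hypothesis epiM : forall v (y : M), v \in S -> exists z : M, tp v y = \sum_u tf u v z.

(** For v in S the entry [z v] is not a vector at v: its components on the sources of the arrows
    into v form an element of the kernel of the map onto the space at v. For v off S it is a vector
    at v. *)
Definition rpred (z : {ffun V -> M}) : Prop := forall v,
  if v \in S then (forall u, ~~ e u v -> tp u (z v) = 0) /\ \sum_u tf u v (z v) = 0
  else tp v (z v) = z v.

Lemma rpred_submod : submod_pred rpred.
Proof.
split=> [v|x y xP yP v|c x xP v].
- case: ifP => _; last by rewrite ffunE linear0.
  by split=> [u _|]; rewrite ?big1 // => *; rewrite ffunE linear0.
- have := xP v; have := yP v; case: ifP => _; rewrite ffunE; last first.
    by rewrite linearD => -> ->.
  move=> [y1 y2] [x1 x2]; split=> [u uv|]; first by rewrite linearD x1 // y1 // addr0.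
  by under eq_bigr do rewrite linearD; rewrite big_split /= x2 y2 addr0.
- have := xP v; case: ifP => _; rewrite ffunE; last by rewrite linearZ => /= ->.
  move=> [x1 x2]; split=> [u uv|]; first by rewrite linearZ /= x1 // scaler0.
  by under eq_bigr do rewrite linearZ; rewrite -scaler_sumr x2 scaler0.
Qed.

Local Notation M' := (subspace rpred_submod).

Lemma rval_off (z : M') v : v \notin S -> tp v (subval z v) = subval z v.
Proof. by move=> /negPf vS; have := subvalP z v; rewrite vS. Qed.

Lemma rval_on (z : M') u v : v \in S -> ~~ e u v -> tp u (subval z v) = 0.
Proof. by move=> vS; have := subvalP z v; rewrite vS => -[+ _]; apply. Qed.

Lemma rval_ker (z : M') v : v \in S -> \sum_u tf u v (subval z v) = 0.
Proof. by move=> vS; have := subvalP z v; rewrite vS => -[]. Qed.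

Definition rp_fun v (z : {ffun V -> M}) : {ffun V -> M} :=
  [ffun w => if w == v then z w else 0].
Lemma rp_linear v : linear (rp_fun v).
Proof.
move=> c x y; apply/ffunP => w; rewrite !ffunE; case: ifP => _ //.
by rewrite scaler0 addr0.
Qed.
Lemma rp_rpred v z : rpred z -> rpred (mklin (rp_linear v) z).
Proof.
move=> zP w; have := zP w; rewrite /= ffunE; have [->|wv] := eqVneq w v => //.
by case: ifP => _ _; rewrite ?linear0 //; split=> [u _|]; rewrite ?big1 // => *; rewrite linear0.
Qed.

(** A reversed arrow, out of a vertex of S, projects the kernel element to one of its components;
    arrows into S have become zero. *)
Definition rf_fun u v (z : {ffun V -> M}) : {ffun V -> M} :=
  [ffun w => if (w == v) && (v \notin S) then
    if u \in S then tp v (z u) else tf u v (z u) else 0].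
Lemma rf_linear u v : linear (rf_fun u v).
Proof.
move=> c x y; apply/ffunP => w; rewrite !ffunE; case: ifP => _.
  by case: ifP => _; rewrite linearP.
by rewrite scaler0 addr0.
Qed.
Lemma rf_rpred u v z : rpred z -> rpred (mklin (rf_linear u v) z).
Proof.
move=> zP w; rewrite /= ffunE; have [->|wv] /= := eqVneq w v; last first.
  by case: ifP => _; rewrite ?linear0 //; split=> [x _|]; rewrite ?big1 // => *; rewrite linear0.
have [vS|vS] /= := boolP (v \in S).
  by split=> [x _|]; rewrite ?big1 // => *; rewrite linear0.
by case: ifP => _; rewrite ?tp_idem // tpf eqxx.
Qed.

Definition ra_fun s (z : {ffun V -> M}) : {ffun V -> M} := [ffun w => ta s (z (av s^-1%g w))].
Lemma ra_rpred s z : H s -> rpred z -> rpred (ra_fun s z).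
Proof.
move=> Hs zP w; have := zP (av s^-1%g w); rewrite stabS ffunE.
have ww : w = av s (av s^-1%g w) by rewrite avVK.
case: ifP => _ [z1]; last by rewrite {1}ww -(gal_tp gM.1) // z1.
move=> z2; split=> [u uw|].
  rewrite -[u](avVK rho s) -(gal_tp gM.1) // z1 ?(ta0 gM.1) //.
  by rewrite stabe.
rewrite {1}ww (reindex _ (onW_bij _ (av_bij rho s))) /=.
under eq_bigr do rewrite -(gal_tf gM.1) //.
by rewrite -(ta_sum gM.1) // z2 (ta0 gM.1).
Qed.

Definition ra (s : G) (z : M') : M' :=
  if pselect (H s) is left Hs then Subspace rpred_submod (ra_rpred Hs (subvalP z)) else z.

Lemma raE s z v : H s -> subval (ra s z) v = ta s (subval z (av s^-1%g v)).
Proof. by rewrite /ra; case: pselect => // Hs _; rewrite /= ffunE. Qed.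

Definition rp v : {linear M' -> M'} := sub_map _ _ (rp_rpred v).
Definition rf u v : {linear M' -> M'} := sub_map _ _ (rf_rpred u v).

Lemma rpE v z w : subval (rp v z) w = if w == v then subval z w else 0.
Proof. by rewrite /= ffunE. Qed.

Lemma rfE u v z w : subval (rf u v z) w = if (w == v) && (v \notin S) then
    if u \in S then tp v (subval z u) else tf u v (subval z u) else 0.
Proof. by rewrite /= ffunE. Qed.

Lemma rval_eq (x y : M') : (forall v, subval x v = subval y v) -> x = y.
Proof. by move=> xy; apply/subval_inj/ffunP. Qed.

Lemma rval0 v : subval (0 : M') v = 0. Proof. by rewrite linear0 ffunE. Qed.

Lemma rpp u v z : rp u (rp v z) = if u == v then rp v z else 0.
Proof.
apply: rval_eq => w; rewrite !rpE; case: (eqVneq u v) => [->|uv].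
  by rewrite rpE; case: eqP.
rewrite rval0; case: (eqVneq w u) => // ->; by rewrite (negPf uv).
Qed.

Lemma rval_sum I (r : seq I) (P : pred I) (F : I -> M') v :
  subval (\sum_(i <- r | P i) F i) v = \sum_(i <- r | P i) subval (F i) v.
Proof. by rewrite linear_sum sum_ffunE. Qed.

Lemma rp_sum z : \sum_v rp v z = z.
Proof.
apply: rval_eq => w; rewrite rval_sum (bigD1 w) //= [X in X + _]ffunE eqxx.
by rewrite big1 ?addr0 // => v vw; rewrite ffunE eq_sym (negPf vw).
Qed.

Lemma rpf u v w z : rp w (rf u v z) = if w == v then rf u v z else 0.
Proof.
apply: rval_eq => x; rewrite rpE rfE; case: (eqVneq w v) => [->|uv].
  by rewrite rfE; case: eqP.
rewrite rval0; case: (eqVneq x w) => // ->; by rewrite (negPf uv).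
Qed.

Lemma rfp u v w z : rf u v (rp w z) = if w == u then rf u v z else 0.
Proof.
apply: rval_eq => x; rewrite rfE rpE [u == w]eq_sym.
case: (eqVneq w u) => [_|uv]; first by rewrite rfE.
by rewrite rval0 !linear0; do 2?case: ifP.
Qed.

Definition reflection : trep := TRep ra rpp rp_sum rpf rfp.

Definition reflection_map_fun (z : reflection) : M := \sum_(v | v \notin S) subval z v.
Lemma reflection_map_linear : linear reflection_map_fun.
Proof.
move=> c x y; rewrite /reflection_map_fun scaler_sumr -big_split; apply: eq_bigr => v _ /=.
by rewrite !ffunE.
Qed.
Definition reflection_map : {linear reflection -> M} := mklin reflection_map_linear.

Lemma tp_reflection_map v z :
  tp v (reflection_map z) = if v \in S then 0 else subval z v.
Proof.
have off w : w \notin S -> tp v (subval z w) = if v == w then subval z w else 0.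
  by move=> wS; rewrite -[in LHS]rval_off // tpp rval_off.
rewrite linear_sum; case: ifPn => vS.
  by rewrite big1 // => w wS; rewrite off //; case: eqP => // vw; rewrite -vw vS in wS.
rewrite (bigD1 v) //= off // eqxx big1 ?addr0 // => w /andP[wS wv].
by rewrite off // eq_sym (negPf wv).
Qed.

Lemma reflection_mapE z : reflection_map z = \sum_(v | v \notin S) subval z v.
Proof. by []. Qed.

Lemma reflection_map_one v (z : M') : (forall w, w != v -> subval z w = 0) ->
  reflection_map z = if v \in S then 0 else subval z v.
Proof.
move=> zv; rewrite reflection_mapE; case: ifPn => vS.
  by rewrite big1 // => w wS; apply: zv; apply: contraNneq wS => ->.
by rewrite (bigD1 v) //= big1 ?addr0 // => w /andP[_ /zv].
Qed.

Lemma tf_sink u v (x : M) : u \in S -> tf u v x = 0.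
Proof. by move=> uS; rewrite gM.2 ?sinkS. Qed.

Lemma reflection_good : good rho H (flip S e) reflection.
Proof.
split; last first.
  move=> u v z nuv; apply: rval_eq => w; rewrite rval0 [LHS]rfE.
  case: ifP => // /andP[_ vS]; move: nuv; rewrite /flip /= (negPf vS).
  have [uS|uS] /= := boolP (u \in S) => nuv; last by rewrite gM.2.
  by rewrite rval_on.
split.
- move=> s Hs c x y; apply: rval_eq => v; rewrite [LHS]raE // !ffunE !raE //.
  by rewrite (gal_lin gM.1).
- move=> s t Hs Ht z; have Hst := subM subH Hs Ht; apply: rval_eq => v.
  by rewrite !raE // (gal_mulE gM.1) // invgM actvM.
- move=> z; apply: rval_eq => v; rewrite [LHS]raE; last exact: (sub1 subH).
  rewrite invg1 actv1.
  exact: (gal_oneE gM.1).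
- move=> s Hs v z; apply: rval_eq => w; rewrite raE // !rpE raE //.
  by rewrite (can2_eq (avVK rho s) (avK rho s)); case: ifP => // _; rewrite (ta0 gM.1).
- move=> s Hs u v z; apply: rval_eq => w; rewrite raE // !rfE !raE // avK !stabS.
  rewrite (can2_eq (avVK rho s) (avK rho s)); case: ifP => _; last by rewrite (ta0 gM.1).
  by case: ifP => _; rewrite ?(gal_tp gM.1) ?(gal_tf gM.1).
Qed.

Lemma rval_small (z : {ffun V -> M}) : (forall v, v \notin S -> tp v (z v) = z v) ->
  (forall v, v \in S -> z v = 0) -> rpred z.
Proof.
move=> z1 z2 v; case: ifPn => vS; last exact: z1.
by rewrite z2 //; split=> [u _|]; rewrite ?big1 // => *; rewrite linear0.
Qed.

Lemma reflection_is_refl : is_refl H e S reflection_map.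
Proof.
split.
- move=> v z; rewrite (@reflection_map_one v) => [|w wv]; last by rewrite rpE (negPf wv).
  by rewrite rpE eqxx tp_reflection_map; case: ifP.
- move=> u v z uS vS; rewrite (@reflection_map_one v) => [|w wv]; last first.
    by rewrite rfE (negPf wv).
  rewrite (negPf vS) rfE eqxx vS (negPf uS) /= -[RHS]tf_tp tp_reflection_map (negPf uS).
  by [].
- move=> s Hs z; rewrite !reflection_mapE (ta_sum gM.1) // (reindex _ (onW_bij _ (av_bij rho s))) /=.
  by apply: eq_big => [v|v _]; rewrite ?stabS // [LHS]raE // avK.
- move=> v z vS; rewrite (@reflection_map_one v) => [|w wv]; last by rewrite rpE (negPf wv).
  rewrite (negPf vS) rpE eqxx => zv; apply: rval_eq => w; rewrite rpE rval0.
  by case: eqP => // ->.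
- move=> y; have yP : rpred [ffun w => if w \in S then 0 else tp w y].
    by apply: rval_small => v vS; rewrite !ffunE ?(negPf vS) ?vS ?tp_idem.
  exists (Subspace rpred_submod yP); apply: eq_bigr => w /negPf wS.
  by rewrite /= ffunE wS.
- move=> v z vS; rewrite -[RHS](rval_ker z vS); apply: eq_bigr => u _.
  have [uS|uS] := boolP (u \in S); first by rewrite !tf_sink.
  rewrite (@reflection_map_one u) => [|w wv]; last by rewrite rfE (negPf wv).
  by rewrite (negPf uS) rfE eqxx uS vS /= tf_tp.
- move=> v z vS z0; apply: rval_eq => w; rewrite rpE rval0; case: eqP => // ->.
  apply: tp_ext => u; rewrite linear0; have [uS|uS] := boolP (u \in S).
    by rewrite rval_on // sinkS.
  have := congr1 (fun x : M' => subval x u) (z0 u uS).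
  by rewrite /= !ffunE eqxx uS vS.
- exact: epiM.
- move=> v z vS z0.
  have zP : rpred [ffun w => if w == v then \sum_(u | e u v) tp u z else 0].
    move=> w; rewrite ffunE; case: (eqVneq w v) => [->|wv]; last first.
      by case: ifP => _; rewrite ?linear0 //; split=> [x _|]; rewrite ?big1 // => *; rewrite linear0.
    rewrite vS; split=> [u nuv|]; first by rewrite tp_partial (negPf nuv).
    rewrite -[RHS]z0; apply: eq_bigr => u _; have [uv|nuv] := boolP (e u v).
      by rewrite -tf_tp tp_partial uv tf_tp.
    by rewrite !gM.2.
  exists (Subspace rpred_submod zP) => u uv; have uS : u \notin S by apply: contraL uv => /sinkS.
  rewrite (@reflection_map_one u) => [|w wv]; last by rewrite rfE (negPf wv).
  by rewrite (negPf uS) rfE eqxx uS vS /= ffunE eqxx tp_partial uv.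
Qed.

End Construction.
End ReflectionFunctor.

(** * Dimension vectors *)

Section Dimension.
Variable L : fieldType.
Implicit Types (U W : lmodType L).

Lemma has_dim_ext U (P Q : U -> Prop) n : (forall x, P x <-> Q x) -> has_dim P n -> has_dim Q n.
Proof. by move=> PQ [f fI fP]; exists f => // x; rewrite -PQ. Qed.

Lemma has_dim0 U (P : U -> Prop) : has_dim P 0 -> forall x, P x -> x = 0.
Proof. by move=> [f _ fP] x /fP[y ->]; rewrite (thinmx0 y) linear0. Qed.

Lemma zero_has_dim U (P : U -> Prop) : (forall x, P x <-> x = 0) -> has_dim P 0.
Proof.
move=> P0; have lin0 : linear (fun _ : 'rV[L]_0 => 0 : U) by move=> c x y; rewrite scaler0 addr0.
exists (mklin lin0) => [x y _|x]; first by rewrite (thinmx0 x) (thinmx0 y).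
by rewrite P0; split=> [->|[y ->]] //; exists 0.
Qed.

Lemma has_dim_unique U (P : U -> Prop) n m : has_dim P n -> has_dim P m -> n = m.
Proof.
suff le_dim k l : has_dim P k -> has_dim P l -> (k <= l)%N.
  by move=> Pn Pm; apply/eqP; rewrite eqn_leq !le_dim.
move=> [f fI fP] [g gI gP].
have [|y|z|h hP] := @linear_of_rel L 'rV[L]_k 'rV[L]_l (fun y z => f y = g z).
- by move=> c x y x' y' xx' yy'; rewrite !linearP xx' yy'.
- have /fP/gP[z yz] : exists x, f y = f x by exists y.
  by exists z.
- by rewrite linear0 => /esym z0; apply: gI; rewrite z0 linear0.
have free : row_free (lin1_mx h).
  apply/row_freeP; apply/row_freeP/inj_row_free => v; rewrite mul_rV_lin1 => v0.
  by apply: fI; have := (hP v (h v)).2 erefl; rewrite v0 !linear0.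
by rewrite -(eqP free) rank_leq_col.
Qed.

Lemma has_dim_preim U W (f : {linear U -> W}) (P : U -> Prop) (Q : W -> Prop) n :
  submod_pred P -> (forall x, P x -> f x = 0 -> x = 0) -> (forall x, P x -> Q (f x)) ->
  (forall y, Q y -> exists2 x, P x & y = f x) -> has_dim Q n -> has_dim P n.
Proof.
move=> sP fI fPQ fS [b bI bP].
have [|y|x [Px]|g gP] := @linear_of_rel L 'rV[L]_n U (fun y x => P x /\ f x = b y).
- move=> c x y x' y' [Px xx'] [Py yy']; rewrite !linearP xx' yy'; split=> //.
  by apply: (submodD sP) => //; apply: (submodZ sP).
- have /bP/fS[x Px bx] : exists z, b y = b z by exists y.
  by exists x.
- by rewrite linear0; apply: fI.
have gE y : P (g y) /\ f (g y) = b y by apply/gP.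
exists g => [y z yz|x]; first by apply: bI; rewrite -(gE y).2 -(gE z).2 yz.
split=> [Px|[y ->]]; last by case: (gE y).
by have [y fx] := (bP _).1 (fPQ x Px); exists y; apply/gP.
Qed.

Lemma has_dim_add U (P Q : U -> Prop) n m :
  (forall x, P x -> Q x -> x = 0) -> submod_pred P -> submod_pred Q ->
  has_dim P n -> has_dim Q m -> has_dim (fun x => exists y z, [/\ P y, Q z & x = y + z]) (n + m).
Proof.
move=> PQ0 sP sQ [f fI fP] [g gI gP].
have lin_h : linear (fun y : 'rV[L]_(n + m) => f (lsubmx y) + g (rsubmx y)).
  by move=> c x y; rewrite !linearP scalerDr addrACA.
exists (mklin lin_h) => [x y /= xy|x]; last first.
  split=> [[y [z [/fP[y' ->] /gP[z' ->] ->]]]|[y ->]].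
    by exists (row_mx y' z'); rewrite /= row_mxKl row_mxKr.
  by exists (f (lsubmx y)), (g (rsubmx y)); split=> //;
    [apply/fP; exists (lsubmx y) | apply/gP; exists (rsubmx y)].
have fg : f (lsubmx x) - f (lsubmx y) = g (rsubmx y) - g (rsubmx x).
  by apply/eqP; rewrite subr_eq addrAC eq_sym subr_eq xy addrC.
have fx : f (lsubmx x) - f (lsubmx y) = 0.
  apply: PQ0; first by rewrite -linearB; apply/fP; exists (lsubmx x - lsubmx y).
  by rewrite fg -linearB; apply/gP; exists (rsubmx y - rsubmx x).
rewrite -[x]hsubmxK -[y]hsubmxK; congr row_mx.
  by apply: fI; apply/eqP; rewrite -subr_eq0 fx.
by apply: gI; apply/eqP; rewrite eq_sym -subr_eq0 -fg fx.
Qed.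

(** Rank-nullity: in the given bases f becomes a matrix [A] of rank m, and [row_base (kermx A)] is a
    basis of its kernel. *)
Lemma has_dim_ker U W (f : {linear U -> W}) (P : U -> Prop) (Q : W -> Prop) n m :
  (forall x, P x -> Q (f x)) -> (forall y, Q y -> exists2 x, P x & y = f x) ->
  has_dim P n -> has_dim Q m ->
  exists2 k, (k + m)%N = n & has_dim (fun x => P x /\ f x = 0) k.
Proof.
move=> PQ fS [b bI bP] [c cI cP].
have Pb y : P (b y) by apply/bP; exists y.
have [|y|z|g gP] := @linear_of_rel L 'rV[L]_n 'rV[L]_m (fun y z => f (b y) = c z).
- by move=> k x y x' y' xx' yy'; rewrite !linearP xx' yy'.
- by have /cP[z yz] := PQ _ (Pb y); exists z.
- by rewrite !linear0 => /esym z0; apply: cI; rewrite z0 linear0.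
have gE y : f (b y) = c (g y) by apply/gP.
pose A := lin1_mx g; have AE y : y *m A = g y by rewrite mul_rV_lin1.
have rkA : \rank A = m.
  apply/eqP; rewrite -/(row_full A) -sub1mx; apply/row_subP => i; apply/submxP.
  have /fS[x /bP[y ->] xE] : Q (c (row i 1%:M)) by apply/cP; exists (row i 1%:M).
  by exists y; rewrite AE; apply: cI; rewrite -gE.
exists (\rank (kermx A)); first by rewrite mxrank_ker rkA subnK // -{1}rkA rank_leq_row.
have lin_h : linear (fun y : 'rV[L]_(\rank (kermx A)) => b (y *m row_base (kermx A))).
  by move=> k x y; rewrite mulmxDl -scalemxAl linearP.
have kerE y : f (b y) = 0 <-> exists z, y = z *m row_base (kermx A).
  rewrite gE -AE; split=> [y0|[z ->]].
    apply/submxP; rewrite eq_row_base; apply/sub_kermxP.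
    by apply: cI; rewrite y0 linear0.
  suff /sub_kermxP-> : (z *m row_base (kermx A) <= kermx A)%MS by rewrite linear0.
  by rewrite -(eq_row_base (kermx A)) submxMl.
exists (mklin lin_h) => [y z /= /bI|x].
  by apply: row_free_inj; apply: row_base_free.
split=> [[/bP[y ->] /kerE[z ->]]|[z ->]]; first by exists z.
by split; [apply: Pb | apply/kerE; exists z].
Qed.
End Dimension.

(** * Transfer of dimension, indecomposability and continuity along reflections *)

Section Transfer.
Variables (K L : fieldType) (iota : {rmorphism K -> L}) (Gamma : quiver).
Variable rho : rational_structure iota Gamma.
Local Notation V := (vert Gamma).
Local Notation G := (Gal iota).
Local Notation av := (actv rho).
Local Notation trep := (trep iota Gamma).
Implicit Types (M N : trep) (a : {ffun V -> int}).

Definition tdim M a : Prop :=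
  forall v, exists n : nat, a v = n%:Z /\ has_dim (fun x : M => tp v x = x) n.

Lemma tdim_iso H M N a : tiso H M N -> tdim M a -> tdim N a.
Proof.
move=> [f [g [hf hg fg gf]]] dM v; have [n [av_n dn]] := dM v; exists n; split=> //.
apply: (has_dim_preim (f := g) _ _ _ _ dn).
- by split=> [|x y xv yv|c x xv]; rewrite ?linear0 // ?linearD ?linearZ /= ?xv ?yv.
- by move=> x _ gx; rewrite -[x]gf gx linear0.
- by move=> x xv; rewrite -(hom_p hg) xv.
- by move=> y yv; exists (f y); rewrite ?fg // -(hom_p hf) yv.
Qed.

Lemma tdim_unique M a b : tdim M a -> tdim M b -> a = b.
Proof.
move=> da db; apply/ffunP => v; have [n [-> dn]] := da v; have [m [-> dm]] := db v.
by rewrite (has_dim_unique dn dm).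
Qed.

Lemma tdim_supp M a v (x : M) : tdim M a -> a v = 0 -> tp v x = 0.
Proof.
move=> dM av0; have [n [av_n dn]] := dM v; rewrite av0 in av_n; case: av_n => n0.
by rewrite -n0 in dn; apply: (has_dim0 dn); rewrite tp_idem.
Qed.

Lemma tdim_vanish M a v : tdim M a -> (forall x : M, tp v x = 0) -> a v = 0.
Proof.
move=> dM v0; have [n [-> dn]] := dM v; congr Posz.
apply: has_dim_unique dn _; apply: zero_has_dim => x; split=> [<-|->]; last exact: linear0.
exact: v0.
Qed.

Lemma supp_submod M (A : {set V}) : submod_pred (fun x : M => forall u, u \notin A -> tp u x = 0).
Proof.
split=> [u _|x y xA yA u uA|c x xA u uA]; first exact: linear0.
  by rewrite linearD xA // yA // addr0.
by rewrite linearZ /= xA // scaler0.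
Qed.

Lemma at_submod M v : submod_pred (fun x : M => tp v x = x).
Proof. by split=> [|x y xv yv|c x xv]; rewrite ?linear0 // ?linearD ?linearZ /= ?xv ?yv. Qed.

Lemma tdim_partial M a (A : {set V}) : tdim M a ->
  exists2 n : nat, n%:Z = \sum_(u in A) a u &
    has_dim (fun x : M => forall u, u \notin A -> tp u x = 0) n.
Proof.
move=> dM; have [k] := ubnP #|A|; elim: k A => // k IHk A leA.
have [->|[v vA]] := set_0Vmem A.
  exists 0%N; first by rewrite big_set0.
  apply: zero_has_dim => x; split=> [x0|-> u _]; last exact: linear0.
  by apply: tp_ext => u; rewrite linear0 x0 // inE.
have [|n nE dn] := IHk (A :\ v); first by move: leA; rewrite (cardsD1 v) vA ltnS.
have [m [mE dm]] := dM v.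
exists (n + m)%N; first by rewrite PoszD nE -mE [RHS](big_setD1 v) //= addrC.
apply: has_dim_ext (has_dim_add _ (supp_submod _ (A :\ v)) (at_submod _ v) dn dm).
  move=> x; split=> [[y [z [yA zv ->]]] u uA|xA].
    rewrite linearD yA ?inE ?(negPf uA) ?andbF // -zv tpp add0r.
    by case: eqP => // uv; rewrite uv vA in uA.
  exists (x - tp v x), (tp v x); split; rewrite ?tp_idem ?subrK // => u uA.
  rewrite linearB tpp; have [->|uv] := eqVneq u v; first by rewrite subrr.
  by rewrite subr0 xA //; move: uA; rewrite !inE uv.
by move=> x xA <-; apply: xA; rewrite !inE eqxx.
Qed.

Section Refl.
Variables (H : G -> Prop) (e : rel V) (S : {set V}).
Hypothesis sinkS : forall u v, u \in S -> ~~ e u v.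
Hypothesis stabS : forall s v, (av s v \in S) = (v \in S).
Variables (M M' : trep) (theta : {linear M' -> M}).
Hypotheses (gM : good rho H e M) (rM : is_refl H e S theta).

(** At a sink v the new space is the kernel of a surjection from the sum of all neighbouring spaces
    onto the old one, so the dimensions subtract. *)
Lemma refl_tdim a : orientation e -> oriented (flip S e) M' -> tdim M a -> tdim M' (srefl S a).
Proof.
move=> eP oM' dM v; have [d [dE dimd]] := dM v; rewrite ffunE; case: ifPn => vS; last first.
  exists d; split=> //; apply: (has_dim_preim (f := theta) (at_submod _ v) _ _ _ dimd).
  - by move=> x xv x0; rewrite -xv; apply: (refl_inj rM vS); rewrite xv.
  - by move=> x xv; rewrite -(refl_tp rM) // xv.
  - move=> y yv; have [x xE] := refl_surj rM y; exists (tp v x); first exact: tp_idem.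
    by rewrite (refl_tp rM) // xE tp_partial vS yv.
pose A := [set u | e u v]; have [n nE dimn] := tdim_partial A dM.
have AS u : u \in A -> u \notin S by rewrite inE; apply: contraL => /sinkS.
have lin_F : linear (fun x : M => \sum_u tf u v x).
  move=> c x y; rewrite scaler_sumr -big_split; apply: eq_bigr => u _; exact: linearP.
have tfA u x : u \notin A -> tf u v x = 0 :> M by rewrite inE; apply: gM.2.
have [|y yv|k kE dimk] := @has_dim_ker _ _ _ (mklin lin_F) _ _ _ _ _ _ dimn dimd.
- by move=> x _ /=; rewrite linear_sum; apply: eq_bigr => u _; rewrite tp_tf.
- have [z zE] := refl_epi rM y vS; exists (\sum_(u in A) tp u z).
    by move=> u uA; rewrite tp_partial (negPf uA).
  rewrite /= -yv zE; apply: eq_bigr => u _; have [uA|/tfA uA] := boolP (u \in A).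
    by rewrite -tf_tp -[RHS]tf_tp tp_partial uA.
  by rewrite !uA.
exists k; split.
  have -> : a v - kk a v = n%:Z - d%:Z.
    have -> : n%:Z = \sum_u (nedges v u)%:Z * a u.
      rewrite nE big_mkcond; apply: eq_bigr => u _.
      by rewrite inE (eP v u) (negPf (sinkS _ vS)); case: (e u v); rewrite ?mul1r ?mul0r.
    by rewrite /kk dE; move: (\sum_u _) => x; lia.
  by rewrite -kE; lia.
(* For v in S the space of M' at v is identified with this kernel by adding up the images along its
   outgoing arrows. *)
have lin_g : linear (fun x : M' => \sum_(u in A) theta (tf v u x)).
  by move=> c x y; rewrite scaler_sumr -big_split; apply: eq_bigr => u _; rewrite !linearP.
have tp_g w x : tp w (\sum_(u in A) theta (tf v u x)) = if w \in A then theta (tf v w x) else 0.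
  have tpE u : u \in A -> theta (tf v u x) = tp u (theta (tf v u x)).
    by move=> /AS uS; rewrite -(refl_tp rM) // tpf eqxx.
  rewrite (eq_bigr _ tpE) linear_sum; case: ifPn => wA.
    rewrite (bigD1 w) //= tp_idem -tpE // big1 ?addr0 // => u /andP[_ uw].
    by rewrite tpp eq_sym (negPf uw).
  by rewrite big1 // => u uA; rewrite tpp; case: eqP => // wu; rewrite wu uA in wA.
apply: (has_dim_preim (f := mklin lin_g) (at_submod _ v) _ _ _ dimk) => /=.
- move=> x xv gx; rewrite -xv; apply: (refl_mono rM vS) => u uS.
  have [uA|uA] := boolP (u \in A); last by apply: oM'; rewrite /flip /= vS (negPf uS) inE in uA *.
  rewrite -tp_tf; apply: (refl_inj rM uS); rewrite tp_tf.
  by have := tp_g u x; rewrite uA gx linear0.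
- move=> x xv; split=> [u uA|]; first by rewrite tp_g (negPf uA).
  rewrite -[RHS](refl_complex rM x vS); apply: eq_bigr => u _.
  have [uA|/tfA uA] := boolP (u \in A); last by rewrite !uA.
  by rewrite -tf_tp tp_g uA.
- move=> z [zA z0]; have [x xE] := refl_exact rM vS z0.
  exists (tp v x); first exact: tp_idem.
  apply: tp_ext => u; rewrite tp_g; case: ifPn => uA; last by rewrite zA.
  by rewrite tf_tp xE ?tp_idem //; rewrite inE in uA.
Qed.

Lemma refl_neq0 : (exists x : M, x <> 0) -> exists x : M', x <> 0.
Proof.
move=> [y y0]; apply: contrapT => nx; apply: y0.
have x0 (x : M') : x = 0 by apply: contrapT => ?; apply: nx; exists x.
have [x1 [x2 ->]] := mix_total sinkS gM rM y.
rewrite (x0 x1) (_ : x2 = fun=> 0); last by apply/funext => v; apply: x0.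
by rewrite mix0r linear0.
Qed.

Hypothesis gM' : good rho H (flip S e) M'.

(** An idempotent of M' transfers back to an idempotent of M, by uniqueness of the transfer; there
    it is 0 or 1, and the transfer is faithful. *)
Lemma refl_tindec : tindec H M -> tindec H M'.
Proof.
move=> [M0 ind]; split; first exact: refl_neq0.
move=> f hf ff; have [g hg gE] := hom_back sinkS (fun s v _ => stabS s v) gM rM gM rM hf.
have hgg : hom H (g \o g : {linear M -> M}) by apply: hom_comp.
have gg x : g (g x) = g x.
  by apply: (hom_back_uniq sinkS gM rM hgg hg) => y; rewrite /= !gE ff.
have [g0|g1] := ind g hg gg; [left | right] => x.
  rewrite -[RHS]/((\0 : {linear M' -> M'}) x).
  apply: (hom_back_faithful rM hg hf (hom0 M' gM'.1)) => // y; by rewrite g0 linear0.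
rewrite -[RHS]/((idfun : {linear M' -> M'}) x).
by apply: (hom_back_faithful rM hg hf (hom_id _ _)) => // y; rewrite g1.
Qed.
(** At a vertex of S a vector is determined by its finitely many images along the outgoing arrows;
    these lie off S, where [theta] reduces continuity to that of M. *)
Lemma refl_tcont : tcont H M -> tcont H M'.
Proof.
move=> cM x; have [galM' _] := gM'.
have [xs xsP] := cM (theta x).
have [|ys ysP] := @finite_nbhs _ _ iota Gamma H (fun v s => forall u,
    ta s (theta (tf v u x)) = theta (tf v u x)).
  move=> v; have [|ys ysP] := @finite_nbhs _ _ iota Gamma H
    (fun u s => ta s (theta (tf v u x)) = theta (tf v u x)); first by move=> u; apply: cM.
  by exists ys.
have [zs zsP] := actv_nbhs rho.
exists (xs ++ ys ++ zs) => s Hs sP.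
have [sxs /fixes_cat[sys szs]] := fixes_cat sP.
have eq_off v y : v \notin S -> ta s (theta y) = theta y -> tp v (ta s y) = tp v y.
  by move=> vS sy; apply: (refl_inj_sub rM) => //; rewrite !(refl_tp rM) // (refl_a rM) // sy.
apply: tp_ext => v; have [vS|vS] := boolP (v \in S); last exact/eq_off/xsP.
apply/eqP; rewrite -subr_eq0 -linearB; apply/eqP/(refl_mono rM) => // u uS.
have tfE y : tf v u y = tp u (tf v u y) :> M' by rewrite tpf eqxx.
rewrite linearB [X in X - _](_ : _ = tf v u x) ?subrr //.
have -> : tf v u (ta s x) = ta s (tf v u x).
  by rewrite (gal_tf galM') // !(zsP s szs).
have yE : tp u (ta s (tf v u x)) = ta s (tf v u x).
  by rewrite -{1}(zsP s szs u) -(gal_tp galM') // -tfE.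
by rewrite -yE eq_off // -?tfE //; apply: ysP.
Qed.
End Refl.

(** * Sequences of reflections *)

Section Chain.
Variables (es : nat -> rel V) (Ss : nat -> {set V}).
Hypothesis esP : forall t, orientation (es t).
Hypothesis flipE : forall t, es t.+1 =2 flip (Ss t) (es t).
Hypothesis sinkS : forall t u v, u \in Ss t -> ~~ es t u v.
Hypothesis stabS : forall t s v, (av s v \in Ss t) = (v \in Ss t).

Lemma oriented_flip t M : oriented (es t.+1) M <-> oriented (flip (Ss t) (es t)) M.
Proof. by split=> oM u v x uv; apply: oM; move: uv; rewrite flipE. Qed.

Definition link H t M M' : Prop :=
  [/\ good rho H (es t) M, good rho H (es t.+1) M' &
    exists theta : {linear M' -> M}, is_refl H (es t) (Ss t) theta].

Fixpoint chain H n t M N : Prop :=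
  if n is n'.+1 then exists2 M', link H t M M' & chain H n' t.+1 M' N else M = N.

Lemma chain_cat H n m t M N (P : trep) :
  chain H n t M N -> chain H m (t + n) N P -> chain H (n + m) t M P.
Proof.
elim: n t M => [|n IHn] t M /=; first by move->; rewrite addn0.
by move=> [M' lM cM] cN; exists M' => //; apply: IHn cM _; rewrite addSnnS.
Qed.

Lemma chain_split H n m t M (P : trep) : chain H (n + m) t M P ->
  exists2 N, chain H n t M N & chain H m (t + n) N P.
Proof.
elim: n t M => [|n IHn] t M /=; first by move=> cM; exists M; rewrite ?addn0.
move=> [M' lM /IHn[N cM' cN]]; exists N; last by rewrite addnS -addSn.
by exists M'.
Qed.

Lemma link_sub H H' t M M' : (forall s, H s -> H' s) -> link H' t M M' -> link H t M M'.
Proof.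
move=> HH' [gM gM' [theta [r1 r2 r3 r4 r5 r6 r7 r8 r9]]]; split; try exact: good_sub HH' _.
by exists theta; split=> // s /HH'; apply: r3.
Qed.

Lemma chain_sub H H' n t M N : (forall s, H s -> H' s) -> chain H' n t M N -> chain H n t M N.
Proof.
move=> HH'; elim: n t M => //= n IHn t M [M' lM cM']; exists M'; last exact: IHn.
exact: link_sub lM.
Qed.

Lemma link_tindec H t M M' : link H t M M' -> tindec H M -> tindec H M'.
Proof.
move=> [gM [gM' oM'] [theta rM]]; apply: (refl_tindec (@sinkS t) (@stabS t) gM rM).
by split=> //; apply/oriented_flip.
Qed.

Lemma link_tcont H t M M' : link H t M M' -> tcont H M -> tcont H M'.
Proof.
move=> [gM [gM' oM'] [theta rM]] cM; apply: (refl_tcont rM) => //.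
by split=> //; apply/oriented_flip.
Qed.

Lemma link_tdim H t M M' a : link H t M M' -> tdim M a -> tdim M' (srefl (Ss t) a).
Proof.
move=> [gM [gM' oM'] [theta rM]]; apply: (refl_tdim (@sinkS t) gM rM) => //.
exact/oriented_flip.
Qed.

(** A hom of reflections goes back one step in time, and faithfulness keeps a nonzero hom
    nonzero. *)
Lemma link_hom H t M M' N N' (f' : {linear M' -> N'}) : link H t M M' -> link H t N N' ->
  hom H f' -> exists (f : {linear M -> N}), hom H f /\ ((forall x, f x = 0) -> forall x, f' x = 0).
Proof.
move=> [gM gM' [theta rM]] [gN gN' [eta rN]] hf'.
have stab s v : H s -> (av s v \in Ss t) = (v \in Ss t) by [].
have [f hf fE] := hom_back (@sinkS t) stab gM rM gN rN hf'.
exists f; split=> // f0 x.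
rewrite -[RHS]/((\0 : {linear M' -> N'}) x).
by apply: (hom_back_faithful rN hf hf' (hom0 M' gN'.1)) => // y; rewrite f0 linear0.
Qed.

Lemma chain_hom H n t M M' N N' (f' : {linear M' -> N'}) : chain H n t M M' -> chain H n t N N' ->
  hom H f' -> exists (f : {linear M -> N}), hom H f /\ ((forall x, f x = 0) -> forall x, f' x = 0).
Proof.
elim: n t M N => [|n IHn] t M N /=.
  by move=> eM eN; subst M' N' => hf'; exists f'.
move=> [M1 lM cM] [N1 lN cN] /(IHn _ _ _ cM cN)[f1 [hf1 f1E]].
have [f [hf fE]] := link_hom lM lN hf1; exists f; split=> // f0.
exact/f1E/fE.
Qed.

(** The transfers of inverse isomorphisms compose to the identity, because a hom on M is determined
    by its composite with [theta]. *)
Lemma link_tiso H t M M' N N' : link H t M M' -> link H t N N' -> tiso H M' N' -> tiso H M N.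
Proof.
move=> [gM gM' [theta rM]] [gN gN' [eta rN]] [f' [g' [hf' hg' fg' gf']]].
have stab s v : H s -> (av s v \in Ss t) = (v \in Ss t) by [].
have [f hf fE] := hom_back (@sinkS t) stab gM rM gN rN hf'.
have [g hg gE] := hom_back (@sinkS t) stab gN rN gM rM hg'.
exists f, g; split=> // x.
- rewrite -[LHS]/((g \o f : {linear M -> M}) x) -[RHS]/((idfun : {linear M -> M}) x).
  apply: (hom_back_uniq (@sinkS t) gM rM (hom_comp hf hg) (hom_id _ _)) => y /=.
  by rewrite fE gE fg'.
- rewrite -[LHS]/((f \o g : {linear N -> N}) x) -[RHS]/((idfun : {linear N -> N}) x).
  apply: (hom_back_uniq (@sinkS t) gN rN (hom_comp hg hf) (hom_id _ _)) => y /=.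
  by rewrite gE fE gf'.
Qed.

Lemma chain_tiso H n t M M' N N' : chain H n t M M' -> chain H n t N N' ->
  tiso H M' N' -> tiso H M N.
Proof.
elim: n t M N => [|n IHn] t M N /=; first by move=> -> ->.
by move=> [M1 lM cM] [N1 lN cN] /(IHn _ _ _ cM cN); apply: link_tiso lM lN.
Qed.

Lemma chain_good H n t M N : chain H n t M N -> good rho H (es t) M -> good rho H (es (t + n)) N.
Proof.
elim: n t M => [|n IHn] t M /=; first by move=> ->; rewrite addn0.
by move=> [M' [_ gM' _] cM'] _; rewrite addnS -addSn; apply: IHn cM' _.
Qed.

Lemma chain_tindec H n t M N : chain H n t M N -> tindec H M -> tindec H N.
Proof.
elim: n t M => [|n IHn] t M /=; first by move->.
by move=> [M' lM /IHn cN] /(link_tindec lM).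
Qed.

End Chain.
End Transfer.

(** * Indecomposables at a set of sinks *)

Section Splitting.
Variables (K L : fieldType) (iota : {rmorphism K -> L}) (Gamma : quiver).
Variable rho : rational_structure iota Gamma.
Hypothesis algL : algebraic_extension iota.
Local Notation V := (vert Gamma).
Local Notation G := (Gal iota).
Local Notation av := (actv rho).
Local Notation trep := (trep iota Gamma).
Implicit Types (M N : trep).

Section Complement.
Variables (H : G -> Prop) (M : trep).
Hypotheses (subH : subgroup H) (gM : galois rho H M) (cM : tcont H M).

Lemma invariant_outside (P : M -> Prop) x : submod_pred P -> ~ P x ->
  exists2 t, (forall s, H s -> ta s t = t) & ~ P t.
Proof.
move=> sP nPx; apply: contrapT => nt; apply: nPx.
apply: (span_invariants algL subH (gal_lin gM) (gal_mulE gM) sP (cM x)) => y yH.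
by apply: contrapT => nPy; apply: nt; exists y.
Qed.

(** Stability under the maps [tf] is left out on purpose: with the vertices and the Galois action
    alone, every stable subspace has a stable complement. *)
Record stable (U : M -> Prop) : Prop := Stable {
  stable_sub : submod_pred U;
  stable_tp : forall v x, U x -> U (tp v x);
  stable_ta : forall s x, H s -> U x -> U (ta s x) }.

Lemma stable_add U W : stable U -> stable W ->
  stable (fun x => exists y z, [/\ U y, W z & x = y + z]).
Proof.
move=> sU sW; have [U1 U2 U3] := sU; have [W1 W2 W3] := sW; split; first split.
- by exists 0, 0; split; rewrite ?addr0 //; apply: submod0.
- move=> _ _ [y [z [Uy Wz ->]]] [y' [z' [Uy' Wz' ->]]].
  by exists (y + y'), (z + z'); split; rewrite 1?addrACA //; apply: submodD.
- move=> c _ [y [z [Uy Wz ->]]]; exists (c *: y), (c *: z).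
  by split; rewrite ?scalerDr //; apply: submodZ.
- move=> v _ [y [z [Uy Wz ->]]]; exists (tp v y), (tp v z).
  by split; rewrite ?linearD //; [apply: U2 | apply: W2].
- move=> s _ Hs [y [z [Uy Wz ->]]]; exists (ta s y), (ta s z).
  by split; rewrite ?(taD gM) //; [apply: U3 | apply: W3].
Qed.

Definition vorb v : {set V} := [set w | `[< exists2 s, H s & w = av s v >]].

Lemma orb_refl v : v \in vorb v.
Proof. by rewrite inE; apply/asboolP; exists 1%g; [apply: sub1 | rewrite actv1]. Qed.

Lemma orb_av s v w : H s -> (av s w \in vorb v) = (w \in vorb v).
Proof.
move=> Hs; rewrite !inE; apply/asboolP/asboolP => -[t Ht].
  move=> wE; exists (s^-1 * t)%g; first by apply: subM => //; apply: subV.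
  by rewrite actvM -wE avK.
by move=> ->; exists (s * t)%g; [apply: subM | rewrite actvM].
Qed.

Section OrbitSpan.
Variables (v : V) (t : M).
Hypothesis tH : forall s, H s -> ta s t = t.

Definition orbit_span (x : M) : Prop :=
  exists k : V -> L, x = \sum_(w in vorb v) k w *: tp w t.

Lemma tp_orbit_span (k : V -> L) w :
  tp w (\sum_(u in vorb v) k u *: tp u t) = if w \in vorb v then k w *: tp w t else 0.
Proof.
rewrite linear_sum; case: ifPn => wO.
  rewrite (bigD1 w) //= linearZ /= tp_idem big1 ?addr0 // => u /andP[_ uw].
  by rewrite linearZ /= tpp eq_sym (negPf uw) scaler0.
rewrite big1 // => u uO; rewrite linearZ /= tpp; case: eqP => [wu|_]; last by rewrite scaler0.
by rewrite wu uO in wO.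
Qed.

Lemma ta_orbit_span s (k : V -> L) : H s ->
  ta s (\sum_(u in vorb v) k u *: tp u t) =
  \sum_(u in vorb v) s (k (av s^-1%g u)) *: tp u t.
Proof.
move=> Hs; rewrite (ta_sum gM) // [RHS](reindex _ (onW_bij _ (av_bij rho s))) /=.
apply: eq_big => [w|w _]; first by rewrite orb_av.
by rewrite (taZ gM) // (gal_tp gM) // tH // avK.
Qed.

Lemma orbit_span_tp w : w \in vorb v -> orbit_span (tp w t).
Proof.
move=> wO; exists (fun u => if u == w then 1 else 0).
rewrite (bigD1 w) //= eqxx scale1r big1 ?addr0 // => u /andP[_ /negPf->].
by rewrite scale0r.
Qed.

Lemma orbit_span_stable : stable orbit_span.
Proof.
split; first split.
- by exists (fun=> 0); rewrite big1 // => w _; rewrite scale0r.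
- move=> _ _ [k ->] [l ->]; exists (fun w => k w + l w); rewrite -big_split.
  by apply: eq_bigr => w _; rewrite scalerDl.
- move=> c _ [k ->]; exists (fun w => c * k w); rewrite scaler_sumr.
  by apply: eq_bigr => w _; rewrite scalerA.
- move=> w _ [k ->]; exists (fun u => if u == w then k u else 0).
  rewrite tp_orbit_span; case: ifPn => wO.
    rewrite (bigD1 w) //= eqxx big1 ?addr0 // => u /andP[_ /negPf->].
    by rewrite scale0r.
  rewrite big1 // => u uO; case: eqP => [uw|_]; last by rewrite scale0r.
  by rewrite -uw uO in wO.
- by move=> s _ Hs [k ->]; rewrite ta_orbit_span //; exists (fun u => s (k (av s^-1%g u))).
Qed.
End OrbitSpan.

(** Zorn's lemma gives a stable A maximal among those meeting U in 0. If U + A is not everything,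
    some invariant t has a component outside U + A at a vertex v; then so are all its conjugate
    components, and their span enlarges A. *)
Lemma complement U : stable U -> exists C, [/\ stable C,
  forall x, U x -> C x -> x = 0 & forall x, exists y z, [/\ U y, C z & x = y + z]].
Proof.
(* Zorn's lemma also considers the empty chain, whose union is empty; adjoining 0 makes it
   admissible. *)
move=> sU; pose zU (A : M -> Prop) x := A x \/ x = 0.
pose P A := stable (zU A) /\ forall x, U x -> zU A x -> x = 0.
have [F FP totF|A [[sA dA] maxA]] := @classical_sets.Zorn_bigcup M P.
  have in_or x : zU (classical_sets.bigcup F id) x -> exists2 A, F A \/ A = (fun=> False) & zU A x.
    case=> [[A FA Ax]|->]; first by exists A; [left|left].
    by exists (fun=> False); right.
  split; last first.
    move=> x Ux [[A FA Ax]|//]; by apply: (FP A FA).2 => //; left.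
  have lift A : F A -> forall x, zU A x -> zU (classical_sets.bigcup F id) x.
    by move=> FA x [Ax|->]; [left; exists A | right].
  have z0 : zU (classical_sets.bigcup F id) 0 by right.
  split; first split=> //.
  - move=> x y [[A FA Ax]|->]; last by rewrite add0r.
    move=> [[B FB By]|->]; last by rewrite addr0; left; exists A.
    have [AB|BA] := totF A B FA FB.
      apply: (lift B FB); apply: (submodD (stable_sub (FP B FB).1)).
        by left; apply: AB.
      by left.
    apply: (lift A FA); apply: (submodD (stable_sub (FP A FA).1)).
      by left.
    by left; apply: BA.
  - move=> c x [[A FA Ax]|->]; last by rewrite scaler0.
    by apply: (lift A FA); apply: (submodZ (stable_sub (FP A FA).1)); left.
  - move=> v x [[A FA Ax]|->]; last by rewrite linear0.
    by apply: (lift A FA); apply: (stable_tp (FP A FA).1); left.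
  - move=> s x Hs [[A FA Ax]|->]; last by rewrite (ta0 gM).
    by apply: (lift A FA); apply: (stable_ta (FP A FA).1) => //; left.
exists (zU A); split=> // x; apply: contrapT => nx.
have sUA := stable_add sU sA.
have [t tH nt] := invariant_outside (stable_sub sUA) nx.
have [v nv] : exists v, ~ exists y z, [/\ U y, zU A z & tp v t = y + z].
  apply: contrapT => nv; apply: nt; rewrite -[t]tp_sum.
  apply: (submod_sum (stable_sub sUA)) => v _.
  by apply: contrapT => ?; apply: nv; exists v.
have nw w : w \in vorb v -> ~ exists y z, [/\ U y, zU A z & tp w t = y + z].
  rewrite inE => /asboolP[s Hs ->] UA; apply: nv.
  have := stable_ta sUA (subV subH Hs) UA.
  by rewrite (gal_tp gM) ?tH ?avK //; apply: (subV subH).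
pose B := fun x => exists y z, [/\ zU A y, orbit_span v t z & x = y + z].
have sB : stable B by apply: stable_add => //; apply: orbit_span_stable.
have BE : zU B = B.
  apply/funext => y; apply/propext; split=> [[//|->]|By]; last by left.
  exact: submod0 (stable_sub sB).
apply: (maxA B); first split.
- move=> y Ay; exists y, 0; split; rewrite ?addr0 //; first by left.
  exact: submod0 (stable_sub (orbit_span_stable v tH)).
- move=> BA; apply: nv; exists 0, (tp v t); split; rewrite ?add0r //.
    exact: submod0 (stable_sub sU).
  left; apply: BA; exists 0, (tp v t); split; rewrite ?add0r //; first by right.
  exact/orbit_span_tp/orb_refl.
rewrite /P BE; split=> // x' Ux' [c [z [Ac [k zE] xE]]]; apply: (dA x') => //.
(* A nonzero coefficient [k w] would put the component of t at w into U + A, since [x'] is in U. *)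
suff z0 : z = 0 by rewrite xE z0 addr0.
rewrite zE big1 // => w wO; apply/eqP; rewrite scaler_eq0; apply: contraT.
rewrite negb_or => /andP[kw _]; case: (nw w wO).
exists ((k w)^-1 *: tp w x'), (- (k w)^-1 *: tp w c); split.
- by apply: (submodZ (stable_sub sU)); apply: (stable_tp sU).
- by apply: (submodZ (stable_sub sA)); apply: (stable_tp sA).
- by rewrite xE linearD scaleNr -scalerBr addrAC subrr add0r zE tp_orbit_span wO scalerK.
Qed.

Definition splits U C : Prop := [/\ stable U, stable C, forall x, U x -> C x -> x = 0 &
  forall x, exists y z, [/\ U y, C z & x = y + z]].

Lemma splits_hom U C : splits U C ->
  (forall u v x, U x -> U (tf u v x)) -> (forall u v x, C x -> C (tf u v x)) ->
  exists2 p : {linear M -> M}, hom H p & (forall x, U x -> p x = x) /\ (forall x, C x -> p x = 0)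
    /\ forall x, U (p x).
Proof.
move=> [sU sC UC0 UC] Uf Cf; have [U1 U2 U3] := sU; have [C1 C2 C3] := sC.
have [|x|y []|p pP] := @linear_of_rel L M M (fun x y => U y /\ C (x - y)).
- move=> c x y x' y' [Ux xx'] [Uy yy']; split; first by apply: (submodD U1) => //; apply: (submodZ U1).
  by rewrite opprD addrACA -scalerBr; apply: (submodD C1) => //; apply: (submodZ C1).
- by have [y [z [Uy Cz ->]]] := UC x; exists y; rewrite addrAC subrr add0r.
- by rewrite sub0r => Uy Cy; apply: UC0 => //; rewrite -[y]opprK; apply: submodN.
have pE x : U (p x) /\ C (x - p x) by apply/pP.
exists p; last first.
  split; first by move=> x Ux; apply/esym/pP; rewrite subrr; split=> //; apply: submod0.
  split; first by move=> x Cx; apply/esym/pP; rewrite subr0; split=> //; apply: submod0.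
  by move=> x; case: (pE x).
split=> [v x|u v x|s Hs x]; apply/esym/pP; have [Up Cp] := pE x.
- by rewrite -linearB; split; [apply: U2 | apply: C2].
- by rewrite -linearB; split; [apply: Uf | apply: Cf].
- by rewrite -(taB gM) //; split; [apply: U3 | apply: C3].
Qed.

Lemma tindec_splits U C : tindec H M -> splits U C ->
  (forall u v x, U x -> U (tf u v x)) -> (forall u v x, C x -> C (tf u v x)) ->
  (forall x, U x -> x = 0) \/ (forall x, C x -> x = 0).
Proof.
move=> [_ ind] sUC Uf Cf; have [p hp [pU [pC Up]]] := splits_hom sUC Uf Cf.
have [|p0|p1] := ind p hp; first by move=> x; apply/pU/Up.
  by left=> x Ux; rewrite -(pU x Ux).
by right=> x Cx; rewrite -(p1 x) pC.
Qed.

Variables (e : rel V) (S : {set V}).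
Hypothesis oM : oriented e M.
Hypothesis sinkS : forall u v, u \in S -> ~~ e u v.
Hypothesis stabS : forall s v, (av s v \in S) = (v \in S).

Definition supported : Prop := forall v, v \notin S -> forall x : M, tp v x = 0.

Lemma tf_from_sink u v (x : M) : u \in S -> tf u v x = 0.
Proof. by move=> uS; rewrite oM // sinkS. Qed.

(* M splits as U + C, where U is M off S and the image of the incoming maps at S;
   C is supported on S. *)
Lemma indecomposable_dichotomy : tindec H M ->
  supported \/ forall v (y : M), v \in S -> exists z : M, tp v y = \sum_u tf u v z.
Proof.
move=> indM.
pose U (x : M) := forall v, v \in S -> exists z : M, tp v x = \sum_u tf u v z.
have sU : stable U.
  split; first split.
  - by move=> v _; exists 0; rewrite linear0 big1 // => u _; rewrite linear0.
  - move=> x y Ux Uy v vS; have [x' xE] := Ux v vS; have [y' yE] := Uy v vS.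
    exists (x' + y'); rewrite linearD xE yE -big_split; apply: eq_bigr => u _.
    by rewrite linearD.
  - move=> c x Ux v vS; have [x' xE] := Ux v vS; exists (c *: x').
    by rewrite linearZ /= xE scaler_sumr; apply: eq_bigr => u _; rewrite linearZ.
  - move=> w x Ux v vS; rewrite tpp; case: eqP => [<-|_]; first exact: Ux.
    by exists 0; rewrite big1 // => u _; rewrite linear0.
  - move=> s x Hs Ux v vS; have [|z zE] := Ux (av s^-1%g v); first by rewrite stabS.
    exists (ta s z); rewrite -[in LHS](avVK rho s v) -(gal_tp gM) // zE (ta_sum gM) //.
    rewrite [RHS](reindex _ (onW_bij _ (av_bij rho s))) /=; apply: eq_bigr => u _.
    by rewrite (gal_tf gM) // avVK.
have U_off w x : w \notin S -> U (tp w x).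
  move=> wS v vS; exists 0; rewrite tpp; case: eqP => [vw|_]; first by rewrite -vw vS in wS.
  by rewrite big1 // => u _; rewrite linear0.
have [C [sC UC0 UC]] := complement sU.
have [|u v x _|u v x Cx|U0|C0] := @tindec_splits U C indM.
- by split.
- move=> w wS; rewrite tpf; case: eqP => [->|_]; last first.
    by exists 0; rewrite big1 // => u' _; rewrite linear0.
  exists (tp u x); rewrite (bigD1 u) //= tfp eqxx big1 ?addr0 // => u' uu'.
  by rewrite tfp eq_sym (negPf uu').
(* C has no components off S, since they would lie in U as well, and the maps out of S vanish. *)
- suff -> : tf u v x = 0 by apply: submod0 (stable_sub sC).
  have [uS|uS] := boolP (u \in S); first exact: tf_from_sink.
  by rewrite -tf_tp [tp u x]UC0 ?linear0 //; [apply: U_off | apply: stable_tp].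
- by left=> w wS x; apply: U0; apply: U_off.
- by right=> v y vS; have [x [z [Ux Cz ->]]] := UC y; rewrite (C0 z Cz) addr0; apply: Ux.
Qed.

Lemma supported_tf : supported -> forall u v (x : M), tf u v x = 0.
Proof.
move=> sM u v x; have [uS|uS] := boolP (u \in S); first exact: tf_from_sink.
by rewrite -tf_tp sM // linear0.
Qed.
End Complement.

(** An invariant generator: as a graded semilinear space, M is then one-dimensional at each vertex
    of the H-orbit of v, with the components of t as coordinates. The maps [tf] are treated
    separately. *)
Definition simple_vec (H : G -> Prop) M v (t : M) : Prop :=
  [/\ forall s, H s -> ta s t = t, forall w, tp w t <> 0 <-> w \in vorb H v &
    forall w x, exists c, tp w x = c *: tp w t].
Definition simple_at H M v : Prop := exists t : M, simple_vec H v t.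

(** * Simple representations on one orbit of vertices *)

Section Simple.
Variable H : G -> Prop.
Hypothesis subH : subgroup H.

Lemma orb_sub v w : w \in vorb H v -> vorb H w = vorb H v.
Proof.
rewrite inE => /asboolP[s Hs ->]; apply/setP => u; rewrite !inE.
apply/asboolP/asboolP => -[t Ht ->].
  by exists (t * s)%g; [apply: subM | rewrite actvM].
exists (t * s^-1)%g; first by apply: subM => //; apply: subV.
by rewrite actvM avK.
Qed.

Lemma simple_at_orb M v w : w \in vorb H v -> simple_at H M v -> simple_at H M w.
Proof. by move=> /orb_sub ow [t [t1 t2 t3]]; exists t; split=> // u; rewrite t2 ow. Qed.

Lemma simple_span M v t : simple_vec H v (t : M) ->
  forall x, exists k : V -> L, x = \sum_(w in vorb H v) k w *: tp w t.
Proof.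
move=> [tH tO tC] x.
exists (fun w => projT1 (cid (tC w x))); rewrite -[LHS]tp_sum [RHS]big_mkcond.
apply: eq_bigr => w _; case: cid => /= k kE; case: ifPn => // wO.
by rewrite kE; have /contra_notP -> := (tO w).1; rewrite ?scaler0 //; apply/negP.
Qed.

(** An endomorphism acts at v by a scalar c and at s v by s c; idempotency forces c to be 0 or 1,
    which s fixes. *)
Lemma simple_tindec M v : galois rho H M -> simple_at H M v -> tindec H M.
Proof.
move=> gM [t st]; have [tH tO tC] := st; split.
  by exists (tp v t); apply/tO; apply: orb_refl.
move=> f hf ff; have [c cE] := tC v (f t).
have fE w : w \in vorb H v -> exists2 s, H s & f (tp w t) = s c *: tp w t.
  rewrite inE => /asboolP[s Hs ->]; exists s => //.
  have -> : tp (av s v) t = ta s (tp v t) by rewrite (gal_tp gM) // tH.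
  by rewrite (hom_a hf) // (hom_p hf) cE (taZ gM).
have : c * c = c.
  have /eqP := ff (tp v t); rewrite (hom_p hf) cE linearZ /= (hom_p hf) cE scalerA.
  rewrite -subr_eq0 -scalerBl scaler_eq0 => /orP[|/eqP tv0]; first by rewrite subr_eq0 => /eqP.
  by case: ((tO v).2 (orb_refl subH v)).
move=> /eqP; rewrite -{3}[c]mulr1 -subr_eq0 -mulrBr mulf_eq0 subr_eq0.
move=> /orP[/eqP c0|/eqP c1]; [left|right] => x; have [k ->] := simple_span st x; rewrite linear_sum.
  by rewrite big1 // => w /fE[s _ fw]; rewrite linearZ /= fw c0 rmorph0 scale0r scaler0.
by apply: eq_bigr => w /fE[s _ fw]; rewrite linearZ /= fw c1 rmorph1 scale1r.
Qed.

Lemma simple_hom M N v (t : M) (t' : N) : galois rho H M -> galois rho H N ->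
  (forall u w (x : M), tf u w x = 0) -> (forall u w (x : N), tf u w x = 0) ->
  simple_vec H v t -> simple_vec H v t' ->
  exists2 f : {linear M -> N}, hom H f & forall k : V -> L,
    f (\sum_(w in vorb H v) k w *: tp w t) = \sum_(w in vorb H v) k w *: tp w t'.
Proof.
move=> gM gN fM fN st st'; have [tH tO tC] := st; have [tH' tO' tC'] := st'.
have spM := simple_span st.
have [|x|y [k [kE ->]]|f fP] := @linear_of_rel L M N (fun x y => exists k : V -> L,
    x = \sum_(w in vorb H v) k w *: tp w t /\ y = \sum_(w in vorb H v) k w *: tp w t').
- move=> c x y x' y' [k [-> ->]] [l [-> ->]]; exists (fun w => c * k w + l w).
  by split; rewrite scaler_sumr -big_split; apply: eq_bigr => w _ /=; rewrite scalerDl scalerA.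
- by have [k ->] := spM x; exists (\sum_(w in vorb H v) k w *: tp w t'), k.
- rewrite big1 // => w wO; have := congr1 (tp w) kE; rewrite linear0 (tp_orbit_span H) wO.
  move/esym/eqP; rewrite scaler_eq0 => /orP[/eqP->|/eqP tw0]; first by rewrite scale0r.
  by case: ((tO w).2 wO).
have fE k : f (\sum_(w in vorb H v) k w *: tp w t) = \sum_(w in vorb H v) k w *: tp w t'.
  by symmetry; apply/fP; exists k.
exists f => //; split=> [u x|u w x|s Hs x].
- have [k ->] := spM x; rewrite fE !(tp_orbit_span H); case: ifP => uO; last by rewrite linear0.
  have := fE (fun w => if w == u then k w else 0).
  have one (P : trep) (z : P) : \sum_(w in vorb H v) (if w == u then k w else 0) *: tp w z = k u *: tp u z.
    rewrite (bigD1 u) //= eqxx big1 ?addr0 // => w /andP[_ /negPf->].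
    by rewrite scale0r.
  by rewrite !one.
- by rewrite fM fN linear0.
- by have [k ->] := spM x; rewrite (ta_orbit_span subH gM) // !fE (ta_orbit_span subH gN).
Qed.

Lemma simple_tiso M N v : galois rho H M -> galois rho H N ->
  (forall u w (x : M), tf u w x = 0) -> (forall u w (x : N), tf u w x = 0) ->
  simple_at H M v -> simple_at H N v -> tiso H M N.
Proof.
move=> gM gN fM fN [t st] [t' st'].
have [f hf fE] := simple_hom gM gN fM fN st st'.
have [g hg gE] := simple_hom gN gM fN fM st' st.
exists f, g; split=> // x.
  by have [k ->] := simple_span st x; rewrite fE gE.
by have [k ->] := simple_span st' x; rewrite gE fE.
Qed.

Lemma simple_tdim M v : simple_at H M v -> tdim M [ffun w => (w \in vorb H v)%:Z].
Proof.
move=> [t [tH tO tC]] w; exists (w \in vorb H v : nat); rewrite ffunE; split=> //.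
case: (boolP (w \in vorb H v)) => wO; last first.
  apply: zero_has_dim => x; split=> [<-|->]; last exact: linear0.
  have [c ->] := tC w x; have /contra_notP -> := (tO w).1; first by rewrite scaler0.
  exact/negP.
have tw0 := (tO w).2 wO.
have lin_f : linear (fun y : 'rV[L]_1 => y 0 0 *: tp w t).
  by move=> c x y; rewrite !mxE scalerDl scalerA.
exists (mklin lin_f) => [x y /= /eqP|x].
  rewrite -subr_eq0 -scalerBl scaler_eq0 subr_eq0 => /orP[/eqP xy|/eqP//].
  by apply/matrixP => i j; rewrite !ord1.
split=> [<-|[y ->]]; last by rewrite /= linearZ /= tp_idem.
by have [c ->] := tC w x; exists (const_mx c); rewrite /= mxE.
Qed.

(** All maps vanish, so the span of the conjugate components of one invariant vector is a summand,
    its stable complement being a subrepresentation too; indecomposability leaves only that span. *)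
Lemma supported_simple M (e : rel V) (S : {set V}) : galois rho H M -> tcont H M ->
  oriented e M -> (forall u v, u \in S -> ~~ e u v) -> tindec H M -> supported M S ->
  exists2 v, v \in S & simple_at H M v.
Proof.
move=> gM cM oM sinkS indM sM; have f0 := supported_tf oM sinkS sM.
have [y y0] := indM.1.
have [|t tH t0] := @invariant_outside H M subH gM cM (fun x => x = 0) y _ y0.
  by split=> [|x z -> ->|c x ->]; rewrite ?addr0 ?scaler0.
have [v tv0] : exists v, tp v t <> 0.
  apply: contrapT => nv; apply: t0; rewrite -[t]tp_sum big1 // => v _.
  by apply: contrapT => ?; apply: nv; exists v.
have vS : v \in S by apply: contraT => vS; case: tv0; apply: sM.
exists v => //; have sO := orbit_span_stable subH gM v tH.
have [C [sC OC0 OC]] := complement subH gM cM sO.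
have [u w x Ox|u w x Cx|O0|C0] := tindec_splits gM indM (And4 sO sC OC0 OC).
- by rewrite f0; apply: submod0 (stable_sub sO).
- by rewrite f0; apply: submod0 (stable_sub sC).
- by case: tv0; apply: O0; apply/orbit_span_tp/orb_refl.
(* A generator must vanish off the orbit of v, so t is truncated to it. *)
pose t' := \sum_(w in vorb H v) 1 *: tp w t.
have tpt' w : tp w t' = if w \in vorb H v then tp w t else 0.
  by rewrite tp_orbit_span; case: ifP; rewrite ?scale1r.
exists t'; split.
- by move=> s Hs; rewrite (ta_orbit_span subH gM) //; apply: eq_bigr => w _; rewrite rmorph1.
- move=> w; rewrite tpt'; case: ifPn => wO; last by split.
  split=> // _; move: wO; rewrite inE => /asboolP[s Hs ->] tw0; apply: tv0.
  by apply: (ta_inj gM subH Hs); rewrite (gal_tp gM) // tH // tw0 (ta0 gM).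
- move=> w x; have [y1 [z [[k yE] Cz xE]]] := OC x.
  rewrite xE (C0 z Cz) addr0 yE tp_orbit_span tpt'.
  by case: ifP => _; [exists (k w) | exists 0; rewrite scaler0].
Qed.
End Simple.
End Splitting.

(** * Induction from a subgroup of the Galois group *)

Section Induction.
Variables (K L : fieldType) (iota : {rmorphism K -> L}) (Gamma : quiver).
Variable rho : rational_structure iota Gamma.
Local Notation V := (vert Gamma).
Local Notation G := (Gal iota).
Local Notation av := (actv rho).
Local Notation trep := (trep iota Gamma).

Definition full (s : G) : Prop := True.

Lemma full_subgroup : subgroup full. Proof. by []. Qed.

Variable H : G -> Prop.
Hypothesis subH : subgroup H.

Section Space.
Variable A : trep.
Hypothesis gA : galois rho H A.

(** The convention of [res_compatible], with the vertices absorbed into the total space; L acts on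
    the value at g through g^-1. *)
Definition ind_compat (x : G -> A) : Prop :=
  forall g k, H k -> ta k (x (g * k)%g) = x g.

Record ind_space : Type := IndSpace { ind_fun :> G -> A; indP : ind_compat ind_fun }.

Lemma ind_ext (x y : ind_space) : x =1 y -> x = y.
Proof.
case: x y => [x xP] [y yP] /= xy; have {}xy : x = y by apply: funext.
by case: _ / xy yP => yP; rewrite (Prop_irrelevance xP yP).
Qed.

HB.instance Definition _ := gen_eqMixin ind_space.
HB.instance Definition _ := gen_choiceMixin ind_space.

Lemma ind0_subproof : ind_compat (fun=> 0).
Proof. by move=> g k Hk; rewrite (ta0 gA). Qed.
Definition ind_zero := IndSpace ind0_subproof.

Lemma indD_subproof (x y : ind_space) : ind_compat (fun g => x g + y g).
Proof. by move=> g k Hk; rewrite (taD gA) // !indP. Qed.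
Definition ind_add x y := IndSpace (indD_subproof x y).

Lemma indZ_subproof c (x : ind_space) : ind_compat (fun g => g^-1%g c *: x g).
Proof. by move=> g k Hk; rewrite (taZ gA) // indP // gal_mulKV. Qed.
Definition ind_scale c x := IndSpace (indZ_subproof c x).

Lemma indN_subproof (x : ind_space) : ind_compat (fun g => - x g).
Proof.
move=> g k Hk; rewrite -scaleN1r (taZ gA) // indP // rmorphN rmorph1.
by rewrite scaleN1r.
Qed.
Definition ind_opp x := IndSpace (indN_subproof x).

Lemma ind_addA : associative ind_add.
Proof. by move=> x y z; apply: ind_ext => g /=; rewrite addrA. Qed.
Lemma ind_addC : commutative ind_add.
Proof. by move=> x y; apply: ind_ext => g /=; rewrite addrC. Qed.
Lemma ind_add0 : left_id ind_zero ind_add.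
Proof. by move=> x; apply: ind_ext => g /=; rewrite add0r. Qed.
Lemma ind_addN : left_inverse ind_zero ind_opp ind_add.
Proof. by move=> x; apply: ind_ext => g /=; rewrite addNr. Qed.
HB.instance Definition _ := GRing.isZmodule.Build ind_space
  ind_addA ind_addC ind_add0 ind_addN.

Lemma ind_scaleA c d x : ind_scale c (ind_scale d x) = ind_scale (c * d) x.
Proof. by apply: ind_ext => g /=; rewrite scalerA -(rmorphM g^-1%g). Qed.
Lemma ind_scale1 : left_id 1 ind_scale.
Proof.
move=> x; apply: ind_ext => g; transitivity (g^-1%g 1 *: x g) => //.
by rewrite rmorph1 scale1r.
Qed.
Lemma ind_scaleDr : right_distributive ind_scale +%R.
Proof. by move=> c x y; apply: ind_ext => g /=; rewrite scalerDr. Qed.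
Lemma ind_scaleDl x : {morph ind_scale^~ x : c d / c + d}.
Proof. by move=> c d; apply: ind_ext => g /=; rewrite -scalerDl -(rmorphD g^-1%g). Qed.
HB.instance Definition _ := GRing.Zmodule_isLmodule.Build L ind_space
  ind_scaleA ind_scale1 ind_scaleDr ind_scaleDl.

Lemma ind_sum I (r : seq I) (P : pred I) (F : I -> ind_space) g :
  (\sum_(i <- r | P i) F i) g = \sum_(i <- r | P i) F i g.
Proof. by elim/big_rec2: _ => // i y x _ <-. Qed.

Lemma avM_inv g k v : av k (av (g * k)^-1%g v) = av g^-1%g v.
Proof. by rewrite invgM actvM avVK. Qed.

Lemma ind_p_subproof v (x : ind_space) : ind_compat (fun g => tp (av g^-1%g v) (x g)).
Proof. by move=> g k Hk; rewrite (gal_tp gA) // indP // avM_inv. Qed.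
Definition ind_p_fun v x := IndSpace (ind_p_subproof v x).
Lemma ind_p_linear v : linear (ind_p_fun v).
Proof. by move=> c x y; apply: ind_ext => g /=; rewrite linearP. Qed.
Definition ind_p v : {linear ind_space -> ind_space} := mklin (@ind_p_linear v).

Lemma ind_f_subproof u v (x : ind_space) :
  ind_compat (fun g => tf (av g^-1%g u) (av g^-1%g v) (x g)).
Proof. by move=> g k Hk; rewrite (gal_tf gA) // indP // !avM_inv. Qed.
Definition ind_f_fun u v x := IndSpace (ind_f_subproof u v x).
Lemma ind_f_linear u v : linear (ind_f_fun u v).
Proof. by move=> c x y; apply: ind_ext => g /=; rewrite linearP. Qed.
Definition ind_f u v : {linear ind_space -> ind_space} := mklin (@ind_f_linear u v).

Lemma ind_a_subproof s (x : ind_space) : ind_compat (fun g => x (s^-1 * g)%g).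
Proof. by move=> g k Hk; rewrite mulgA indP. Qed.
Definition ind_a s x := IndSpace (ind_a_subproof s x).

Lemma av_eq s u v : (av s u == av s v) = (u == v).
Proof. exact: (inj_eq (@av_inj _ _ _ _ rho s)). Qed.

Lemma ind_pp u v x : ind_p u (ind_p v x) = if u == v then ind_p v x else 0.
Proof.
by apply: ind_ext => g /=; rewrite tpp av_eq; case: eqP.
Qed.
Lemma ind_p_sum x : \sum_v ind_p v x = x.
Proof.
apply: ind_ext => g; rewrite ind_sum /= -[RHS]tp_sum.
by rewrite [RHS](reindex _ (onW_bij _ (av_bij rho g^-1%g))).
Qed.
Lemma ind_pf u v w x : ind_p w (ind_f u v x) = if w == v then ind_f u v x else 0.
Proof. by apply: ind_ext => g /=; rewrite tpf av_eq; case: eqP. Qed.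
Lemma ind_fp u v w x : ind_f u v (ind_p w x) = if w == u then ind_f u v x else 0.
Proof. by apply: ind_ext => g /=; rewrite tfp av_eq; case: eqP. Qed.

Definition ind : trep := TRep ind_a ind_pp ind_p_sum ind_pf ind_fp.

Lemma ind_good e : (forall s u v, e (av s u) (av s v) = e u v) -> oriented e A ->
  good rho full e ind.
Proof.
move=> e_av oA; split; last first.
  by move=> u v x nuv; apply: ind_ext => g /=; apply: oA; rewrite e_av.
split=> [s _ c x y|s t _ _ x|x|s _ v x|s _ u v x]; apply: ind_ext => g /=.
- congr (_ *: _ + _); have : ((s^-1 * g)^-1 = g^-1 * s)%g by rewrite invgM invgK.
  by move/(congr1 (fun k : G => k c)).
- by rewrite invgM mulgA.
- by rewrite invg1 mul1g.
- by rewrite invgM invgK actvM.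
- by rewrite invgM invgK !actvM.
Qed.
End Space.

Definition coset_rep (g : G) : G := classical_sets.xget 1%g (fun s => H (g^-1 * s)%g).

Lemma coset_repP g : H (g^-1 * coset_rep g)%g.
Proof.
apply: (@classical_sets.xgetPex _ 1%g (fun s => H (g^-1 * s)%g)).
by exists g; rewrite mulVg; apply: sub1.
Qed.

(** The representative is chosen from a predicate that is the same for g and for g k. *)
Lemma coset_repM g k : H k -> coset_rep (g * k)%g = coset_rep g.
Proof.
move=> Hk; congr classical_sets.xget; apply/funext => s; apply/propext; rewrite invgM -mulgA.
split=> Hs; last by apply: (subM subH) => //; apply: (subV subH).
by rewrite -[(_ * s)%g](mulVKg k); apply: (subM subH).
Qed.

Section Extension.
Variables (A : trep) (gA : galois rho H A) (y : G -> A).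

Lemma ind_extend_subproof :
  ind_compat (fun g => ta (g^-1 * coset_rep g)%g (y (coset_rep g))).
Proof.
move=> g k Hk; rewrite coset_repM // -(gal_mulE gA) //.
  by rewrite invgM !mulgA mulgV mul1g.
by rewrite invgM -mulgA; apply: (subM subH); [apply: (subV subH) | apply: coset_repP].
Qed.
(* The extension to G of the restriction of y to coset representatives. *)
Definition ind_extend : ind gA := IndSpace ind_extend_subproof.

Lemma ind_at_rep (x : ind gA) g : x g = ta (g^-1 * coset_rep g)%g (x (coset_rep g)).
Proof.
by rewrite -(indP x g (coset_repP g)) mulgA mulgV mul1g.
Qed.

Lemma av_rep g v : av (g^-1 * coset_rep g)%g (av (coset_rep g)^-1%g v) = av g^-1%g v.
Proof. by rewrite actvM avVK. Qed.
End Extension.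

Section Map.
Variables (A B : trep) (gA : galois rho H A) (gB : galois rho H B).
Variable f : {linear A -> B}.
Hypothesis fa : forall s, H s -> forall x, f (ta s x) = ta s (f x).

Lemma ind_map_subproof (x : ind gA) : ind_compat (fun g => f (x g)).
Proof. by move=> g k Hk; rewrite -fa // indP. Qed.
Definition ind_map_fun (x : ind gA) : ind gB := IndSpace (ind_map_subproof x).
Lemma ind_map_linear : linear ind_map_fun.
Proof. by move=> c x y; apply: ind_ext => g /=; rewrite linearP. Qed.
Definition ind_map : {linear ind gA -> ind gB} := mklin ind_map_linear.

Lemma ind_map_hom : hom H f -> hom full ind_map.
Proof.
by move=> [fp ff _]; split=> [v x|u v x|s _ x]; apply: ind_ext => g /=; rewrite ?fp ?ff.
Qed.
End Map.

Lemma ind_tiso A B (gA : galois rho H A) (gB : galois rho H B) :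
  tiso H A B -> tiso full (ind gA) (ind gB).
Proof.
move=> [f [g [hf hg fg gf]]].
exists (ind_map gA gB (hom_a hf)), (ind_map gB gA (hom_a hg)).
by split; try exact: ind_map_hom; move=> x; apply: ind_ext => s /=; rewrite ?fg ?gf.
Qed.

Section Reflection.
Variables (e : rel V) (S : {set V}).
Hypothesis stabS : forall s v, (av s v \in S) = (v \in S).
Hypothesis e_av : forall s u v, e (av s u) (av s v) = e u v.
Variables (A A' : trep) (theta : {linear A' -> A}).
Hypotheses (gA : good rho H e A) (gA' : galois rho H A') (rA : is_refl H e S theta).

Lemma sum_av s (M : nmodType) (F : V -> M) : \sum_v F (av s v) = \sum_v F v.
Proof. by rewrite [RHS](reindex _ (onW_bij _ (av_bij rho s))). Qed.

(** Each condition is checked value by value, at g for the vertex g^-1 v. Where a vector must be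
    produced, it is chosen at the coset representatives only and extended by [ind_extend], which
    makes it compatible. *)
Lemma ind_is_refl : is_refl full e S (ind_map gA' gA.1 (refl_a rA)).
Proof.
have choiceG (P : G -> A' -> Prop) : (forall g, exists x, P g x) -> exists x : G -> A', forall g, P g (x g).
  by move=> exP; exists (fun g => projT1 (cid (exP g))) => g; case: cid.
have choiceA (P : G -> A -> Prop) : (forall g, exists x, P g x) -> exists x : G -> A, forall g, P g (x g).
  by move=> exP; exists (fun g => projT1 (cid (exP g))) => g; case: cid.
split.
- move=> v x; apply: ind_ext => g /=; rewrite (refl_p rA) stabS.
  by case: ifP.
- by move=> u v x uS vS; apply: ind_ext => g /=; rewrite (refl_f rA) ?stabS.
- by move=> s _ x; apply: ind_ext.
- move=> v x vS x0; apply: ind_ext => g /=; apply: (refl_inj rA); rewrite ?stabS //.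
  by have := congr1 (fun y : ind gA.1 => y g) x0.
- move=> y; have [x xE] := choiceG _ (fun g => refl_surj rA (y g)).
  exists (ind_extend gA' x); apply: ind_ext => g /=; rewrite ind_sum /=.
  rewrite (refl_a rA) ?xE; last exact: coset_repP.
  rewrite (ta_sum gA.1); last exact: coset_repP.
  rewrite (eq_bigr (fun v => tp (av (g^-1 * coset_rep g)%g v) (y g))); last first.
    by move=> v _; rewrite (gal_tp gA.1) -?ind_at_rep //; apply: coset_repP.
  rewrite big_mkcond [RHS]big_mkcond.
  rewrite -[RHS](sum_av (coset_rep g)); apply: eq_bigr => v _.
  by rewrite stabS actvM.
- move=> v x vS; apply: ind_ext => g; rewrite ind_sum /=.
  rewrite -[RHS](refl_complex rA (x g) (v := av g^-1%g v)) ?stabS //.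
  by rewrite -[RHS](sum_av g^-1%g).
- move=> v x vS x0; apply: ind_ext => g /=; apply: (refl_mono rA); rewrite ?stabS //.
  move=> u uS; have := x0 (av g u); rewrite stabS => /(_ uS).
  by move/(congr1 (fun y : ind gA' => y g)) => /=; rewrite avK.
- move=> v y vS; have [|z zE] := choiceA (fun g z => tp (av g^-1%g v) (y g) = \sum_u tf u (av g^-1%g v) z).
    by move=> g; apply: (refl_epi rA); rewrite stabS.
  exists (ind_extend gA.1 z); apply: ind_ext => g; rewrite ind_sum /=.
  have Hk := coset_repP g; rewrite (ind_at_rep y g) -(av_rep g v) -(gal_tp gA.1) // zE.
  rewrite (ta_sum gA.1) // (sum_av g^-1%g (fun u => tf u _ _)).
  rewrite -[RHS](sum_av (g^-1 * coset_rep g)%g); apply: eq_bigr => u _.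
  by rewrite (gal_tf gA.1).
- move=> v z vS z0; have [|x xE] := choiceG (fun g x =>
    forall u, e u (av g^-1%g v) -> theta (tf (av g^-1%g v) u x) = tp u (z g)).
    move=> g; apply: (refl_exact rA); rewrite ?stabS //.
    have := congr1 (fun y : ind gA.1 => y g) z0; rewrite ind_sum /=.
    by rewrite (sum_av g^-1%g (fun u => tf u (av g^-1%g v) (z g))).
  exists (ind_extend gA' x) => u uv; apply: ind_ext => g /=; have Hk := coset_repP g.
  rewrite -!(av_rep g) -(gal_tf gA') // (refl_a rA) // xE ?e_av //.
  by rewrite (ind_at_rep z g) (gal_tp gA.1).
Qed.

End Reflection.

Lemma ind_supp (A : trep) (gA : galois rho H A) v : (forall x : ind gA, tp v x = 0) ->
  forall y : A, tp v y = 0.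
Proof.
move=> x0 y; pose k := (1^-1 * coset_rep 1)%g; have Hk : H k := coset_repP 1.
have := congr1 (fun x : ind gA => x 1%g) (x0 (ind_extend gA (fun=> ta k^-1%g y))).
by rewrite /= -/k (taVK gA subH) // invg1 actv1.
Qed.

(** The constant function t generates: H is the whole stabilizer of v, so the g with g^-1 w = v form
    a single coset, and compatibility determines every value from the one at [g0]. *)
Lemma ind_simple (A : trep) (gA : galois rho H A) v : (forall s, H s <-> av s v = v) ->
  simple_at rho H A v -> simple_at rho full (ind gA) v.
Proof.
move=> Hv [t [tH tO tC]].
have orbv w : w \in vorb rho H v -> w = v by rewrite inE => /asboolP[s /Hv sv ->].
have tE w : w != v -> tp w t = 0 by move=> wv; apply: contrapT => /tO/orbv/eqP; apply/negP.
have tv0 : tp v t <> 0 by apply/tO/orb_refl.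
have tP : ind_compat (fun _ : G => t) by move=> g k; apply: tH.
exists (IndSpace tP : ind gA); split.
- by move=> s _; apply: ind_ext.
- move=> w; rewrite inE; split=> [nz|/asboolP[s _ ->] tw0].
    apply/asboolP; apply: contrapT => nw; apply: nz; apply: ind_ext => g /=.
    by apply: tE; apply/eqP => gw; apply: nw; exists g; rewrite // -gw avVK.
  by apply: tv0; have := congr1 (fun x : ind gA => x s) tw0; rewrite /= avK.
- move=> w y; have [[g0 g0w]|nw] := pselect (exists g, av g v = w); last first.
    exists 0; rewrite scale0r; apply: ind_ext => g /=.
    have [c ->] := tC (av g^-1%g w) (y g); rewrite tE ?scaler0 //.
    by apply/eqP => gw; apply: nw; exists g; rewrite -gw avVK.
  (* The scalar is [g0 c] because L acts on the value at [g0] through the inverse of [g0]. *)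
  have [c cE] := tC v (y g0); exists (g0 c); apply: ind_ext => g /=.
  have [gw|/eqP gw] := pselect (av g^-1%g w = v); last first.
    by have [c' ->] := tC (av g^-1%g w) (y g); rewrite tE // !scaler0.
  rewrite gw; pose k := (g^-1 * g0)%g.
  have kv : av k v = v by rewrite actvM g0w.
  have Hk : H k by apply/Hv.
  have -> : y g = ta k (y g0) by rewrite -(indP y g Hk) mulgA mulgV mul1g.
  rewrite -{1}kv -(gal_tp gA) // cE (taZ gA) // (gal_tp gA) // kv tH //.
Qed.

(** It suffices to control x on a finite transversal of the stabilizer of [xs]. If s fixes the
    t-images of [xs] and of the elements controlling [x t], then t^-1 s^-1 t lies in H and fixes
    [x t]. *)
Lemma ind_tcont (A : trep) (gA : galois rho H A) : algebraic_extension iota ->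
  (exists xs, forall s, fixes s xs -> H s) -> tcont H A -> tcont full (ind gA).
Proof.
move=> algL [xs xsP] cA x; have [ss ssP] := transversal_exists algL full xs.
pose ys t := projT1 (cid (cA (x t))).
have ysP t s : H s -> fixes s (ys t) -> ta s (x t) = x t by rewrite /ys; case: cid => z /=; apply.
exists (flatten [seq [seq (t : G) z | z <- xs ++ ys t] | t <- ss]) => s _ sP.
apply: ind_ext => g /=; have [t tss gt] := trans_ex ssP (I : full g).
have sVt z : z \in xs ++ ys t -> (t^-1 * (s^-1 * t))%g z = z.
  move=> zP; have st : s (t z) = t z.
    by apply: sP; apply/flatten_mapP; exists t => //; apply: map_f.
  by rewrite -[RHS](gal_invK t) -[t z in RHS](gal_invK s) st.
have Hm : H (t^-1 * (s^-1 * t))%g by apply: xsP => z zxs; apply: sVt; rewrite mem_cat zxs.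
have xm : ta (t^-1 * (s^-1 * t))%g (x t) = x t.
  by apply: ysP => // z zys; apply: sVt; rewrite mem_cat zys orbT.
have xst : x (s^-1 * t)%g = x t.
  apply: (ta_inj gA subH Hm); rewrite xm -[RHS](indP x t Hm).
  by rewrite mulVKg.
have Hk : H (g^-1 * t)%g by apply: xsP.
have E1 : (g * (g^-1 * t) = t)%g by rewrite mulVKg.
have E2 : (s^-1 * g * (g^-1 * t) = s^-1 * t)%g by rewrite -mulgA E1.
by rewrite -(indP x g Hk) -(indP x (s^-1 * g)%g Hk) E1 E2 xst.
Qed.
End Induction.
Arguments full {K L iota} s.
Arguments full_subgroup {K L iota}.

(** * Classification of the continuous indecomposables *)

Section Classification.
Variables (K L : fieldType) (iota : {rmorphism K -> L}) (Gamma : quiver).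
Variable rho : rational_structure iota Gamma.
Hypothesis algL : algebraic_extension iota.
Local Notation V := (vert Gamma).
Local Notation G := (Gal iota).
Local Notation av := (actv rho).
Local Notation trep := (trep iota Gamma).
Local Notation vec := {ffun V -> int}.
Implicit Types (M N : trep) (a : vec).

Variable h : V -> int.
Hypothesis nloop : forall v : V, nedges v v = 0%N.
Hypothesis h_gt0 : forall v, 0 < h v.
Hypothesis kk_h : forall v, 1 <= 2 * h v - \sum_u (nedges v u)%:Z * h u.
Variable arr : rel V.
Hypothesis arrP : orientation arr.
Hypothesis arr_av : forall s u v, arr (av s u) (av s v) = arr u v.

Local Notation es := (arrow arr).
Local Notation Ss := (fire arr).
Local Notation window := (window h).
Let sinkS t u v : u \in Ss t -> ~~ es t u v := @fire_sink _ h h_gt0 kk_h arr arrP t u v.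
Let flipE t : es t.+1 =2 flip (Ss t) (es t) := @arrow_flip _ arr t.
Let esP t : orientation (es t) := arrow_orientation arrP t.
Let indepS t : indep (Ss t) := @fire_indep _ h h_gt0 kk_h arr arrP t.

Lemma connect_av s u v : connect arr (av s u) (av s v) = connect arr u v.
Proof.
suff imp k x y : connect arr x y -> connect arr (av k x) (av k y).
  by apply/idP/idP => [/(imp s^-1%g)|/imp//]; rewrite !avK.
move=> /connectP[p]; elim: p x => [|z p IHp] x /=; first by move=> _ ->.
move=> /andP[xz zp] /(IHp _ zp); apply: connect_trans; apply: connect1.
by rewrite arr_av.
Qed.

Lemma rank_av s v : rank arr (av s v) = rank arr v.
Proof.
rewrite /rank -(card_imset [set w | connect arr v w] (@av_inj _ _ _ _ rho s)).
apply: eq_card => w; apply/idP/imsetP => [|[x + ->]].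
  by rewrite inE => vw; exists (av s^-1%g w); rewrite ?avVK // inE -(connect_av s) avVK.
by rewrite !inE connect_av.
Qed.

Lemma fire_av t s v : (av s v \in Ss t) = (v \in Ss t).
Proof. by rewrite !inE rank_av. Qed.

Lemma arrow_av t s u v : es t (av s u) (av s v) = es t u v.
Proof. by rewrite /arrow /= /fired !rank_av !arr_av. Qed.

Local Notation link := (link rho es Ss).
Local Notation chain := (chain rho es Ss).

Definition triv (s : G) : Prop := s = 1%g.

Lemma triv_sub (H : G -> Prop) : subgroup H -> forall s, triv s -> H s.
Proof. by move=> subH s ->; apply: sub1. Qed.

Lemma triv_subgroup : subgroup triv.
Proof. by split=> [|s t -> ->|s ->]; rewrite /triv ?mulg1 ?invg1. Qed.

Lemma triv_tcont M : galois rho triv M -> tcont triv M.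
Proof. by move=> gM x; exists [::] => s -> _; apply: (gal_oneE gM). Qed.

Lemma link_exists (H : G -> Prop) t M : subgroup H -> good rho H (es t) M ->
  (forall v (y : M), v \in Ss t -> exists z : M, tp v y = \sum_u tf u v z) ->
  exists M', link H t M M'.
Proof.
move=> subH gM epiM; have st s v := fire_av t s v; have se s u v := arrow_av t s u v.
exists (reflection st se gM).
have [gM' oM'] := reflection_good subH st se gM.
split=> //; last by exists (reflection_map st se gM); apply: reflection_is_refl; first exact: sinkS.
by split=> //; apply/(oriented_flip flipE).
Qed.

Section Line.
Variable u : V.
Definition line_p (v : V) (x : L^o) : L^o := if v == u then x else 0.
Lemma line_p_linear v : linear (line_p v).
Proof. by move=> c x y; rewrite /line_p; case: ifP => // _; rewrite scaler0 addr0. Qed.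
Definition line_f (v w : V) (x : L^o) : L^o := 0.
Lemma line_f_linear v w : linear (line_f v w).
Proof. by move=> c x y; rewrite /line_f scaler0 addr0. Qed.

(** The simple representation at u, with G acting on L itself; this action respects the vertices
    only for elements fixing u. *)
Definition line : trep.
Proof.
apply: (@TRep _ _ iota Gamma L^o (fun v => mklin (line_p_linear v))
  (fun v w => mklin (line_f_linear v w)) (fun s x => s x)).
- move=> v w x; rewrite /= /line_p; case: (eqVneq v w) => [->|vw]; first by case: eqP.
  by case: eqP => // vu; case: eqP => // wu; rewrite vu wu eqxx in vw.
- move=> x; rewrite (bigD1 u) //= /line_p eqxx big1 ?addr0 // => v /negPf.
  by rewrite /line_p => ->.
- by move=> v w w' x; rewrite /= /line_f /line_p; do 2!case: ifP.
- by move=> v w w' x; rewrite /= /line_f; case: ifP.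
Defined.

Variable H : G -> Prop.
Hypothesis subH : subgroup H.
Hypothesis Hu : forall s, H s -> av s u = u.

Lemma line_good e : good rho H e line.
Proof.
split; last by [].
split=> //=.
- by move=> s _ c x y; rewrite rmorphD rmorphM.
- move=> s Hs v x; rewrite /line_p -{2}(Hu Hs) (inj_eq (@av_inj _ _ _ _ rho s)).
  by case: ifP => // _; exact: (rmorph0 s).
- by move=> s _ v w x; exact: (rmorph0 s).
Qed.

Lemma line_simple : simple_at rho H line u.
Proof.
exists (1 : L^o); split=> [s _|w|w x] /=; first exact: (rmorph1 s).
  rewrite /line_p /vorb inE; case: eqP => [->|wu]; split=> //.
  - by move=> _; apply/asboolP; exists 1%g; [apply: sub1 | rewrite actv1].
  - by move=> _; apply/eqP/oner_neq0.
  - by move=> /asboolP[s Hs wE]; case: wu; rewrite wE Hu.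
exists (if w == u then x else 0); rewrite /line_p; case: ifP => _; last by rewrite scaler0.
by rewrite -[x in LHS]mulr1.
Qed.
End Line.

Lemma line_tdim u : tdim (line u) (simple_root u).
Proof.
have Hu s : triv s -> av s u = u by move=> ->; apply: actv1.
have := simple_tdim (line_simple triv_subgroup Hu); congr (tdim _ _).
apply/ffunP => w; rewrite !ffunE inE; congr (Posz (nat_of_bool _)).
apply/asboolP/eqP => [[s -> ->]|->]; first exact: actv1.
by exists 1%g; rewrite ?actv1.
Qed.

Local Notation hits := (hits arr).

(** By [indep_root] such a vector is the simple root of a fired vertex, and its reflection is the
    negative. *)
Lemma supported_root_step t a : nonneg a -> bform a a = 2 ->
  (forall v, v \notin Ss t -> a v = 0) -> ~ nonneg (srefl (Ss t) a).
Proof.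
move=> a0 a2 aS na; have [v vS aE] := indep_root nloop h_gt0 kk_h a0 a2 (@indepS t) aS.
have := na v; rewrite ffunE vS aE -bform_simple bform_simple_simple // ffunE eqxx.
by [].
Qed.

Lemma chain_rcons (H : G -> Prop) n t M N (P : trep) :
  chain H n t M N -> link H (t + n) N P -> chain H n.+1 t M P.
Proof.
by move=> cM lN; rewrite -addn1; apply: chain_cat cM _; exists P.
Qed.

(* [root_indec] asks for indecomposability over L, whatever H. *)
Record root_rep (H : G -> Prop) t a M : Prop := RootRep {
  root_good : good rho H (es t) M;
  root_cont : tcont H M;
  root_indec : tindec triv M;
  root_dim : tdim M a }.

(** Were M supported at the fired sinks, its dimension vector would reflect to a negative one by
    [supported_root_step]. As [root_indec] is over L, the dichotomy is applied with the trivial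
    group, and the link is then formed over H. *)
Lemma root_link (H : G -> Prop) t a M : subgroup H -> root_rep H t a M ->
  nonneg a -> bform a a = 2 -> nonneg (srefl (Ss t) a) ->
  exists2 M', link H t M M' & root_rep H t.+1 (srefl (Ss t) a) M'.
Proof.
move=> subH [gM cM iM dM] a0 a2 na.
have gM' : good rho triv (es t) M by apply: good_sub gM; apply: triv_sub.
have [sM|epiM] := indecomposable_dichotomy algL triv_subgroup gM'.1 (triv_tcont gM'.1) gM'.2
    (@sinkS t) (fire_av t) iM.
  case: (supported_root_step a0 a2 _ na) => v vS.
  by apply: (tdim_vanish dM) => x; apply: sM.
have [M' lM] := link_exists subH gM epiM.
exists M' => //; split; first by case: lM.
- exact: (link_tcont flipE lM cM).
- by apply: (link_tindec flipE sinkS fire_av (t := t) _ iM); apply: link_sub lM; apply: triv_sub.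
- exact: (link_tdim esP flipE sinkS lM dM).
Qed.

Lemma root_chain (H : G -> Prop) t0 T (b : nat -> vec) M n : subgroup H ->
  (forall i, (t0 <= i < T)%N -> b i.+1 = srefl (Ss i) (b i)) ->
  (forall i, (t0 <= i <= T)%N -> nonneg (b i) /\ bform (b i) (b i) = 2) ->
  root_rep H t0 (b t0) M -> (t0 + n <= T)%N ->
  exists2 N, chain H n t0 M N & root_rep H (t0 + n) (b (t0 + n)%N) N.
Proof.
move=> subH bS bP rM; elim: n => [|n IHn] len; first by exists M; rewrite ?addn0.
have [|N cN rN] := IHn; first by lia.
have bn : b (t0 + n).+1 = srefl (Ss (t0 + n)) (b (t0 + n)%N) by apply: bS; lia.
have [||| N' lN rN'] := root_link subH rN.
- by apply: (bP _ _).1; lia.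
- by apply: (bP _ _).2; lia.
- by rewrite -bn; apply: (bP _ _).1; lia.
by exists N'; [apply: chain_rcons lN | rewrite addnS bn].
Qed.

Lemma line_root (H : G -> Prop) t u : subgroup H -> (forall s, H s -> av s u = u) ->
  root_rep H t (simple_root u) (line u).
Proof.
move=> subH Hu; have Hu' s : triv s -> av s u = u by move=> ->; apply: actv1.
split; first exact: line_good.
- by move=> x; exists [:: x : L] => s _ sx; apply: sx; exact: mem_head.
- apply: (simple_tindec triv_subgroup) (line_simple triv_subgroup Hu').
  exact: (line_good Hu' (fun=> xpred0)).1.
- exact: line_tdim.
Qed.

Lemma line_chain (H : G -> Prop) j T (b : nat -> vec) u n : subgroup H ->
  (forall s, H s -> av s u = u) -> hits j T b u -> (j.+1 + n <= T)%N ->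
  exists2 A : trep, chain H n j.+1 (line u) A & root_rep H (j.+1 + n) (b (j.+1 + n)%N) A.
Proof.
move=> subH Hu [ltjT uS bj bS bP]; apply: root_chain => //.
by rewrite bj; apply: line_root.
Qed.

(* Back at time j+1 the hom starts at the simple at u and ends in a reflection,
   where no nonzero vector at u is killed by the outgoing maps. *)
Lemma hom_line_vanish j u n M0 M1 N (A : trep) (f : {linear A -> N}) : u \in Ss j ->
  link triv j M0 M1 -> chain triv n j.+1 M1 N -> chain triv n j.+1 (line u) A ->
  hom triv f -> forall x, f x = 0.
Proof.
move=> uS [_ _ [theta rM]] cM cA hf.
have [g [hg g0]] := chain_hom sinkS fire_av cA cM hf; apply: g0 => x.
have xE : tp u (x : line u) = x by rewrite /= /line_p eqxx.
rewrite -xE (hom_p hg); apply: (refl_mono rM uS) => w _.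
by rewrite -(hom_f hg) -[RHS](linear0 g); congr (g _).
Qed.

(** With a simple root as dimension vector, A is one-dimensional with zero maps, so its generator
    can go to any vector at v that the outgoing maps kill. *)
Lemma hom_from_root v (A : trep) N e x : good rho triv e A -> orientation e -> tdim A (simple_root v) ->
  galois rho triv N -> tp v x = x -> (forall w, tf v w x = 0 :> N) ->
  exists2 f : {linear A -> N}, hom triv f & exists y, f y = x.
Proof.
move=> [gA oA] eP dA gN xv xf.
have [n []] := dA v; rewrite ffunE eqxx => -[<-] [b bI bP] {n}.
have A0 w y : w != v -> tp w y = 0 :> A.
  by move=> wv; apply: (tdim_supp _ dA); rewrite ffunE (negPf wv).
have Av y : tp v y = y :> A.
  by rewrite -[RHS]tp_sum (bigD1 v) //= big1 ?addr0 // => w; apply: A0.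
have tfA u w y : tf u w y = 0 :> A.
  have [->|uv] := eqVneq u v; last by rewrite -[y]Av tfp eq_sym (negPf uv).
  have [->|wv] := eqVneq w v; last by rewrite -[LHS]Av tpf eq_sym (negPf wv).
  by apply: oA; have := eP v v; rewrite nloop; case: (e v v).
pose t := b (const_mx 1); have tE y : exists c, y = c *: t.
  have /bP[z ->] := Av y; exists (z 0 0); rewrite -linearZ; congr (b _).
  by apply/matrixP => i k; rewrite !ord1 !mxE mulr1.
have t0 c : c *: t = 0 -> c = 0.
  rewrite -linearZ => /eqP; rewrite -(linear0 b) => /eqP/bI/matrixP/(_ 0 0).
  by rewrite !mxE mulr1.
have [|y|z [c [/esym/t0-> ->]]|f fP] := @linear_of_rel L A N (fun y z => exists c, y = c *: t /\ z = c *: x).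
- move=> c y y' z z' [k [-> ->]] [l [-> ->]]; exists (c * k + l).
  by rewrite !scalerDl !scalerA.
- by have [c ->] := tE y; exists (c *: x), c.
- by rewrite scale0r.
have fE c : f (c *: t) = c *: x by symmetry; apply/fP; exists c.
exists f; last by exists t; rewrite -[t]scale1r fE scale1r.
split=> [w y|u w y|s -> y].
- have [c cE] := tE y; have [->|wv] := eqVneq w v; first by rewrite Av cE fE linearZ /= xv.
  by rewrite A0 // linear0 cE fE -xv linearZ /= tpp (negPf wv) scaler0.
- have [c ->] := tE y; rewrite tfA linear0 fE linearZ /=.
  have [->|uv] := eqVneq u v; first by rewrite xf scaler0.
  by rewrite -xv tfp eq_sym (negPf uv) scaler0.
- by rewrite (gal_oneE gA) (gal_oneE gN).
Qed.

Lemma chain_neq0 (H : G -> Prop) n t M N : chain H n t M N ->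
  (exists x : M, x <> 0) -> exists x : N, x <> 0.
Proof.
elim: n t M => [|n IHn] t M /=; first by move->.
move=> [M' [gM _ [theta rM]] /IHn cN] M0; apply: cN.
exact: (refl_neq0 (@sinkS t) gM rM).
Qed.

Lemma simple_root_nonneg (v : V) : nonneg (simple_root v).
Proof. by move=> u; rewrite ffunE. Qed.

(* x is the image of a hom from a root representation with dimension vector the
   simple root of v, which vanishes by transfer back to time j+1. *)
Lemma chain_hom_vanish n t M N j b v u x : chain triv n t M N -> good rho triv (es (t + n)) N ->
  hits j (t + n) b u -> b (t + n)%N = simple_root v -> (t <= j)%N ->
  tp v x = x -> (forall w, tf v w x = 0 :> N) -> x = 0.
Proof.
move=> cM gN hit_j bv le_tj xv xf; have [ltj uS _ _ _] := hit_j.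
pose k := (t + n - j.+1)%N.
have Hu s : triv s -> av s u = u by move=> ->; apply: actv1.
have [|A cA [gA _ _ dA]] := line_chain (n := k) triv_subgroup Hu hit_j; first by rewrite /k; lia.
have jk : (j.+1 + k = t + n)%N by rewrite /k; lia.
rewrite jk bv in gA dA.
have nE : n = (j - t + k.+1)%N by rewrite /k; lia.
rewrite nE in cM; have [M0 _ [M1 lM cM']] := chain_split cM.
rewrite (subnKC le_tj) in lM cM'.
have [f hf [y <-]] := hom_from_root gA (esP _) dA gN.1 xv xf.
exact: (hom_line_vanish uS lM cM' cA hf).
Qed.

(** If M were nonzero, so would be N, and its support would have a relative sink v, where all
    vectors are killed by the outgoing maps. Traced back, the simple root of v hits a fired vertex
    within [window] steps, hence within the chain, and [chain_hom_vanish] gives a contradiction. *)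
Lemma chain_terminates t M N : good rho triv (es t) M -> chain triv window t M N -> forall x : M, x = 0.
Proof.
move=> gM cM x; apply: contrapT => x0.
have [y y0] := chain_neq0 cM (ex_intro _ x x0).
have gN := chain_good cM gM.
pose T := [set v | `[< exists x : N, tp v x <> 0 >]].
have [|v] := @relative_sink _ h h_gt0 kk_h _ T (esP (t + window)).
  apply/set0Pn; apply: contrapT => nv; apply: y0; rewrite -[y]tp_sum big1 // => v _.
  by apply: contrapT => yv; apply: nv; exists v; rewrite inE; apply/asboolP; exists y.
rewrite inE => /asboolP[z zv] vT; apply: zv.
have [j [b [u [hj bv le_j]]]] := hit nloop h_gt0 kk_h arrP (leq_addl t window)
  (@simple_root_nonneg v) (bform_simple_simple (nloop v)).
apply: (chain_hom_vanish cM gN hj bv) => //; [by lia | exact: tp_idem | move=> w].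
have [vw|nvw] := boolP (es (t + window) v w); last by apply: gN.2.
rewrite -tp_tf; apply: contrapT => nz; have := vT w; rewrite vw inE => /(_ _)/negP[] //.
by apply/asboolP; exists (tf v w (tp v z)).
Qed.

Section OverH.
Variable H : G -> Prop.
Hypothesis subH : subgroup H.

Lemma descend t M : good rho H (es t) M -> tcont H M -> tindec H M ->
  exists n N, [/\ chain H n t M N, good rho H (es (t + n)) N, tcont H N, tindec H N &
    supported N (Ss (t + n))].
Proof.
move=> gM cM indM.
suff step k : (exists n N, [/\ chain H n t M N, good rho H (es (t + n)) N, tcont H N, tindec H N &
    supported N (Ss (t + n))]) \/
    exists N, [/\ chain H k t M N, good rho H (es (t + k)) N, tcont H N & tindec H N].
  have [//|[N [cN _ _ _]]] := step window.
  have [[x x0] _] := indM; case: x0.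
  apply: (@chain_terminates t M N); last by apply: chain_sub cN; apply: triv_sub.
  by apply: good_sub gM; apply: triv_sub.
elim: k => [|k [|[N [cN gN contN indN]]]]; first by right; exists M; rewrite addn0.
  by left.
have [sN|epiN] := indecomposable_dichotomy algL subH gN.1 contN gN.2 (@sinkS _) (fire_av _) indN.
  by left; exists k, N.
have [N' lN] := link_exists subH gN epiN.
right; exists N'; split; first exact: chain_rcons lN.
- by rewrite addnS; case: lN.
- exact: (link_tcont flipE lN contN).
- exact: (link_tindec flipE sinkS fire_av lN indN).
Qed.

(** Induction on the number of reflections that bring M to a representation supported on sinks.
    Whether M' is supported on sinks is read off the common dimension vector, so M' can be reflected
    along with M, and the isomorphism is pulled back. *)
Theorem tdim_tiso t M M' d : good rho H (es t) M -> good rho H (es t) M' ->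
  tcont H M -> tcont H M' -> tindec H M -> tindec H M' -> tdim M d -> tdim M' d -> tiso H M M'.
Proof.
move=> gM gM' cM cM' iM iM' dM dM'.
have [n [N [chM gN cN iN sN]]] := descend gM cM iM.
elim: n t M M' d gM gM' cM cM' iM iM' dM dM' chM gN cN iN sN
  => [|n IHn] t M M' d gM gM' cM cM' iM iM' dM dM' /=.
  move=> eM; subst N; rewrite addn0 => _ _ _ sM.
  have sM' : supported M' (Ss t).
    by move=> v vS x; apply: (tdim_supp _ dM'); apply: (tdim_vanish dM) => y; apply: sM.
  have [v vS simM] := supported_simple algL subH gM.1 cM gM.2 (@sinkS t) iM sM.
  have [v' vS' simM'] := supported_simple algL subH gM'.1 cM' gM'.2 (@sinkS t) iM' sM'.
  have := tdim_unique dM (simple_tdim simM).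
  rewrite (tdim_unique dM' (simple_tdim simM')) => /ffunP/(_ v).
  rewrite !ffunE orb_refl // => -[v'v].
  have vv' : v \in vorb rho H v' by case: (_ \in _) v'v.
  apply: (simple_tiso subH gM.1 gM'.1 _ _ simM).
  - exact: (supported_tf gM.2 (@sinkS t) sM).
  - exact: (supported_tf gM'.2 (@sinkS t) sM').
  - exact: simple_at_orb vv' simM'.
move=> [M1 lM cM1] gN cN iN sN; have [_ gM1 [theta rM]] := lM.
have [sM'|epiM'] := indecomposable_dichotomy algL subH gM'.1 cM' gM'.2 (@sinkS t) (fire_av t) iM'.
  have sM : supported M (Ss t).
    by move=> v vS x; apply: (tdim_supp _ dM); apply: (tdim_vanish dM') => y; apply: sM'.
  have [[x x0] _] := iM; case: x0; rewrite -[x]tp_sum big1 // => v _.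
  have [vS|/sM//] := boolP (v \in Ss t).
  have [z ->] := refl_epi rM x vS; rewrite big1 // => u _.
  exact: (supported_tf gM.2 (@sinkS t) sM).
have [M1' lM'] := link_exists subH gM' epiM'.
apply: (link_tiso sinkS fire_av lM lM').
apply: (IHn t.+1 M1 M1' (srefl (Ss t) d)) => //; rewrite ?addSn -?addnS //.
- by case: lM'.
- exact: (link_tcont flipE lM cM).
- exact: (link_tcont flipE lM' cM').
- exact: (link_tindec flipE sinkS fire_av lM iM).
- exact: (link_tindec flipE sinkS fire_av lM' iM').
- exact: (link_tdim esP flipE sinkS lM dM).
- exact: (link_tdim esP flipE sinkS lM' dM').
Qed.
End OverH.

(** This is [act_root] in coordinates; see [act_rootE]. *)
Definition sact (s : G) a : vec := [ffun v => a (av s^-1%g v)].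
Definition stab a (s : G) : Prop := sact s a = a.

Lemma sactM s t a : sact (s * t)%g a = sact s (sact t a).
Proof. by apply/ffunP => v; rewrite !ffunE invgM actvM. Qed.

Lemma sact1 a : sact 1%g a = a.
Proof. by apply/ffunP => v; rewrite ffunE invg1 actv1. Qed.

Lemma sact_simple s (v : V) : sact s (simple_root v) = simple_root (av s v).
Proof.
by apply/ffunP => u; rewrite !ffunE (can2_eq (avVK rho s) (avK rho s)).
Qed.

Lemma stab_subgroup a : subgroup (stab a).
Proof.
split=> [|s t Hs Ht|s Hs]; rewrite /stab ?sact1 ?sactM //; first by rewrite Ht.
by rewrite -[in LHS]Hs -sactM mulVg sact1.
Qed.

Lemma stab_open a : exists xs, forall s, fixes s xs -> stab a s.
Proof.
have [xs xsP] := actv_nbhs rho; exists xs => s sxs; apply/ffunP => v; rewrite ffunE.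
congr (a _); apply: xsP; exact: (subV (fixes_sub iota xs) sxs).
Qed.

Lemma nedges_av s (u v : V) : nedges (av s u) (av s v) = nedges u v.
Proof. by rewrite !arrP !arr_av. Qed.

Lemma kk_sact s a v : kk (sact s a) v = kk a (av s^-1%g v).
Proof.
rewrite /kk ffunE; congr (_ - _); rewrite -(sum_av rho s); apply: eq_bigr => u _.
by rewrite ffunE avK -{1}(avVK rho s v) nedges_av.
Qed.

Lemma srefl_sact t s a : srefl (Ss t) (sact s a) = sact s (srefl (Ss t) a).
Proof. by apply/ffunP => v; rewrite !ffunE kk_sact -{1}(avVK rho s v) fire_av. Qed.

Lemma nonneg_sact s a : nonneg a -> nonneg (sact s a).
Proof. by move=> a0 v; rewrite ffunE. Qed.

Lemma bform_sact s a : bform (sact s a) (sact s a) = bform a a.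
Proof.
rewrite /bform -(sum_av rho s); apply: eq_bigr => v _.
by rewrite kk_sact ffunE avK.
Qed.

Lemma positive_root_sact s a : is_positive_root a -> is_positive_root (sact s a).
Proof.
move=> [ra a0]; split; last by move=> v; rewrite ffunE.
elim: ra {a0} => [v|v b _ IHb]; first by rewrite sact_simple; apply: is_root_simple.
suff -> : sact s (simple_reflection v b) = simple_reflection (av s v) (sact s b).
  exact: is_root_reflection.
rewrite !simple_reflectionE //; apply/ffunP => u; rewrite !ffunE kk_sact !inE.
by rewrite (can2_eq (avVK rho s) (avK rho s)).
Qed.

Lemma srefl_seq_inj j T (b b' : nat -> vec) i : (j <= i <= T)%N ->
  (forall k, (j <= k < T)%N -> b k.+1 = srefl (Ss k) (b k)) ->
  (forall k, (j <= k < T)%N -> b' k.+1 = srefl (Ss k) (b' k)) ->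
  b T = b' T <-> b i = b' i.
Proof.
move=> iP bS bS'; split=> [bT|bi].
  suff rec k : (k <= T - i)%N -> b (T - k)%N = b' (T - k)%N.
    by have := rec (T - i)%N (leqnn _); rewrite subKn //; lia.
  elim: k => [|k IHk] le_k; first by rewrite subn0.
  have Tk : (T - k = (T - k.+1).+1)%N by lia.
  have := IHk (ltnW le_k); rewrite Tk bS ?bS'; try lia.
  by move/(congr1 (srefl (Ss (T - k.+1)))); rewrite !sreflK.
suff rec k : (k <= T - i)%N -> b (i + k)%N = b' (i + k)%N.
  by have := rec (T - i)%N (leqnn _); rewrite subnKC //; lia.
elim: k => [|k IHk] le_k; first by rewrite addn0.
by rewrite addnS bS ?bS' ?IHk //; lia.
Qed.

Lemma hits_sact j T b u s : hits j T b u -> hits j T (fun i => sact s (b i)) (av s u).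
Proof.
move=> [ltjT uS bj bS bP]; split=> //; first by rewrite fire_av.
- by rewrite bj sact_simple.
- by move=> i /bS ->; rewrite srefl_sact.
- by move=> i /bP[b0 b2]; split; [apply: nonneg_sact | rewrite bform_sact].
Qed.

Lemma simple_root_inj : injective (@simple_root Gamma).
Proof. by move=> u v /ffunP/(_ u); rewrite !ffunE eqxx; case: eqP. Qed.

(** Reflections are injective and commute with the Galois action, so the stabilizer can be computed
    at the time when the root is simple. *)
Lemma hits_stab j T b u s : hits j T b u -> stab (b T) s <-> av s u = u.
Proof.
move=> hb; have [_ _ sbj sbS _] := hits_sact s hb; have [ltjT _ bj bS _] := hb.
have := @srefl_seq_inj j.+1 T (fun i => sact s (b i)) b j.+1 _ sbS bS.
rewrite /stab => ->; last by lia.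
by rewrite sbj bj; split=> [/simple_root_inj|->].
Qed.

(** Otherwise the common sequence, just after time j', is the simple root of a vertex fired at j';
    one step earlier it is negative, although [hits] from j promises a nonnegative vector there. *)
Lemma hits_le j j' T b b' u u' : hits j T b u -> hits j' T b' u' -> b T = b' T -> (j' <= j)%N.
Proof.
move=> [ltjT uS bj bS bP] [ltjT' uS' bj' bS' bP'] bT; rewrite leqNgt; apply/negP => ltj.
have bS1 k : (j'.+1 <= k < T)%N -> b k.+1 = srefl (Ss k) (b k) by move=> lt_k; apply: bS; lia.
have bj1 : b j'.+1 = b' j'.+1 by apply/(srefl_seq_inj _ bS1 bS'); rewrite ?ltjT' ?leqnn.
have := @supported_root_step j' (simple_root u') (@simple_root_nonneg u')
  (bform_simple_simple (nloop u')).
case; first by move=> v vS; rewrite ffunE; case: eqP => // vu; rewrite vu uS' in vS.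
rewrite -bj' -bj1 bS ?sreflK //; last by lia.
by apply: (bP _ _).1; lia.
Qed.

Lemma hits_unique j j' T b b' u u' : hits j T b u -> hits j' T b' u' -> b T = b' T ->
  j = j' /\ u = u'.
Proof.
move=> hb hb' bT; have jj' : j = j'.
  by apply/eqP; rewrite eqn_leq (hits_le hb' hb) // (hits_le hb hb').
split=> //; subst j'; have [ltjT _ bj bS _] := hb; have [_ _ bj' bS' _] := hb'.
apply: simple_root_inj; rewrite -bj -bj'; apply/(srefl_seq_inj _ bS bS') => //.
by rewrite leqnn.
Qed.

Fixpoint refl_iter t n a : vec :=
  if n is n'.+1 then refl_iter t.+1 n' (srefl (Ss t) a) else a.

Lemma chain_tdim (H : G -> Prop) n t M N a : chain H n t M N -> tdim M a -> tdim N (refl_iter t n a).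
Proof.
elim: n t M a => [|n IHn] t M a /=; first by move->.
by move=> [M' lM cM] /(link_tdim esP flipE sinkS lM); apply: IHn.
Qed.

Lemma refl_iter_seq t T (b : nat -> vec) n :
  (forall i, (t <= i < T)%N -> b i.+1 = srefl (Ss i) (b i)) -> (t + n <= T)%N ->
  refl_iter t n (b t) = b (t + n)%N.
Proof.
elim: n t => [|n IHn] t bS le_n /=; first by rewrite addn0.
rewrite -bS; last by lia.
rewrite IHn ?addnS // => [i lt_i|]; first by apply: bS; lia.
by lia.
Qed.

Lemma refl_iter_inj t n : injective (refl_iter t n).
Proof.
elim: n t => [|n IHn] t a b //= /IHn /(congr1 (srefl (Ss t))).
by rewrite !sreflK.
Qed.

Lemma link_ind (H : G -> Prop) t A A' (gA : galois rho H A) (gA' : galois rho H A') :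
  subgroup H -> link H t A A' -> link full t (ind gA) (ind gA').
Proof.
move=> subH [gA1 gA'1 [theta rA]].
(* [ind] takes the proof of [galois] as an argument, so these proofs must be identified first. *)
rewrite (Prop_irrelevance gA gA1.1) (Prop_irrelevance gA' gA'1.1).
split; [exact: ind_good (@arrow_av t) gA1.2 | exact: ind_good (@arrow_av t.+1) gA'1.2 |].
exists (ind_map gA'1.1 gA1.1 (refl_a rA)).
exact: (ind_is_refl subH (fire_av t) (@arrow_av t) gA1 gA'1.1 rA).
Qed.

Lemma chain_ind (H : G -> Prop) n t A A' (gA : galois rho H A) (gA' : galois rho H A') :
  subgroup H -> chain H n t A A' -> chain full n t (ind gA) (ind gA').
Proof.
move=> subH; elim: n t A gA => [|n IHn] t A gA /=.
  by move=> eA; subst A'; rewrite (Prop_irrelevance gA gA').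
move=> [A1 lA cA]; have [_ [gA1 _] _] := lA.
by exists (ind gA1); [apply: link_ind | apply: IHn].
Qed.

Definition orbit_vec u : vec := [ffun w => (w \in vorb rho full u)%:Z].

(** * Induced root representations and their orbits *)

Section Towers.
Variable T : nat.
Hypothesis leT : (window <= T)%N.

Definition root_vec a : Prop := nonneg a /\ bform a a = 2.

(* A arises by reflections from A0, which is simple at u. *)
Definition root_tower a A (gA : galois rho (stab a) A) : Prop :=
  exists j b u A0 (gA0 : good rho (stab a) (es j.+1) A0), [/\ hits j T b u, b T = a,
    chain (stab a) (T - j.+1) j.+1 A0 A, tdim (ind gA0.1) (orbit_vec u) & tdim A0 (b j.+1)].

Lemma root_rep_exists a : root_vec a -> exists A (gA : galois rho (stab a) A),
  [/\ root_rep (stab a) T a A, tindec full (ind gA), tcont full (ind gA) &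
    root_tower gA].
Proof.
move=> [a0 a2]; have [j [b [u [hb bT _]]]] := hit nloop h_gt0 kk_h arrP leT a0 a2.
have subS := stab_subgroup a.
have Hu s : stab a s <-> av s u = u by rewrite -bT; apply: hits_stab hb.
have [ltjT uS bj bS bP] := hb.
have jT : (j.+1 + (T - j.+1) = T)%N by lia.
have [|A cA rA] := line_chain (n := (T - j.+1)%N) subS (fun s => (Hu s).1) hb; first by lia.
rewrite jT bT in rA; have [gA contA _ _] := rA.
have gl : good rho (stab a) (es j.+1) (line u) by apply: line_good => s /Hu.
exists A, gA.1; have cI := chain_ind gl.1 gA.1 subS cA.
have sim : simple_at rho full (ind gl.1) u.
  exact: (ind_simple subS gl.1 Hu (line_simple subS (fun s => (Hu s).1))).
split=> //.
- apply: (chain_tindec flipE sinkS fire_av cI); apply: (simple_tindec full_subgroup) sim.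
  exact: (ind_good gl.1 (@arrow_av j.+1) gl.2).1.
- by apply: ind_tcont => //; apply: stab_open.
- exists j, b, u, (line u), gl; split=> //; first exact: (simple_tdim sim).
  by rewrite bj; apply: line_tdim.
Qed.

(** M is reflected forwards to a representation N that is simple on the orbit of v, at time T1. The
    simple root of v, traced back to time T, is the root sought: its root representation, reflected
    forwards for the same n steps and induced, is N again. *)
Lemma indecomposable_induced M : good rho full (es T) M -> tcont full M -> tindec full M ->
  exists a, [/\ root_vec a, is_root a & exists A (gA : galois rho (stab a) A),
    root_rep (stab a) T a A /\ tiso full M (ind gA)].
Proof.
move=> gM cM iM; have [n [N [cN gN contN iN sN]]] := descend full_subgroup gM cM iM.
have [v vS simN] := supported_simple algL full_subgroup gN.1 contN gN.2 (@sinkS _) iN sN.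
set T1 := (T + n)%N in gN sN vS *.
have leT1 : (window <= T1)%N by rewrite /T1; lia.
have [j [b [u [hb bT _]]]] := hit nloop h_gt0 kk_h arrP leT1 (@simple_root_nonneg v)
  (bform_simple_simple (nloop v)).
have [ltjT uS bj bS bP] := hb.
(* Were the trace from v to stop at time T or later, the component of the generator of N at v would
   vanish by transfer back along the chain from M. *)
have lt_jT : (j < T)%N.
  rewrite ltnNge; apply/negP => le_Tj; have [t [_ tO _]] := simN.
  have [] : tp v t <> 0 by apply/tO/orb_refl/full_subgroup.
  have cN' : chain triv n T M N by apply: chain_sub cN.
  have gN' : good rho triv (es T1) N by apply: good_sub gN.
  apply: (chain_hom_vanish cN' gN' hb bT le_Tj); first exact: tp_idem.
  by move=> w; apply: (supported_tf gN.2 (@sinkS _) sN).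
have bTT1 : (T <= T1)%N by rewrite /T1; lia.
have hb' : hits j T b u by split=> // i lt_i; [apply: bS | apply: bP]; lia.
have [na n2] : nonneg (b T) /\ bform (b T) (b T) = 2 by apply: bP; lia.
exists (b T); split=> //.
  suff rt k : (j.+1 + k <= T)%N -> is_root (b (j.+1 + k)%N).
    by have := rt (T - j.+1)%N; rewrite subnKC //; apply.
  elim: k => [|k IHk] le_k; first by rewrite addn0 bj; apply: is_root_simple.
  by rewrite addnS bS; [apply: is_root_srefl => //; apply: IHk; lia | lia].
have subS := stab_subgroup (b T).
have Hu s : stab (b T) s <-> av s u = u by apply: hits_stab hb'.
have Hv s : stab (b T) s <-> av s v = v.
  rewrite Hu -(hits_stab s hb) bT /stab sact_simple.
  by split=> [/simple_root_inj|->].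
have jT : (j.+1 + (T - j.+1) = T)%N by lia.
have [|A cA rA] := line_chain (n := (T - j.+1)%N) subS (fun s => (Hu s).1) hb; first by lia.
rewrite jT in rA.
(* The root sequence stays nonnegative from T up to T1, so A can be reflected n more steps, to the
   time of N. *)
have [|||A1 cA1 [gA1 contA1 iA1 dA1]] := @root_chain _ T T1 b A n subS _ _ rA.
- by move=> i lt_i; apply: bS; lia.
- by move=> i lt_i; apply: bP; lia.
- by [].
rewrite -/T1 bT in gA1 dA1.
exists A, (root_good rA).1; split=> //.
have cI := chain_ind (root_good rA).1 gA1.1 subS cA1.
have sA1 : supported A1 (Ss T1).
  by move=> w wS x; apply: (tdim_supp _ dA1); rewrite ffunE; case: eqP => // wv; rewrite wv vS in wS.
have iA1' : tindec (stab (b T)) A1 by apply: tindec_sub iA1; apply: triv_sub.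
have [v' v'S simA1] := supported_simple algL subS gA1.1 contA1 gA1.2 (@sinkS _) iA1' sA1.
have vv' : v \in vorb rho (stab (b T)) v'.
  have /ffunP/(_ v) := tdim_unique dA1 (simple_tdim simA1); rewrite !ffunE eqxx.
  by case: (_ \in _).
have {}simA1 := simple_at_orb subS vv' simA1.
have simI := ind_simple subS gA1.1 Hv simA1.
have gI := chain_good cI (ind_good (root_good rA).1 (@arrow_av T) (root_good rA).2).
apply: (chain_tiso sinkS fire_av cN cI).
apply: (simple_tiso full_subgroup gN.1 gI.1 _ _ simN simI).
- exact: (supported_tf gN.2 (@sinkS _) sN).
- apply: (supported_tf gI.2 (@sinkS _)) => w wS x; have [t [_ tO tC]] := simI.
  have [c ->] := tC w x; have /contra_notP -> := (tO w).1; first by rewrite scaler0.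
  rewrite inE => /asboolP[s _ wE]; move: wS; rewrite wE fire_av.
  by rewrite -/T1 vS.
Qed.

Lemma tower_ind_tdim a A (gA : galois rho (stab a) A) : root_tower gA ->
  exists j b u, [/\ hits j T b u, b T = a & tdim (ind gA) (refl_iter j.+1 (T - j.+1) (orbit_vec u))].
Proof.
move=> [j [b [u [A0 [gA0 [hb bT cA dI _]]]]]]; exists j, b, u; split=> //.
exact: chain_tdim (chain_ind gA0.1 gA (stab_subgroup a) cA) dI.
Qed.

(** The bottoms of the two towers induce to simples on the orbit of u, which is also that of s u, so
    the induced representations share a dimension vector. *)
Lemma tower_tiso a s A A' (gA : galois rho (stab a) A) (gA' : galois rho (stab (sact s a)) A') :
  oriented (es T) A -> oriented (es T) A' -> tindec full (ind gA) -> tindec full (ind gA') ->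
  tcont full (ind gA) -> tcont full (ind gA') -> root_tower gA -> root_tower gA' ->
  tiso full (ind gA) (ind gA').
Proof.
move=> oA oA' iA iA' cA cA' /tower_ind_tdim[j [b [u [hb bT dA]]]].
move=> /tower_ind_tdim[j' [b' [u' [hb' bT' dA']]]].
have [jj' uu'] : j = j' /\ av s u = u'.
  by apply: (hits_unique (hits_sact s hb) hb'); rewrite bT bT'.
subst j' u'; have orbE : orbit_vec (av s u) = orbit_vec u.
  apply/ffunP => w; rewrite !ffunE (orb_sub full_subgroup (v := u)) //.
  by rewrite orb_av //; apply: orb_refl.
rewrite orbE in dA'.
exact: (tdim_tiso full_subgroup (ind_good gA (@arrow_av T) oA)
  (ind_good gA' (@arrow_av T) oA') cA cA' iA iA' dA dA').
Qed.

(** Only the equality of dimension vectors is taken from the isomorphism. For j' <= j, at time j.+1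
    the first representation is simple on the orbit of u, so the root of the other tower is
    supported on this set of non-adjacent fired vertices, hence is a simple root there. *)
Lemma tower_orbit a a' A A' (gA : galois rho (stab a) A) (gA' : galois rho (stab a') A') :
  root_tower gA -> root_tower gA' -> tiso full (ind gA) (ind gA') -> exists s, a' = sact s a.
Proof.
move=> tA tA' iso.
have [j [b [u [A0 [gA0 [hb bT cA dI dA0]]]]]] := tA.
have [j' [b' [u' [A0' [gA0' [hb' bT' cA' dI' dA0']]]]]] := tA'.
wlog le_j : a a' A A' gA gA' {tA tA'} iso j b u A0 gA0 hb bT cA dI dA0
    j' b' u' A0' gA0' hb' bT' cA' dI' dA0' /
    (j' <= j)%N.
  move=> wl; have [le_j|/ltnW le_j] := leqP j' j.
    exact: (wl a a' A A' gA gA' iso j b u A0 gA0 hb bT cA dI dA0 j' b' u' A0' gA0').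
  have [s ->] := wl a' a A' A gA' gA (tiso_sym iso) j' b' u' A0' gA0' hb' bT' cA' dI' dA0'
    j b u A0 gA0 hb bT cA dI dA0 le_j.
  by exists s^-1%g; rewrite -sactM mulVg sact1.
have [ltjT uS bj bS bP] := hb; have [ltjT' uS' bj' bS' bP'] := hb'.
have subS' := stab_subgroup a'.
have nE : (T - j'.+1 = (j - j') + (T - j.+1))%N by lia.
rewrite nE in cA'; have [A1 c1 c2] := chain_split cA'.
have jE : (j'.+1 + (j - j') = j.+1)%N by lia.
rewrite jE in c2.
have gA1 := chain_good c1 gA0'.
have dA1 := chain_tdim c1 dA0'; rewrite (@refl_iter_seq _ T) ?jE // in dA1.
have cI1 := chain_ind gA0'.1 gA1.1 subS' c1; have cI2 := chain_ind gA1.1 gA' subS' c2.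
have cI := chain_ind gA0.1 gA (stab_subgroup a) cA.
have dI1 := chain_tdim cI1 dI'.
(* The reflections from j.+1 to T are injective on dimension vectors and can be stripped. *)
have /refl_iter_inj DE := tdim_unique (tdim_iso iso (chain_tdim cI dI)) (chain_tdim cI2 dI1).
rewrite -DE in dI1.
have suppA1 v : v \notin vorb rho full u -> b' j.+1 v = 0.
  move=> vO; apply: (tdim_vanish dA1); apply: (ind_supp subS' (gA := gA1.1)) => x.
  by apply: (tdim_supp _ dI1); rewrite ffunE (negPf vO).
have OS w : w \in vorb rho full u -> w \in Ss j.
  by rewrite inE => /asboolP[s _ ->]; rewrite fire_av.
have [b0 b2] : nonneg (b' j.+1) /\ bform (b' j.+1) (b' j.+1) = 2 by apply: bP'; lia.
have [|w wS bw] := indep_root nloop h_gt0 kk_h b0 b2 (@indepS j).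
  by move=> v vS; apply: suppA1; apply: contra vS; apply: OS.
have : w \in vorb rho full u.
  by apply: contraT => /suppA1; rewrite bw ffunE eqxx.
rewrite inE => /asboolP[s _ wE]; exists s.
have [_ _ sbj sbS _] := hits_sact s hb.
have bS1 k : (j.+1 <= k < T)%N -> b' k.+1 = srefl (Ss k) (b' k) by move=> lt_k; apply: bS'; lia.
rewrite -bT' -bT; have jj : (j.+1 <= j.+1 <= T)%N by rewrite leqnn.
by apply/(srefl_seq_inj (b' := fun i => sact s (b i)) jj bS1 sbS); rewrite bw sbj wE.
Qed.

End Towers.
End Classification.

(** * Rational representations as total spaces *)

Section TotalSpace.
Variables (K L : fieldType) (iota : {rmorphism K -> L}) (Gamma : quiver).
Variable rho : rational_structure iota Gamma.
Local Notation V := (vert Gamma).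
Local Notation G := (Gal iota).
Local Notation av := (actv rho).
Local Notation trep := (trep iota Gamma).

Section Product.
Variable M : V -> lmodType L.
Definition dprod : Type := forall v, M v.
HB.instance Definition _ := gen_eqMixin dprod.
HB.instance Definition _ := gen_choiceMixin dprod.

Lemma dprod_ext (x y : dprod) : (forall v, x v = y v) -> x = y.
Proof. exact: functional_extensionality_dep. Qed.

Definition dprod_zero : dprod := fun v => 0.
Definition dprod_add (x y : dprod) : dprod := fun v => x v + y v.
Definition dprod_opp (x : dprod) : dprod := fun v => - x v.
Definition dprod_scale c (x : dprod) : dprod := fun v => c *: x v.

Lemma dprod_addA : associative dprod_add.
Proof. by move=> x y z; apply: dprod_ext => v; apply: addrA. Qed.
Lemma dprod_addC : commutative dprod_add.
Proof. by move=> x y; apply: dprod_ext => v; apply: addrC. Qed.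
Lemma dprod_add0 : left_id dprod_zero dprod_add.
Proof. by move=> x; apply: dprod_ext => v; apply: add0r. Qed.
Lemma dprod_addN : left_inverse dprod_zero dprod_opp dprod_add.
Proof. by move=> x; apply: dprod_ext => v; apply: addNr. Qed.
HB.instance Definition _ := GRing.isZmodule.Build dprod
  dprod_addA dprod_addC dprod_add0 dprod_addN.

Lemma dprod_scaleA c d x : dprod_scale c (dprod_scale d x) = dprod_scale (c * d) x.
Proof. by apply: dprod_ext => v; apply: scalerA. Qed.
Lemma dprod_scale1 : left_id 1 dprod_scale.
Proof. by move=> x; apply: dprod_ext => v; apply: scale1r. Qed.
Lemma dprod_scaleDr : right_distributive dprod_scale +%R.
Proof. by move=> c x y; apply: dprod_ext => v; apply: scalerDr. Qed.
Lemma dprod_scaleDl x : {morph dprod_scale^~ x : c d / c + d}.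
Proof. by move=> c d; apply: dprod_ext => v; apply: scalerDl. Qed.
HB.instance Definition _ := GRing.Zmodule_isLmodule.Build L dprod
  dprod_scaleA dprod_scale1 dprod_scaleDr dprod_scaleDl.

Lemma dprodD (x y : dprod) v : (x + y) v = x v + y v. Proof. by []. Qed.
Lemma dprodZ c (x : dprod) v : (c *: x) v = c *: x v. Proof. by []. Qed.
Lemma dprod_sum I (r : seq I) (P : pred I) (F : I -> dprod) v :
  (\sum_(i <- r | P i) F i) v = \sum_(i <- r | P i) F i v.
Proof. by elim/big_rec2: _ => // i y x _ <-. Qed.

Definition single v (m : M v) : dprod := fun w =>
  if eqVneq v w is EqNotNeq vw then ecast w (M w) vw m else 0.

Lemma single_same v m : single m v = m.
Proof.
rewrite /single; case: eqVneq => [vv|/eqP//].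
by rewrite (Prop_irrelevance vv erefl).
Qed.

Lemma single_other v (m : M v) w : v != w -> single m w = 0.
Proof. by rewrite /single; case: eqVneq. Qed.

Lemma single_linear v : linear (@single v).
Proof.
move=> c x y; apply: dprod_ext => w; rewrite dprodD dprodZ.
have [<-|vw] := eqVneq v w; first by rewrite !single_same.
by rewrite !single_other // scaler0 addr0.
Qed.

Lemma single_at v (x : dprod) : (forall w, w != v -> x w = 0) -> single (x v) = x.
Proof.
move=> x0; apply: dprod_ext => w; have [<-|vw] := eqVneq v w; first by rewrite single_same.
by rewrite single_other // x0 // eq_sym.
Qed.
End Product.

HB.instance Definition _ (M : V -> lmodType L) v := GRing.isLinear.Build L (M v) (dprod M) *:%R
  (@single M v) (@single_linear M v).

Definition arr : rel V := [rel u v | [exists e : edge Gamma, (src e == u) && (tgt e == v)]].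
Hypothesis edge_inj : forall e e' : edge Gamma, src e = src e' -> tgt e = tgt e' -> e = e'.

Section ToTotal.
Variables (F : L -> Prop) (M : rat_rep rho F).
Local Notation H := (@gal_over K L iota F).
Local Notation T := (dprod M).

Lemma gal_over_subgroup : subgroup H.
Proof.
split=> [x//|s t Hs Ht x Fx|s Hs x Fx]; first by rewrite /= Ht // Hs.
by rewrite -{1}(Hs _ Fx); apply: gal_invK.
Qed.

Lemma total_p_linear v : linear (fun x : T => single (x v)).
Proof. by move=> c x y; rewrite dprodD dprodZ linearP. Qed.
Definition total_p v : {linear T -> T} := mklin (@total_p_linear v).

Lemma total_f_linear u v : linear (fun x : T =>
  \sum_(e : edge Gamma | (src e == u) && (tgt e == v)) single (emap M e (x (src e)))).
Proof.
move=> c x y; rewrite scaler_sumr -big_split; apply: eq_bigr => e _ /=.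
by rewrite dprodD dprodZ !linearP.
Qed.
Definition total_f u v : {linear T -> T} := mklin (@total_f_linear u v).

(** Here [edge_inj] enters: [total_f] only sees the sum over parallel edges, which consists of a
    single edge. *)
Lemma total_fE e x : total_f (src e) (tgt e) x = single (emap M e (x (src e))).
Proof.
rewrite /= (bigD1 e) ?eqxx //= big1 ?addr0 // => e' /andP[/andP[/eqP se /eqP te]].
by move=> /eqP[]; apply: edge_inj.
Qed.

Lemma total_f0 u v x : ~~ arr u v -> total_f u v x = 0.
Proof.
move=> nuv /=; rewrite big1 // => e euv; case/negP: nuv; apply/existsP.
by exists e.
Qed.

Lemma total_f_at u v w x : w != v -> total_f u v x w = 0.
Proof.
move=> wv; rewrite /= dprod_sum big1 // => e /andP[_ /eqP te].
by rewrite single_other // te eq_sym.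
Qed.

Definition total_a (s : G) (x : T) : T :=
  if pselect (H s) is left Fs
  then \sum_v single (semi M Fs (erefl (av s v)) (x v)) else x.

Lemma total_aE s (Fs : H s) x v w (vw : av s v = w) : total_a s x w = semi M Fs vw (x v).
Proof.
case: _ / vw; rewrite /total_a; case: pselect => // Fs'; rewrite (Prop_irrelevance Fs' Fs).
rewrite dprod_sum (bigD1 v) //= single_same big1 ?addr0 // => u uv.
by rewrite single_other // (inj_eq (@av_inj _ _ _ _ rho s)).
Qed.

Lemma total_pp u v x : total_p u (total_p v x) = if u == v then total_p v x else 0.
Proof.
rewrite /=; have [->|uv] := eqVneq u v; first by rewrite single_same.
by rewrite single_other ?linear0 // eq_sym.
Qed.

Lemma total_p_sum x : \sum_v total_p v x = x.
Proof.
apply: dprod_ext => w; rewrite dprod_sum (bigD1 w) //= single_same big1 ?addr0 // => v vw.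
by rewrite single_other.
Qed.

Lemma total_pf u v w x : total_p w (total_f u v x) = if w == v then total_f u v x else 0.
Proof.
have [->|wv] := eqVneq w v; first by apply: single_at => w' /total_f_at ->.
by rewrite [LHS]/= [X in single X]total_f_at // linear0.
Qed.

Lemma total_fp u v w x : total_f u v (total_p w x) = if w == u then total_f u v x else 0.
Proof.
rewrite /=; have [->|wu] := eqVneq w u.
  by apply: eq_bigr => e /andP[/eqP <- _]; rewrite single_same.
by rewrite big1 // => e /andP[/eqP se _]; rewrite single_other ?se // !linear0.
Qed.

Definition total : trep := TRep total_a total_pp total_p_sum total_pf total_fp.

Lemma ta_totalE s (Fs : H s) (x : total) v w (vw : av s v = w) :
  (ta s x : T) w = semi M Fs vw ((x : T) v).
Proof. exact: total_aE. Qed.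

Lemma single_semi s (Fs : H s) v w (vw : av s v = w) (m : M v) :
  single (semi M Fs vw m) = total_a s (single m).
Proof.
rewrite -[RHS](@single_at M w) => [|w' ww']; first by rewrite (total_aE Fs _ vw) single_same.
rewrite (total_aE Fs _ (avVK rho s w')) single_other ?linear0 //.
by apply: contraNneq ww' => vE; rewrite -vw vE avVK.
Qed.

Lemma total_galois : galois rho H total.
Proof.
split.
- move=> s Hs c x y; apply: dprod_ext => w; rewrite dprodD dprodZ.
  by rewrite !(ta_totalE Hs _ (avVK rho s w)) dprodD dprodZ linearP.
- move=> s t Hs Ht x; apply: dprod_ext => w.
  have Hst := subM gal_over_subgroup Hs Ht.
  have tw : av t (av (s * t)^-1%g w) = av s^-1%g w by rewrite invgM actvM avVK.
  rewrite (ta_totalE Hst _ (avVK rho (s * t)%g w)) (ta_totalE Hs _ (avVK rho s w)).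
  rewrite (ta_totalE Ht _ tw).
  exact/esym/semiM.
- move=> x; apply: dprod_ext => w; rewrite (ta_totalE (sub1 gal_over_subgroup) _ (actv1 rho w)).
  exact: semi_id.
- move=> s Hs v x; rewrite /= -(single_semi Hs erefl); congr single.
  by rewrite (total_aE Hs _ erefl).
- move=> s Hs u v x; have [/existsP[e /andP[/eqP <- /eqP <-]]|nuv] := boolP (arr u v); last first.
    have nuv' : ~~ arr (av s u) (av s v).
      apply: contra nuv => /existsP[e /andP[/eqP se /eqP te]]; apply/existsP.
      by exists (acte rho s^-1%g e); rewrite src_act tgt_act se te !avK !eqxx.
    rewrite [tf _ _ x]total_f0 // [RHS]total_f0 //.
    apply: dprod_ext => w; rewrite (ta_totalE Hs _ (avVK rho s w)) linear0.
    by [].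
  rewrite [tf _ _ x]total_fE -(src_act rho) -(tgt_act rho) [RHS]total_fE.
  rewrite (ta_totalE Hs _ (esym (src_act rho s e))).
  rewrite (emap_semi Hs _ (esym (tgt_act rho s e))).
  by rewrite (single_semi Hs).
Qed.

Lemma total_oriented : oriented arr total.
Proof. by move=> u v x /total_f0 ->. Qed.

End ToTotal.
Section Compare.
Variable F : L -> Prop.
Local Notation H := (@gal_over K L iota F).
Implicit Types (M N : rat_rep rho F).

Lemma ta_single M s (Fs : H s) v w (vw : av s v = w) (m : M v) :
  ta s (single m : total M) = single (semi M Fs vw m).
Proof. by rewrite (single_semi Fs). Qed.

Lemma tf_single M e (m : M (src e)) :
  tf (src e) (tgt e) (single m : total M) = single (emap M e m).
Proof. by rewrite [LHS]total_fE single_same. Qed.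

Lemma tp_single M v (m : M v) : tp v (single m : total M) = single m.
Proof. by rewrite /= single_same. Qed.

Lemma sum_single M (x : dprod M) : \sum_v single (x v) = x.
Proof. exact: (tp_sum (t := total M)). Qed.

Lemma single_inj M v : injective (@single M v).
Proof. by move=> m n mn; rewrite -[m]single_same mn single_same. Qed.

Lemma rep_iso_total M N : rep_iso M N <-> tiso H (total M) (total N).
Proof.
split=> [[f [fbij femap fsemi]]|[phi [psi [hphi hpsi phiK psiK]]]].
  have gex v : exists g : N v -> M v, cancel (f v) g /\ cancel g (f v).
    by case: (fbij v) => g; exists g.
  pose g v := projT1 (cid (gex v)).
  have gK v : cancel (f v) (g v) /\ cancel (g v) (f v) by rewrite /g; case: cid.
  have lin_f : linear (fun x : dprod M => (fun v => f v (x v)) : dprod N).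
    by move=> c x y; apply: dprod_ext => v; rewrite dprodD dprodZ dprodD dprodZ linearP.
  have lin_g : linear (fun x : dprod N => (fun v => g v (x v)) : dprod M).
    move=> c x y; apply: dprod_ext => v; apply: (can_inj (gK v).1).
    by rewrite dprodD dprodZ (gK v).2 linearP !(gK v).2.
  pose phi : {linear total M -> total N} := mklin lin_f.
  pose psi : {linear total N -> total M} := mklin lin_g.
  have phi_single v (m : M v) : phi (single m) = single (f v m).
    apply: dprod_ext => w /=; have [<-|vw] := eqVneq v w; first by rewrite !single_same.
    by rewrite !single_other // linear0.
  have phiK : cancel phi psi by move=> x; apply: dprod_ext => v; apply: (gK v).1.
  have psiK : cancel psi phi by move=> x; apply: dprod_ext => v; apply: (gK v).2.
  have hphi : hom H phi.
    split=> [v x|u v x|s Hs x]; first exact: phi_single.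
      have [/existsP[e /andP[/eqP <- /eqP <-]]|nuv] := boolP (arr u v); last first.
        by rewrite [tf u v x]total_f0 // [tf u v _]total_f0 // linear0.
      by rewrite [tf _ _ x]total_fE [tf _ _ _]total_fE phi_single femap.
    apply: dprod_ext => w; rewrite (ta_totalE Hs _ (avVK rho s w)) -fsemi.
    by rewrite -(ta_totalE Hs _ (avVK rho s w)).
  exact: (tiso_intro hphi phiK psiK).
have lin_f v : linear (fun m : M v => (phi (single m) : dprod N) v).
  by move=> c x y; rewrite !linearP.
have phi_single v (m : M v) : phi (single m) = single ((phi (single m) : dprod N) v).
  by rewrite -{1}(tp_single m) (hom_p hphi).
have psi_single v (m : N v) : psi (single m) = single ((psi (single m) : dprod M) v).
  by rewrite -{1}(tp_single m) (hom_p hpsi).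
exists (fun v => mklin (lin_f v)); split=> [v|e m|s Fs v w vw m] /=.
- exists (fun m => (psi (single m) : dprod M) v) => m /=.
    by rewrite -phi_single phiK single_same.
  by rewrite -psi_single psiK single_same.
- rewrite -tf_single (hom_f hphi) phi_single tf_single !single_same.
  by [].
- rewrite -(ta_single Fs) (hom_a hphi) // phi_single (ta_single Fs vw) !single_same.
  by [].
Qed.

Lemma tcont_total M : rep_continuous M <-> tcont H (total M).
Proof.
split=> [cM x|cM v m].
  have [|xs xsP] := @finite_nbhs _ _ iota Gamma H (fun v s =>
    exists (Fs : H s) (vv : av s v = v), semi M Fs vv ((x : dprod M) v) = (x : dprod M) v).
    move=> v; have [xs xsP] := cM v ((x : dprod M) v); exists xs => s Hs sxs.
    exact: xsP.
  exists xs => s Hs sxs; apply: dprod_ext => w.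
  have [Fs [vv xw]] := xsP s Hs sxs w.
  by rewrite (ta_totalE Fs _ vv).
have [xs xsP] := cM (single m); have [ys ysP] := actv_nbhs rho.
exists (xs ++ ys) => s Hs sP.
have [sxs sys] := fixes_cat sP; have vv : av s v = v by apply: ysP.
exists Hs, vv; apply: single_inj; rewrite -(ta_single Hs).
exact: xsP.
Qed.

Lemma hom_single_ker M N (g : {linear total M -> total N}) : hom H g -> exists U : subrep M,
  forall v (m : M v), U v m = (g (single m) = 0).
Proof.
move=> hg; have U4 e (m : M (src e)) : g (single m) = 0 -> g (single (emap M e m)) = 0.
  by rewrite -tf_single (hom_f hg) => ->; rewrite linear0.
have U5 s (Fs : H s) v w (vw : av s v = w) (m : M v) :
    g (single m) = 0 -> g (single (semi M Fs vw m)) = 0.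
  by rewrite -(ta_single Fs) (hom_a hg) // => ->; rewrite (ta0 (total_galois N)).
have [U1 U2 U3] : [/\ forall v, g (single (0 : M v)) = 0,
    forall v (x y : M v), g (single x) = 0 -> g (single y) = 0 -> g (single (x + y)) = 0
    & forall v c (x : M v), g (single x) = 0 -> g (single (c *: x)) = 0].
  split=> [v|v x y gx gy|v c x gx]; first by rewrite !linear0.
    by rewrite !linearD gx gy addr0.
  by rewrite !linearZ /= gx scaler0.
by exists (SubRep U1 U2 U3 U4 U5).
Qed.

(** An idempotent f splits M into the kernels of id - f and of f; conversely the summands of M are
    stable subspaces of the total space, to which [tindec_splits] applies. *)
Lemma indecomposable_total M : indecomposable M <-> tindec H (total M).
Proof.
split=> [[[v [m m0]] ind]|[[x x0] ind]].
  split; first by exists (single m) => sm0; apply: m0; rewrite -[m]single_same sm0.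
  move=> f hf ff; pose g : {linear total M -> total M} := (idfun \- f).
  have hg : hom H g := homB (total_galois M) (hom_id _ _) hf.
  have fs w (n : M w) : f (single n) = single ((f (single n) : dprod M) w).
    by rewrite -{1}(tp_single n) (hom_p hf).
  have [U UE] := hom_single_ker hg; have [W WE] := hom_single_ker hf.
  have fU w (n : M w) : U w ((f (single n) : dprod M) w).
    by rewrite UE /= -fs ff subrr.
  have gW w (n : M w) : W w (n - (f (single n) : dprod M) w).
    by rewrite WE !linearB /= -fs ff subrr.
  have [|U0|W0] := ind U W.
  - move=> w; split=> n; last first.
      rewrite UE WE /= => + fn; rewrite fn subr0 => n0.
      by rewrite -[n]single_same n0.
    by exists ((f (single n) : dprod M) w), (n - (f (single n) : dprod M) w); split; rewrite // addrC subrK.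
  - by left=> x; rewrite -[x]sum_single linear_sum big1 // => w _; rewrite fs (U0 _ _ (fU _ _)) linear0.
  - right=> x; rewrite -[x]sum_single linear_sum; apply: eq_bigr => w _.
    by apply/eqP; rewrite -subr_eq0 -oppr_eq0 opprB fs -linearB (W0 _ _ (gW _ _)) linear0.
split.
  have [w xw] : exists w, (x : dprod M) w <> 0.
    apply: contrapT => nw; apply: x0; apply: dprod_ext => w.
    by apply: contrapT => xw; apply: nw; exists w.
  by exists w, ((x : dprod M) w).
move=> U W UW.
have stab (X : subrep M) : stable H (M := total M) (fun y : dprod M => forall v, X v (y v)).
  split; first split=> [v|y z yX zX v|c y yX v].
  - exact: sub_mem0.
  - exact: sub_memD.
  - exact: sub_memZ.
  - move=> v y yX w; rewrite /=; have [<-|vw] := eqVneq v w; first by rewrite single_same.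
    by rewrite single_other //; apply: sub_mem0.
  - move=> s y Hs yX w; rewrite (ta_totalE Hs _ (avVK rho s w)).
    exact: sub_mem_semi.
have stabf (X : subrep M) u v (y : total M) : (forall w, X w ((y : dprod M) w)) ->
    forall w, X w ((tf u v y : dprod M) w).
  move=> yX w; rewrite /= dprod_sum; elim/big_rec: _ => [|e z _ zX]; first exact: sub_mem0.
  apply: sub_memD => //; have [<-|vw] := eqVneq (tgt e) w.
    by rewrite single_same; apply: sub_mem_emap.
  by rewrite single_other //; apply: sub_mem0.
have memS (X : subrep M) v (m : M v) w : X v m -> X w ((single m : dprod M) w).
  move=> mX; have [<-|vw] := eqVneq v w; first by rewrite single_same.
  by rewrite single_other //; apply: sub_mem0.
have sUW : splits H (M := total M) (fun y : dprod M => forall v, U v (y v))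
    (fun y : dprod M => forall v, W v (y v)).
  split=> // [y yU yW|y].
    by apply: dprod_ext => v; apply: (UW v).2.
  have yz v : exists yz : M v * M v, [/\ U v yz.1, W v yz.2 & (y : dprod M) v = yz.1 + yz.2].
    by have [y1 [y2 [Uy1 Wy2 ->]]] := (UW v).1 ((y : dprod M) v); exists (y1, y2).
  exists (fun v => (projT1 (cid (yz v))).1), (fun v => (projT1 (cid (yz v))).2).
  split=> [v|v|]; first by case: cid => ? [].
    by case: cid => ? [].
  by apply: dprod_ext => v; rewrite dprodD; case: cid => ? [].
have [|||U0|W0] := tindec_splits (total_galois M) _ sUW;
  [by split; [exists x | exact: ind] | exact: stabf | exact: stabf | left | right].
  by move=> v m mU; apply: single_inj; rewrite linear0; apply: U0 => w; exact: memS.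
by move=> v m mW; apply: single_inj; rewrite linear0; apply: W0 => w; exact: memS.
Qed.

Lemma tdim_total M a : has_dimension_vector M a <-> tdim (total M) a.
Proof.
split=> dM v.
  have [n [aE [f fP]]] := dM v; exists n; split=> //.
  have lin_g : linear (fun y => single (f y)) by move=> c x y; rewrite !linearP.
  exists (mklin lin_g) => [x y /= /single_inj|x]; first by move/(bij_inj fP).
  case: fP => g fK gK; split=> [<-|[y ->]]; last exact: tp_single.
  by exists (g ((x : dprod M) v)); rewrite /= gK.
have [n [aE [f fI fP]]] := dM v; exists n; split=> //.
have fE y : f y = single ((f y : dprod M) v).
  have /fP E : exists z, f y = f z by exists y.
  by rewrite -[LHS]E.
have lin_g : linear (fun y => (f y : dprod M) v) by move=> c x y; rewrite linearP.
have ex (m : M v) : exists y, (single m : total M) = f y by apply/fP; rewrite tp_single.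
exists (mklin lin_g), (fun m => projT1 (cid (ex m))) => [y|m] /=; case: cid => z /=.
  by rewrite -fE => /fI.
by move=> <-; rewrite single_same.
Qed.
End Compare.

Section FromTotal.
Variables (F : L -> Prop) (A : trep).
Local Notation H := (@gal_over K L iota F).
Hypothesis gA : good rho H arr A.

Definition part_space v : lmodType L := subspace (at_submod A v).

Lemma part_semi_subproof s (Fs : H s) v w (vw : av s v = w) (x : part_space v) :
  tp w (ta s (subval x)) = ta s (subval x).
Proof. by rewrite -vw -(gal_tp gA.1) // (subvalP x). Qed.
Definition part_semi_fun s (Fs : H s) v w (vw : av s v = w) (x : part_space v) : part_space w :=
  Subspace (at_submod A w) (part_semi_subproof Fs vw x).
Lemma part_semi_linear s (Fs : H s) v w (vw : av s v = w) :
  linear_for ((s : L -> L) \; *:%R) (part_semi_fun Fs vw).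
Proof. by move=> c x y; apply: subval_inj; rewrite /= (gal_lin gA.1). Qed.
Definition part_semi s (Fs : H s) v w (vw : av s v = w) :
  {linear part_space v -> part_space w | (s : L -> L) \; *:%R} :=
  HB.pack (part_semi_fun Fs vw)
    (GRing.isLinear.Build L (part_space v) (part_space w) _ _ (part_semi_linear Fs vw)).

Lemma part_emap_subproof e (x : A) : tp (src e) x = x ->
  tp (tgt e) (tf (src e) (tgt e) x) = tf (src e) (tgt e) x.
Proof. by rewrite tp_tf. Qed.
Definition part_emap e : {linear part_space (src e) -> part_space (tgt e)} :=
  sub_map _ _ (@part_emap_subproof e).

Definition part : rat_rep rho F.
Proof.
exists part_space part_semi part_emap.
- move=> s Fs v w vw; have sH := gal_over_subgroup F.
  have Fs' : H s^-1%g := subV sH Fs.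
  have wv : av s^-1%g w = v by rewrite -vw avK.
  exists (part_semi Fs' wv) => x; apply: subval_inj; rewrite /=.
    exact: (taK gA.1 sH).
  exact: (taVK gA.1 sH).
- move=> s t Fs Ft Fst u v w uv vw uw x; apply: subval_inj; rewrite /=.
  by rewrite (gal_mulE gA.1).
- move=> s Fs e hs ht x; apply: subval_inj; rewrite /=.
  by rewrite (gal_tf gA.1) // src_act tgt_act.
Defined.

Lemma total_part : tiso H (total part) A.
Proof.
have lin_f : linear (fun x : dprod part => \sum_v subval (x v)).
  move=> c x y; rewrite scaler_sumr -big_split; apply: eq_bigr => v _.
  by rewrite dprodD dprodZ linearP.
have lin_g : linear (fun a : A => (fun v => Subspace (at_submod A v) (tp_idem v a)) : dprod part).
  by move=> c x y; apply: dprod_ext => v; apply: subval_inj; rewrite /= linearP.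
pose phi : {linear total part -> A} := mklin lin_f.
pose psi : {linear A -> total part} := mklin lin_g.
have tp_phi v (x : dprod part) : tp v (phi x) = subval (x v).
  rewrite /= linear_sum (bigD1 v) //= (subvalP (x v)) big1 ?addr0 // => w wv.
  by rewrite -(subvalP (x w)) tpp eq_sym (negPf wv).
have phi_single v (m : part v) : phi (single m) = subval m.
  rewrite /= (bigD1 v) //= single_same big1 ?addr0 // => w wv.
  by rewrite single_other 1?eq_sym // linear0.
have phiK : cancel phi psi.
  by move=> x; apply: dprod_ext => v; apply: subval_inj; rewrite /= -[RHS]tp_phi.
have psiK : cancel psi phi by move=> a; rewrite /= tp_sum.
have hphi : hom H phi.
  split=> [v x|u v x|s Hs x].
  - by rewrite tp_phi -phi_single.
  - have [/existsP[e /andP[/eqP <- /eqP <-]]|nuv] := boolP (arr u v); last first.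
      by rewrite [tf u v x]total_f0 // linear0 gA.2.
    rewrite [tf _ _ x]total_fE phi_single /= -tp_phi.
    exact: tf_tp.
  - apply: tp_ext => w; rewrite tp_phi (ta_totalE Hs _ (avVK rho s w)) /=.
    by rewrite -tp_phi (gal_tp gA.1) // avVK.
exact: (tiso_intro hphi phiK psiK).
Qed.
End FromTotal.

Section Restriction.
Variables (F : L -> Prop) (N : rat_rep rho F).
Local Notation H := (@gal_over K L iota F).

Lemma gal_over_base s : @gal_over K L iota (base_field iota) s.
Proof. by move=> _ [a ->]; apply: gal_fix. Qed.

Lemma gal_over_baseE : @gal_over K L iota (base_field iota) = full.
Proof. by apply/funext => s; apply/propext; split=> // _; apply: gal_over_base. Qed.

Local Notation RN := (restriction_of_scalars N).
Local Notation IN := (ind (total_galois N)).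

Lemma res_transport (x : dprod RN) g w v v' (e : av g w = v) (e' : av g w = v') :
  (x v : res_space N v) g w e = (x v' : res_space N v') g w e'.
Proof. by case: _ / e; case: _ / e'. Qed.

(** Evaluated at g, a family indexed by vertices becomes one vector of the total space, whose
    component at w comes from the space at the vertex g w. *)
Lemma res_to_ind_subproof (x : dprod RN) :
  ind_compat (A := total N) H (fun g => (fun w => (x (av g w) : res_space N _) g w erefl) : dprod N).
Proof.
move=> g k Hk; apply: dprod_ext => w; rewrite (ta_totalE Hk _ (avVK rho k w)).
have E : av g w = av (g * k)%g (av k^-1%g w) by rewrite actvM avVK.
rewrite (resP _ Hk _ _ E); exact: res_transport.
Qed.

Lemma res_to_ind_linear : linear (fun x : dprod RN => IndSpace (res_to_ind_subproof x) : IN).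
Proof. by move=> c x y; apply: ind_ext => g; apply: dprod_ext => w. Qed.
Definition res_to_ind : {linear total RN -> IN} := mklin res_to_ind_linear.

Lemma ind_to_res_subproof (y : IN) v :
  res_compatible (fun g w (_ : av g w = v) => (y g : dprod N) w).
Proof. by move=> g k Hk w w' e e' e''; rewrite -(indP y g Hk) (ta_totalE Hk _ e'). Qed.

Lemma ind_to_res_linear : linear (fun y : IN =>
  (fun v => ResSpace (ind_to_res_subproof y (v := v))) : dprod RN).
Proof. by move=> c x y; apply: dprod_ext => v; apply: res_ext. Qed.
Definition ind_to_res : {linear IN -> total RN} := mklin ind_to_res_linear.

Lemma tp_at F' (M : rat_rep rho F') u (x : total M) w :
  (tp u x : dprod M) w = if u == w then (x : dprod M) w else 0.
Proof. by rewrite /=; have [<-|uw] := eqVneq u w; rewrite ?single_same // single_other. Qed.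

Lemma single_res v (m : RN v) g w (e : av g w = v) :
  ((single m : dprod RN) (av g w) : res_space N _) g w erefl = (m : res_space N v) g w e.
Proof. by case: _ / e m => m; rewrite single_same. Qed.

Lemma emap_at_single e w (te : tgt e = w) (y : N (src e)) :
  emap_at erefl te y = (single (emap N e y) : dprod N) w.
Proof. by case: _ / te; rewrite single_same. Qed.

Lemma res_to_ind_hom : hom full res_to_ind.
Proof.
split=> [v x|u v x|s _ x]; apply: ind_ext => g; apply: dprod_ext => w.
- apply: etrans _ (esym (tp_at (M := N) (av g^-1%g v) (res_to_ind x g) w)).
  have -> : (av g^-1%g v == w) = (v == av g w).
    by rewrite -{1}(avK rho g w) (inj_eq (@av_inj _ _ _ _ rho g^-1%g)).
  rewrite /=.
  have [vw|vw] := eqVneq v (av g w); first by subst v; rewrite single_same.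
  by rewrite single_other.
- have [/existsP[e /andP[/eqP <- /eqP <-]]|nuv] := boolP (arr u v); last first.
    have nuv' : ~~ arr (av g^-1%g u) (av g^-1%g v).
      apply: contra nuv => /existsP[e /andP[/eqP se /eqP te]]; apply/existsP.
      by exists (acte rho g e); rewrite src_act tgt_act se te !avVK !eqxx.
    have E1 : tf u v x = 0 by apply: total_f0.
    have E2 : tf (av g^-1%g u) (av g^-1%g v) (res_to_ind x g) = 0 by apply: total_f0.
    by rewrite E1 linear0; apply: (congr1 (fun y : dprod N => y w) (esym E2)).
  have E1 : tf (src e) (tgt e) x = single (emap RN e ((x : dprod RN) (src e))).
    exact: total_fE.
  pose e' := acte rho g^-1%g e.
  have E2 : tf (av g^-1%g (src e)) (av g^-1%g (tgt e)) (res_to_ind x g) =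
      single (emap N e' ((res_to_ind x g : dprod N) (src e'))).
    by rewrite -(src_act rho) -(tgt_act rho); apply: total_fE.
  rewrite E1; apply: etrans _ (congr1 (fun y : dprod N => y w) (esym E2)).
  have [ew|/eqP ew] := pselect (av g w = tgt e); last first.
    rewrite [RHS]single_other.
      by rewrite [LHS](_ : _ =
        ((single (emap RN e ((x : dprod RN) (src e))) : dprod RN) (av g w) : res_space N _) g w erefl)
        // single_other // eq_sym.
    by apply: contra ew => /eqP <-; rewrite tgt_act avVK.
  apply: etrans (single_res _ ew) _; apply: etrans (emap_at_single _ _) _.
  by congr ((single (emap N _ _) : dprod N) w); apply: res_transport.
- have E := ta_totalE (gal_over_base s) x (avVK rho s (av g w)).
  apply: etrans (congr1 (fun m : RN (av g w) => (m : res_space N _) g w erefl) E) _.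
  exact: (@res_transport x (s^-1 * g)%g w _ _
    (res_act_subproof (avVK rho s (av g w)) (erefl (av g w))) erefl).
Qed.

Lemma total_restriction : tiso full (total RN) IN.
Proof.
have phiK : cancel res_to_ind ind_to_res.
  move=> x; apply: dprod_ext => v; apply: res_ext => g w e.
  exact: (@res_transport x g w _ _ erefl e).
have psiK : cancel ind_to_res res_to_ind.
  by move=> y; apply: ind_ext => g; apply: dprod_ext => w.
have hphi := res_to_ind_hom.
exact: (tiso_intro hphi phiK psiK).
Qed.
End Restriction.

End TotalSpace.

(** * The Dynkin diagrams *)

Section Weights.
Variable Gamma : quiver.
Local Notation V := (vert Gamma).

(* For the Dynkin diagrams h is a multiple of the sum of the positive roots, on
   which the Cartan matrix takes a constant positive value. *)
Definition weighted (h : V -> int) : Prop :=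
  [/\ forall v : V, nedges v v = 0%N, forall u v : V, (nedges u v <= 1)%N,
      forall v, 0 < h v & forall v, 1 <= 2 * h v - \sum_u (nedges v u)%:Z * h u].

Lemma sum_pick n c (w : nat -> int) :
  \sum_(j < n) (j == c :> nat)%:Z * w j = if (c < n)%N then w c else 0.
Proof.
case: ltnP => [lt_cn|le_nc].
  rewrite (bigD1 (Ordinal lt_cn)) //= eqxx mul1r big1 ?addr0 // => j jc.
  by rewrite (_ : (j == c :> nat) = false) ?mul0r //; apply: contraNF jc => /eqP jc; apply/eqP/val_inj.
by rewrite big1 // => j _; rewrite (_ : (j == c :> nat) = false) ?mul0r //; have := ltn_ord j; lia.
Qed.

Lemma graph_weighted n (adj : rel nat) (w : nat -> int) :
  underlying_graph_iso Gamma n adj -> (forall i, (i < n)%N -> ~~ adj i i) ->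
  (forall i, (i < n)%N -> 0 < w i) ->
  (forall i, (i < n)%N -> 1 <= 2 * w i - \sum_(j < n) (adj i j)%:Z * w j) ->
  exists h, weighted h.
Proof.
move=> [f fbij fP] adj0 w0 wP; exists (fun v => w (f v)); split=> [v|u v|v|v].
- by rewrite fP (negPf (adj0 _ _)).
- by rewrite fP leq_b1.
- exact: w0.
- have := wP (f v) (ltn_ord _); rewrite (reindex f) /=; last exact: onW_bij.
  by under eq_bigr do rewrite -fP.
Qed.

Lemma type_A_weighted : type_A Gamma -> exists h, weighted h.
Proof.
(* The coefficients of the sum of the positive roots: (i + 1)(n - i) intervals of the path contain
   i. *)
move=> [n n0 iso]; pose w i : int := (i%:Z + 1) * (n%:Z - i%:Z).
apply: (graph_weighted (w := w) iso) => i lt_in.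
- by rewrite /adjA; lia.
- by rewrite /w; nia.
have -> : \sum_(j < n) (adjA i j)%:Z * w j =
    \sum_(j < n) (j == i.+1 :> nat)%:Z * w j + \sum_(j < n) (0 < i)%N%:Z * ((j == i.-1 :> nat)%:Z * w j).
  rewrite -big_split; apply: eq_bigr => j _ /=; rewrite /adjA mulrA -mulrDl; congr (_ * _).
  by case: (posnP i) => i0; rewrite ?i0; lia.
rewrite -mulr_sumr !sum_pick /w; case: i lt_in => [|i] lt_in /=.
  by rewrite mul0r; case: ltnP => le_i; nia.
by rewrite mul1r; case: ltnP => le_i; case: ltnP => le_i'; nia.
Qed.

Lemma branch_sum n k i (w : nat -> int) : (k.+1 < n)%N -> (i < n)%N ->
  \sum_(j < n) (adj_branch n k i j)%:Z * w j =
  if i == n.-1 then w k else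
    (if (i.+2 < n)%N then w i.+1 else 0) + (if (0 < i)%N then w i.-1 else 0) + (if i == k then w n.-1 else 0).
Proof.
move=> lt_kn lt_in; case: eqP => [->|/eqP in1].
  rewrite (eq_bigr (fun j : 'I_n => (j == k :> nat)%:Z * w j)) => [|j _].
    by rewrite sum_pick; case: ltnP; lia.
  suff -> : adj_branch n k n.-1 j = (j == k :> nat) by [].
  rewrite /adj_branch ltnn andbF /= eqxx /= (_ : (n.-1 == k) = false) ?andbF ?orbF //.
  by apply/eqP; lia.
have -> : \sum_(j < n) (adj_branch n k i j)%:Z * w j =
    \sum_(j < n) ((i.+2 < n)%N%:Z * ((j == i.+1 :> nat)%:Z * w j)
     + (0 < i)%N%:Z * ((j == i.-1 :> nat)%:Z * w j) + (i == k)%:Z * ((j == n.-1 :> nat)%:Z * w j)).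
  apply: eq_bigr => j _; rewrite !mulrA -!mulrDl; congr (_ * _).
  have lt_jn := ltn_ord j; have lt_i : (i < n.-1)%N by lia.
  rewrite /adj_branch /adjA lt_i (negPf in1) andbT /=.
  by do ?case: eqP => ?; do ?case: ltnP => ? //=; lia.
rewrite !big_split /= -!mulr_sumr !sum_pick.
by case: (ltnP i.+2 n) => ?; case: (posnP i) => ?; case: (eqVneq i k) => ?; do !(case: ltnP => ?); lia.
Qed.

Lemma branch_irrefl n k i : (k.+1 < n)%N -> ~~ adj_branch n k i i.
Proof. by rewrite /adj_branch /adjA; lia. Qed.

Lemma type_D_weighted : type_D Gamma -> exists h, weighted h.
Proof.
move=> [n n3 iso].
(* Twice the sum of the positive roots, which clears the denominator of n(n - 1)/2 at the vertices n
   - 2 and n - 1. *)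
pose w i : int := if (i < n - 2)%N then 2 * (i%:Z + 1) * (2 * n%:Z - 2 - i%:Z) else n%:Z * (n%:Z - 1).
have kn : ((n - 3).+1 < n)%N by lia.
apply: (graph_weighted (w := w) iso) => i lt_in; first exact: branch_irrefl.
  by rewrite /w; case: ltnP => _; nia.
rewrite branch_sum // /w; case: eqP => [->|in1].
  by do !(case: ltnP => ?); nia.
case: eqP => ik; do !(case: ltnP => ?); nia.
Qed.

Lemma type_E_weighted : type_E Gamma -> exists h, weighted h.
Proof.
move=> [n n678 iso].
(* The coefficients of the sum of the positive roots, along the path and with the attached vertex
   last. *)
pose ws : seq nat := if n == 6%N then [:: 16; 30; 42; 30; 16; 22] else
  if n == 7%N then [:: 34; 66; 96; 75; 52; 27; 49] else [:: 92; 182; 270; 220; 168; 114; 58; 136].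
pose w i : int := (nth 0%N ws i)%:Z.
apply: (graph_weighted (w := w) iso) => i lt_in.
- by apply: branch_irrefl; move: n678; rewrite !inE => /or3P[] /eqP->.
- move: n678 lt_in; rewrite /w /ws !inE => /or3P[] /eqP-> /=; by do 8?[case: i => [//|i]].
- rewrite branch_sum //; last by move: n678; rewrite !inE => /or3P[] /eqP->.
  move: n678 lt_in; rewrite /w /ws !inE => /or3P[] /eqP-> /=; by do 8?[case: i => [//|i]].
Qed.

Lemma ADE_weighted : type_ADE Gamma -> exists h, weighted h.
Proof. by case; [apply: type_A_weighted | apply: type_D_weighted | apply: type_E_weighted]. Qed.

End Weights.

(** * The bijection *)

Section SimpleGraph.
Variable Gamma : quiver.
Hypothesis nedges_le1 : forall u v : vert Gamma, (nedges u v <= 1)%N.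

Lemma simple_edge_inj (e e' : edge Gamma) : src e = src e' -> tgt e = tgt e' -> e = e'.
Proof.
move=> se te; have /card_le1_eqP := nedges_le1 (src e) (tgt e).
by apply; rewrite inE ?se ?te !eqxx.
Qed.

Lemma arr_orientation : (forall v : vert Gamma, nedges v v = 0%N) -> orientation (@arr Gamma).
Proof.
move=> nloop u v; have := nedges_le1 u v; rewrite /nedges; set E := [set _ | _].
have EE e : (e \in E) = ((src e == u) && (tgt e == v)) || ((src e == v) && (tgt e == u)).
  by rewrite inE.
have := nloop u; rewrite /nedges; set Eu := [set _ | _] => Eu0.
case: (set_0Vmem E) => [E0|[e eE]].
  rewrite E0 cards0 => _; symmetry; apply/eqP; rewrite addn_eq0 !eqb0.
  apply/andP; split; apply/negP => /existsP[e /andP[se te]].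
    by have := EE e; rewrite E0 inE se te.
  by have := EE e; rewrite E0 inE se te orbT.
have uv : u != v.
  apply/eqP => uv; have : e \in Eu by move: eE; rewrite !inE -uv.
  by move/eqP: Eu0; rewrite cards_eq0 => /eqP->; rewrite inE.
move=> le1; have /card_le1_eqP E1 := le1.
have -> : #|E| = 1%N by apply/eqP; rewrite eqn_leq le1 card_gt0; apply/set0Pn; exists e.
suff -> : @arr Gamma u v = ~~ @arr Gamma v u by case: (arr v u).
have [/existsP[e1 e1P]|nvu] := boolP (@arr Gamma v u).
  rewrite /=; apply/existsP => -[e2 e2P].
  have e12 : e1 = e2 by apply: E1; rewrite EE ?e1P ?e2P ?orbT.
  move: e1P e2P; rewrite e12 => /andP[/eqP-> _] /andP[/eqP vu _].
  by rewrite vu eqxx in uv.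
move: eE; rewrite EE => /orP[eP|eP]; first by apply/existsP; exists e.
by case/negP: nvu; apply/existsP; exists e.
Qed.
End SimpleGraph.

Section RootGalois.
Variables (K L : fieldType) (iota : {rmorphism K -> L}) (Gamma : quiver).
Variable rho : rational_structure iota Gamma.
Local Notation V := (vert Gamma).
Local Notation G := (Gal iota).
Local Notation av := (actv rho).
Local Notation vec := {ffun V -> int}.

Lemma arr_actv s (u v : V) : arr (av s u) (av s v) = arr u v.
Proof.
suff imp k x y : arr x y -> arr (av k x) (av k y).
  by apply/idP/idP => [/(imp s^-1%g)|/imp//]; rewrite !avK.
move=> /existsP[e /andP[/eqP<- /eqP<-]]; apply/existsP; exists (acte rho k e).
by rewrite src_act tgt_act !eqxx.
Qed.

Lemma act_rootE s (a : vec) : act_root rho s a = sact rho s a.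
Proof.
apply/ffunP => w; rewrite sum_ffunE ffunE (bigD1 (av s^-1%g w)) //= ffun_mulz ffunE avVK eqxx mul1r.
rewrite big1 ?addr0 // => v vw; rewrite ffun_mulz ffunE.
by rewrite (_ : (w == av s v) = false) ?mul0r //; apply: contraNF vw => /eqP->; rewrite avK.
Qed.

(** The stabilizer is open because it contains all elements acting trivially on the vertices, so the
    Galois correspondence applies to it. *)
Lemma gal_over_definition_field (a : vec) : algebraic_extension iota ->
  gal_over (definition_field rho a) = stab rho a.
Proof.
move=> algL; have stabE : root_stabilizer rho a = stab rho a.
  by apply/funext => s; rewrite /root_stabilizer act_rootE.
have [xs xsP] := stab_open rho a.
apply/funext => s; apply/propext; rewrite /definition_field stabE; split=> [|Hs x]; last exact.
exact: (open_subgroup_closed algL (stab_subgroup rho a) xsP).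
Qed.

Lemma gal_over_whole_field : gal_over (@whole_field L) = @triv K L iota.
Proof.
apply/funext => s; apply/propext; split=> [s1|-> x _ //].
by apply: gal_ext => x; apply: s1.
Qed.

Lemma ind_tiso_eq (H H' : G -> Prop) B A (gB : galois rho H B) (gA : galois rho H' A) :
  H = H' -> tiso H B A -> tiso full (ind gB) (ind gA).
Proof. by move=> HH'; case: _ / HH' gA => gA; apply: ind_tiso. Qed.

Lemma oriented_eq (e e' : rel V) (M : trep iota Gamma) : e =2 e' -> oriented e M -> oriented e' M.
Proof. by move=> ee' oM u v x; rewrite -ee'; apply: oM. Qed.
End RootGalois.

Section Main.
Variables (K L : fieldType) (iota : {rmorphism K -> L}) (Gamma : quiver).
Variable rho : rational_structure iota Gamma.
Hypothesis algL : algebraic_extension iota.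
Local Notation V := (vert Gamma).
Local Notation G := (Gal iota).
Local Notation av := (actv rho).
Local Notation vec := {ffun V -> int}.
Variable h : V -> int.
Hypothesis nloop : forall v : V, nedges v v = 0%N.
Hypothesis nedges_le1 : forall u v : V, (nedges u v <= 1)%N.
Hypothesis h_gt0 : forall v, 0 < h v.
Hypothesis kk_h : forall v, 1 <= 2 * h v - \sum_u (nedges v u)%:Z * h u.

Local Notation arr := (@arr Gamma).
Let edge_inj := simple_edge_inj nedges_le1.
Let arrP := arr_orientation nedges_le1 nloop.
(** A multiple of the period, so that the orientation at time T is that of the quiver, and large
    enough for every positive root to become simple before time 0 is reached. *)
Let T := (window h * period Gamma)%N.
Let leT : (window h <= T)%N. Proof. exact: leq_pmulr. Qed.
Let arrT : arrow arr T =2 arr := @arrowK Gamma arr (window h).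
Local Notation K0 := (base_field iota).
Implicit Types (a : vec) (M : rat_rep rho K0) (s : G).

Lemma totalT F (N : rat_rep rho F) : good rho (gal_over F) (arrow arr T) (total N).
Proof.
split; first exact: total_galois.
apply: oriented_eq (@total_oriented _ _ _ _ _ _ N); by move=> u v; rewrite arrT.
Qed.

Lemma positive_root_vec a : is_positive_root a -> root_vec a.
Proof. by move=> [ra a0]; split=> //; apply: bform_root. Qed.

(** The tower belongs to the data because the orbit of a is recovered from it. *)
Definition induced_from a M : Prop :=
  exists A (gA : galois rho (stab rho a) A),
    [/\ root_rep rho arr (stab rho a) T a A, tindec full (ind gA), tcont full (ind gA),
        root_tower arr T gA & tiso full (total M) (ind gA)].

Lemma induced_exists a : is_positive_root a ->
  exists M, [/\ rep_continuous M, indecomposable M & induced_from a M].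
Proof.
move=> /positive_root_vec va.
have [A [gA [rA iA cA tA]]] := root_rep_exists algL nloop h_gt0 kk_h arrP (arr_actv rho) leT va.
have gI : good rho (gal_over K0) arr (ind gA).
  rewrite gal_over_baseE; apply: ind_good; first exact: arr_actv.
  exact: oriented_eq arrT (root_good rA).2.
have iso := total_part edge_inj gI; exists (part gI); split.
- by apply/tcont_total; apply: tiso_tcont (tiso_sym iso) _; rewrite gal_over_baseE.
- apply/(indecomposable_total edge_inj); apply: tiso_tindec (tiso_sym iso) _.
  by rewrite gal_over_baseE.
- by exists A, gA; split=> //; rewrite -[full](gal_over_baseE iota).
Qed.

Lemma induced_iso a s M M' : induced_from a M -> induced_from (sact rho s a) M' -> rep_iso M M'.
Proof.
move=> [A [gA [rA iA cA tA MA]]] [A' [gA' [rA' iA' cA' tA' MA']]].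
apply/(rep_iso_total edge_inj); rewrite gal_over_baseE; apply: tiso_trans MA _.
apply: tiso_trans (tiso_sym MA').
apply: (tower_tiso algL nloop h_gt0 kk_h arrP (arr_actv rho) _ _ iA iA' cA cA' tA tA').
  exact: (root_good rA).2.
exact: (root_good rA').2.
Qed.

Lemma induced_iso_same a M M' : induced_from a M -> induced_from a M' -> rep_iso M M'.
Proof. by move=> aM aM'; apply: (@induced_iso a 1%g) => //; rewrite sact1. Qed.

Lemma induced_orbit a a' M M' : induced_from a M -> induced_from a' M' -> rep_iso M M' ->
  exists s, a' = sact rho s a.
Proof.
move=> [A [gA [_ _ _ tA MA]]] [A' [gA' [_ _ _ tA' MA']]].
move=> /(rep_iso_total edge_inj); rewrite gal_over_baseE => MM'.
apply: (tower_orbit nloop h_gt0 kk_h arrP (arr_actv rho) leT tA tA').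
exact: tiso_trans (tiso_sym MA) (tiso_trans MM' MA').
Qed.

Lemma root_rep_tindec (H : G -> Prop) a A : subgroup H -> root_rep rho arr H T a A -> tindec H A.
Proof. by move=> sH rA; apply: tindec_sub (root_indec rA) => s ->; apply: sub1. Qed.

Lemma induced_cover M : rep_continuous M -> indecomposable M ->
  exists2 a, is_positive_root a & induced_from a M.
Proof.
move=> /tcont_total cM /(indecomposable_total edge_inj) iM; have gM := totalT M.
rewrite gal_over_baseE in cM iM gM.
have [a [va ra [A [gA [rA MA]]]]] :=
  indecomposable_induced algL nloop h_gt0 kk_h arrP (arr_actv rho) leT gM cM iM.
exists a; first by case: va.
have [A' [gA' [rA' iA' cA' tA']]] := root_rep_exists algL nloop h_gt0 kk_h arrP (arr_actv rho) leT va.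
exists A', gA'; split=> //; apply: tiso_trans MA _; apply: ind_tiso.
have sH := stab_subgroup rho a.
by apply: (tdim_tiso algL nloop h_gt0 kk_h arrP (arr_actv rho) sH (root_good rA) (root_good rA')
  (root_cont rA) (root_cont rA') (root_rep_tindec sH rA) (root_rep_tindec sH rA')
  (root_dim rA) (root_dim rA')).
Qed.

(** N and the root representation A are continuous over the stabilizer of a, indecomposable, and of
    dimension vector a, hence isomorphic; restriction of scalars of N is induction by
    [total_restriction]. *)
Lemma induced_restriction a (N : rat_rep rho (definition_field rho a)) :
  is_positive_root a -> rep_continuous N -> tindec (@triv K L iota) (total N) ->
  tdim (total N) a -> induced_from a (restriction_of_scalars N).
Proof.
move=> /positive_root_vec va /tcont_total cN iN dN.
have [A [gA [rA iA cA tA]]] := root_rep_exists algL nloop h_gt0 kk_h arrP (arr_actv rho) leT va.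
exists A, gA; split=> //; apply: tiso_trans (total_restriction edge_inj N) _.
have HE := gal_over_definition_field rho a algL.
have gN := totalT N; have sH := stab_subgroup rho a.
apply: ind_tiso_eq => //; rewrite HE in cN gN *.
apply: (tdim_tiso algL nloop h_gt0 kk_h arrP (arr_actv rho) sH gN (root_good rA)
  cN (root_cont rA) _ (root_rep_tindec sH rA) dN (root_dim rA)).
by apply: tindec_sub iN => s ->; apply: sub1.
Qed.

Lemma total_base_change F (N : rat_rep rho F) :
  tiso (@triv K L iota) (total (base_change_top N)) (total N).
Proof.
have gN := total_galois edge_inj N; have gX := total_galois edge_inj (base_change_top N).
pose f : {linear total (base_change_top N) -> total N} :=
  mklin (f := fun x : dprod N => x) (fun c x y => erefl).
pose g : {linear total N -> total (base_change_top N)} :=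
  mklin (f := fun x : dprod N => x) (fun c x y => erefl).
exists f, g; split=> //; split=> // s -> x.
  by rewrite (gal_oneE gN) (gal_oneE gX).
by rewrite (gal_oneE gN) (gal_oneE gX).
Qed.

Lemma form_exists a : is_positive_root a -> exists N : rat_rep rho (definition_field rho a),
  [/\ rep_continuous N, tindec (@triv K L iota) (total N) & tdim (total N) a].
Proof.
move=> /positive_root_vec va; have sH := stab_subgroup rho a.
have HE := gal_over_definition_field rho a algL.
have [A [gA [rA iA cA tA]]] := root_rep_exists algL nloop h_gt0 kk_h arrP (arr_actv rho) leT va.
have gF : good rho (gal_over (definition_field rho a)) arr A.
  by rewrite HE; split=> //; apply: oriented_eq arrT (root_good rA).2.
have iso := tiso_sym (total_part edge_inj gF); exists (part gF); split.
- by apply/tcont_total; apply: tiso_tcont iso _; rewrite HE; apply: root_cont rA.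
- apply: tiso_tindec (root_indec rA); apply: tiso_sub iso => s ->.
  by move=> x _.
- exact: tdim_iso iso (root_dim rA).
Qed.

Lemma indecomposable_top (X : rat_rep rho (@whole_field L)) :
  indecomposable X <-> tindec (@triv K L iota) (total X).
Proof. by rewrite (indecomposable_total edge_inj) gal_over_whole_field. Qed.

Lemma top_iso a (X Y : rat_rep rho (@whole_field L)) :
  tindec (@triv K L iota) (total X) -> tdim (total X) a ->
  tindec (@triv K L iota) (total Y) -> tdim (total Y) a -> rep_iso X Y.
Proof.
move=> iX dX iY dY; apply/(rep_iso_total edge_inj).
have gX := totalT X; have gY := totalT Y; rewrite gal_over_whole_field in gX gY *.
exact: (tdim_tiso algL nloop h_gt0 kk_h arrP (arr_actv rho) (@triv_subgroup _ _ iota) gX gY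
  (triv_tcont gX.1) (triv_tcont gY.1)).
Qed.

(** A form of X becomes isomorphic to X over L, so it is indecomposable there with dimension vector
    a, and [induced_restriction] treats all forms alike. *)
Lemma induced_attached a M : is_positive_root a -> induced_from a M -> attached a (rep_iso M).
Proof.
move=> pa aM; have [N0 [cN0 iN0 dN0]] := form_exists pa.
have iso0 := tiso_sym (total_base_change N0).
have iX := tiso_tindec iso0 iN0; have dX := tdim_iso iso0 dN0.
exists (base_change_top N0); split.
- exact/indecomposable_top.
- exact/tdim_total.
- by move=> Y /indecomposable_top iY /tdim_total dY; apply: (top_iso iX dX iY dY).
- by exists N0; split=> //; apply: (top_iso iX dX iX dX).
move=> N [cN /(rep_iso_total edge_inj)]; rewrite gal_over_whole_field => XN.
have iso := tiso_trans (tiso_sym XN) (total_base_change N).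
by apply: (induced_iso_same aM); apply: induced_restriction (tiso_tindec iso iX) (tdim_iso iso dX).
Qed.

Lemma root_orbit_self a : root_orbit rho a a.
Proof. by exists 1%g; rewrite act_rootE sact1. Qed.

Lemma root_orbitE a b : root_orbit rho a b -> root_orbit rho b = root_orbit rho a.
Proof.
move=> [s ->]; rewrite act_rootE; apply/funext => c; apply/propext; split=> -[t ->].
  by exists (t * s)%g; rewrite !act_rootE sactM.
by exists (t * s^-1)%g; rewrite !act_rootE -sactM -mulgA mulVg mulg1.
Qed.

Definition root_orbit_of a (pa : is_positive_root a) : positive_root_orbit rho :=
  exist _ (root_orbit rho a) (ex_intro2 _ _ a pa erefl).

Definition attached_rep (O : positive_root_orbit rho) : rat_rep rho K0 :=
  projT1 (cid (induced_exists (s2valP (cid2 (svalP O))))).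

Lemma attached_repP (O : positive_root_orbit rho) :
  [/\ rep_continuous (attached_rep O), indecomposable (attached_rep O)
    & induced_from (s2val (cid2 (svalP O))) (attached_rep O)].
Proof. by rewrite /attached_rep; case: (cid (induced_exists _)). Qed.

(** The class does not depend on the root of the orbit chosen in [attached_rep]. *)
Lemma orbit_induced (O : positive_root_orbit rho) a M : is_positive_root a ->
  sval O a -> induced_from a M -> rep_iso (attached_rep O) M.
Proof.
have [_ _] := attached_repP O; case: (cid2 _) => b /= pb Ob bN pa.
by rewrite Ob => -[s ->]; rewrite act_rootE; apply: induced_iso bN.
Qed.


Lemma orbit_positive (O : positive_root_orbit rho) a : sval O a -> is_positive_root a.
Proof.
have [b pb ->] := svalP O => -[s ->]; rewrite act_rootE.
exact: (positive_root_sact nloop arrP (arr_actv rho)).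
Qed.

Lemma rep_iso_class M M' : rep_iso M M' -> rep_iso M = rep_iso M'.
Proof.
move=> /(rep_iso_total edge_inj) iso; apply/funext => N; apply/propext.
split=> /(rep_iso_total edge_inj) iso'; apply/(rep_iso_total edge_inj).
  exact: tiso_trans (tiso_sym iso) iso'.
exact: tiso_trans iso iso'.
Qed.

Lemma rep_iso_self M : rep_iso M M.
Proof. by apply/(rep_iso_total edge_inj); apply: tiso_refl. Qed.

Lemma attached_class_subproof (O : positive_root_orbit rho) :
  exists M, [/\ rep_continuous M, indecomposable M & rep_iso (attached_rep O) = rep_iso M].
Proof. by have [cM iM _] := attached_repP O; exists (attached_rep O). Qed.

Definition attached_class (O : positive_root_orbit rho) : indecomposable_class rho :=
  exist _ (rep_iso (attached_rep O)) (attached_class_subproof O).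

Lemma class_eq (C C' : indecomposable_class rho) : sval C = sval C' -> C = C'.
Proof.
case: C C' => [C cP] [C' cP'] /= CC'; case: _ / CC' cP' => cP'.
by rewrite (Prop_irrelevance cP cP').
Qed.

Lemma orbit_eq (O O' : positive_root_orbit rho) : sval O = sval O' -> O = O'.
Proof.
case: O O' => [O oP] [O' oP'] /= OO'; case: _ / OO' oP' => oP'.
by rewrite (Prop_irrelevance oP oP').
Qed.

Lemma attached_class_inj : injective attached_class.
Proof.
move=> O O' /(congr1 sval) /= OO'; apply: orbit_eq.
have [_ _] := attached_repP O; have [_ _] := attached_repP O'.
case: (cid2 (svalP O)) => a /= _ ->; case: (cid2 (svalP O')) => a' /= _ -> a'M' aM.
have MM' : rep_iso (attached_rep O) (attached_rep O') by rewrite OO'; apply: rep_iso_self.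
have [s a'E] := induced_orbit aM a'M' MM'.
by apply/esym/root_orbitE; exists s; rewrite act_rootE.
Qed.

Lemma attached_class_surj C : exists O, attached_class O = C.
Proof.
have [M [cM iM CM]] := svalP C; have [a pa aM] := induced_cover cM iM.
exists (root_orbit_of pa); apply: class_eq; rewrite CM; apply: rep_iso_class.
exact: (@orbit_induced (root_orbit_of pa) a M pa (root_orbit_self a) aM).
Qed.

Lemma attached_class_bij : bijective attached_class.
Proof.
exists (fun C => projT1 (cid (attached_class_surj C))) => [O|C]; case: cid => //= O'.
exact: attached_class_inj.
Qed.

Lemma attached_classP (O : positive_root_orbit rho) a :
  sval O a -> attached a (sval (attached_class O)).
Proof.
move=> Oa; have pa := orbit_positive Oa; have [M [_ _ aM]] := induced_exists pa.
by rewrite /= (rep_iso_class (orbit_induced pa Oa aM)); apply: induced_attached.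
Qed.

Lemma finitely_many_classes : representation_finite rho.
Proof.
(* [C0] is the default value at vectors that are not positive roots; without any class the empty
   enumeration serves. *)
have [[C0]|noC] := pselect (inhabited (indecomposable_class rho)); last first.
  have f0 (i : 'I_0) : indecomposable_class rho by case: i.
  by exists 0%N, f0 => C; case: noC.
(* By [root_bound] the coefficients of a positive root lie between 0 and B. *)
pose B := \max_v absz (2 * h v)%R.
pose vec_of (x : {ffun V -> 'I_B.+1}) : vec := [ffun v => (x v)%:Z].
pose class_of x := if pselect (is_positive_root (vec_of x)) is left px
  then attached_class (root_orbit_of px) else C0.
exists #|{: {ffun V -> 'I_B.+1}}|, (fun i => class_of (enum_val i)) => C.
have [O <-] := attached_class_surj C; have [a pa OE] := svalP O.
have aB v : (absz (a v) < B.+1)%N.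
  rewrite ltnS; apply: leq_trans (leq_bigmax v); rewrite -lez_nat abszE abszE.
  have [_ /(root_bound h_gt0 kk_h v) av] := positive_root_vec pa.
  exact: le_trans av (ler_norm _).
pose x : {ffun V -> 'I_B.+1} := [ffun v => Ordinal (aB v)].
have xE : vec_of x = a.
  by apply/ffunP => v; rewrite !ffunE /= gez0_abs //; case: pa.
exists (enum_rank x); rewrite enum_rankK /class_of; case: pselect => [px|]; last by rewrite xE.
by congr attached_class; apply: orbit_eq; rewrite OE /= xE.
Qed.

End Main.

Theorem theorem2p3 (K L : fieldType) (iota : {rmorphism K -> L}) (Gamma : quiver)
    (rho : rational_structure iota Gamma) :
  [pchar K] =i pred0 -> galois_extension iota ->
  connected_quiver Gamma -> type_ADE Gamma ->
  representation_finite rho /\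
  exists Phi : positive_root_orbit rho -> indecomposable_class rho,
    bijective Phi /\
    forall (O : positive_root_orbit rho) (a : {ffun vert Gamma -> int}),
      sval O a -> attached a (sval (Phi O)).
Proof.
move=> _ [algL _ _] _ /ADE_weighted[h [nloop nedges_le1 h_gt0 kk_h]].
split; first exact: (finitely_many_classes rho algL nloop nedges_le1 h_gt0 kk_h).
exists (attached_class algL nloop nedges_le1 h_gt0 kk_h).
split; first exact: attached_class_bij.
exact: attached_classP.
Qed.
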